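(* Let $X_1,X_2,\dots$ be iid with parent random variable $X$ having finite mean $\mu$ and variance $\sigma^2$. Let $0<p_1<\dots<p_m<1$ and $r\in\{1,2\}$. Assume $F_X$ is differentiable at each $q_X(p_i)$ with $f_X(q_X(p_i))>0$, $\mathbb{E}[X^{2r}]<\infty$, and, if $r=1$, the density $f_X$ exists and is positive at $\mu$. Let $h=(h_1,\dots,h_{m+1}):\mathbb{R}^{m+1}\to\mathbb{R}^{m+1}$ have continuous components, differentiable at $z_0=(q_X(p_1),\dots,q_X(p_m),m(X,r))$, with Jacobian $J$ at $z_0$. Let $\hat z_n=(q_n(p_1),\dots,q_n(p_m),\hat m(X,n,r))$. Then $$\sqrt n\big(h(\hat z_n)-h(z_0)\big)\xrightarrow{d}\mathcal N\big(0,\,J\,\Sigma^{(m,r)}J^{t}\big),$$ where $\Sigma^{(m,r)}$ is the $(m+1)\times(m+1)$ symmetric matrix $$\Sigma^{(m,r)}=\begin{pmatrix}\Sigma^{(m)} & s(X,r)\\ s(X,r)^t & \operatorname{Var}\big(|X-\mu|^r+(2-r)(2F_X(\mu)-1)X\big)\end{pmatrix},$$ with $\Sigma^{(m)}_{ij}=\Sigma^{(m)}_{ji}=\frac{p_i(1-p_j)}{f_X(q_X(p_i))f_X(q_X(p_j))}$ for $1\le i\le j\le m$, and $s(X,r)\in\mathbb{R}^m$ with $i$-th entry $\frac{\tau_r(|X-\mu|,p_i)+(2-r)(2F_X(\mu)-1)\tau_1(p_i)}{f_X(q_X(p_i))}$.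
   Context: $F_X,f_X$ cdf and density of $X$; $q_X(p)=\inf\{x:F_X(x)\ge p\}$; $q_n(p)=X_{(\lceil np\rceil)}$; $\bar X_n=\frac1n\sum X_i$; $m(X,r)=\mathbb{E}|X-\mu|^r$; $\hat m(X,n,r)=\frac1n\sum_{i=1}^n|X_i-\bar X_n|^r$ (for $r=1$ the sample MAD, for $r=2$ the sample variance up to the asymptotically irrelevant factor $\frac{n-1}{n}$). For continuous $\eta$, $\tau_k(\eta(X),p):=(1-p)\big(\mathbb{E}[\eta^k(X)\mid X>q_X(p)]-\mathbb{E}[\eta^k(X)]\big)$, $\tau_k(p):=\tau_k(X,p)$. $A^t$ denotes transpose. *)

(* Defs.v *)
From HB Require Import structures.
From mathcomp Require Import all_boot all_order all_algebra.
From mathcomp Require Import all_classical all_reals all_analysis.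

Set Implicit Arguments.
Unset Strict Implicit.
Unset Printing Implicit Defensive.

Import Order.TTheory GRing.Theory Num.Theory.
Import numFieldNormedType.Exports.

Local Open Scope classical_set_scope.
Local Open Scope ring_scope.

Section sample_defs.
Context {d : measure_display} {T : measurableType d} {R : realType}
  (P : probability T R).

Definition cdfR (X : {RV P >-> R}) (x : R) : R := fine (cdf X x).

(** f_X(x) : the density, i.e. the derivative of F_X at x
    (used only at points where F_X is assumed differentiable) *)
Definition dens (X : {RV P >-> R}) (x : R) : R := derive1 (cdfR X) x.

Definition quantile (X : {RV P >-> R}) (p : R) : R :=
  inf [set x | p <= cdfR X x].

Definition meanR (Y : T -> R) : R := fine ('E_P[Y])%E.

Definition cmoment (X : T -> R) (r : nat) : R :=
  meanR (fun w => `|X w - meanR X| ^+ r).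

(** sample mean of X_1..X_n, where X_k is [X (k-1)] *)
Definition sample_mean (X : nat -> T -> R) (n : nat) (w : T) : R :=
  n%:R^-1 * \sum_(i < n) X i w.

Definition sample_cmoment (X : nat -> T -> R) (n r : nat) (w : T) : R :=
  n%:R^-1 * \sum_(i < n) `|X i w - sample_mean X n w| ^+ r.

(** k-th order statistic X_(k) (1-based) of X_1..X_n *)
Definition order_stat (X : nat -> T -> R) (n k : nat) (w : T) : R :=
  nth 0 (sort <=%R [seq X i w | i <- iota 0 n]) k.-1.

Definition sample_quantile (X : nat -> T -> R) (n : nat) (p : R) (w : T) : R :=
  order_stat X n `|Num.ceil (n%:R * p)|%N w.

Definition cond_exp_above (Y X : T -> R) (q : R) : R :=
  meanR (fun w => Y w * (if q < X w then 1 else 0)) / fine (P [set w | q < X w]).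

(** tau_k(eta(X), p) = (1-p) (E[eta^k(X) | X > q_X(p)] - E[eta^k(X)]),
    where [Y] is the random variable eta(X) *)
Definition tau (X : {RV P >-> R}) (Y : T -> R) (k : nat) (p : R) : R :=
  (1 - p) * (cond_exp_above (fun w => Y w ^+ k) X (quantile X p)
             - meanR (fun w => Y w ^+ k)).

Definition mutually_independent (X : nat -> T -> R) : Prop :=
  forall (n : nat) (B : nat -> set R), (forall i, measurable (B i)) ->
    P (\big[setI/setT]_(i < n) (X i @^-1` B i)) =
    (\prod_(i < n) P (X i @^-1` B i))%E.

Definition identically_distributed (X : nat -> T -> R) : Prop :=
  forall (i : nat) (B : set R), measurable B ->
    P (X i @^-1` B) = P (X 0%N @^-1` B).

End sample_defs.

(** Z : T' -> R^k is a centered Gaussian vector with covariance matrix C,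
    defined via its characteristic function:
    E[exp(i <t,Z>)] = exp(- t C t^T / 2) for all t. *)
Definition gaussian_vector {d' : measure_display} {T' : measurableType d'}
  {R : realType} (Q : probability T' R) (k : nat) (C : 'M[R]_k)
  (Z : T' -> 'rV[R]_k) : Prop :=
  (forall i, measurable_fun setT (fun w => Z w ord0 i)) /\
  forall t : 'rV[R]_k,
    ('E_Q[fun w => cos ((t *m (Z w)^T) ord0 ord0)])%E =
      (expR (- ((t *m C *m t^T) ord0 ord0) / 2))%:E /\
    ('E_Q[fun w => sin ((t *m (Z w)^T) ord0 ord0)] = 0)%E.

Definition cvg_in_law_normal {d : measure_display} {T : measurableType d}
  {R : realType} (P : probability T R) (k : nat)
  (Y : nat -> T -> 'rV[R]_k) (C : 'M[R]_k) : Prop :=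
  forall (d' : measure_display) (T' : measurableType d')
         (Q : probability T' R) (Z : T' -> 'rV[R]_k),
    gaussian_vector Q C Z ->
    forall g : 'rV[R]_k -> R, continuous g ->
      (exists M : R, forall v, `|g v| <= M) ->
      ('E_P[fun w => g (Y n w)])%E @[n --> \oo] --> ('E_Q[fun w => g (Z w)])%E.

Section sigma.
Context {d : measure_display} {T : measurableType d} {R : realType}
  (P : probability T R).

Definition Sigma_mr (X : {RV P >-> R}) (m : nat) (p : 'I_m -> R) (r : nat)
  : 'M[R]_(m + 1) :=
  let mu := meanR P X in
  let q i := quantile X (p i) in
  let f i := dens X (q i) in
  let c := (2 - r%:R) * (2 * cdfR X mu - 1) in
  let Sm : 'M[R]_m := \matrix_(i, j)
      ((if (i <= j)%N then p i * (1 - p j) else p j * (1 - p i)) / (f i * f j)) in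
  let s : 'cV[R]_m := \col_i
      ((tau X (fun w => `|X w - mu|) r (p i) + c * tau X X 1 (p i)) / f i) in
  let v : 'M[R]_1 := \matrix_(_, _)
      fine (variance P (fun w => `|X w - mu| ^+ r + c * X w)) in
  block_mx Sm s s^T v.

Definition z0_vec (X : {RV P >-> R}) (m : nat) (p : 'I_m -> R) (r : nat)
  : 'rV[R]_(m + 1) :=
  row_mx (\row_i quantile X (p i)) (\row_(_ < 1) cmoment P X r).

Definition zhat_vec (X : nat -> {RV P >-> R}) (m : nat) (p : 'I_m -> R)
  (r n : nat) (w : T) : 'rV[R]_(m + 1) :=
  row_mx (\row_i sample_quantile (fun k => X k : T -> R) n (p i) w)
         (\row_(_ < 1) sample_cmoment (fun k => X k : T -> R) n r w).

End sigma.

(* Main.v *)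
Require Import Defs.
From HB Require Import structures.
From mathcomp Require Import all_boot all_order all_algebra.
From mathcomp Require Import all_classical all_reals all_analysis.
From mathcomp Require Import measurable_realfun ring lra zify.

Set Implicit Arguments.
Unset Strict Implicit.
Unset Printing Implicit Defensive.

Import Order.TTheory GRing.Theory Num.Theory.
Import numFieldNormedType.Exports.

Local Open Scope classical_set_scope.
Local Open Scope ring_scope.

(**
   Each estimator is replaced by a normalised sum of centred iid variables up to
   an error [o_P(1)].  For the sample quantiles this is the weak Bahadur
   representation, proved as in Ghosh's argument: [V_n <= t] is an event about
   the empirical distribution function at [q + t / sqrt n], which differs from
   the one about [W_n] by an increment whose variance tends to zero.  For the
   sample mean absolute deviation (resp. variance) one expands [|x - v|] (resp.
   [(x - v)^2]) around the mean.  The delta method then reduces the theorem to a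
   central limit theorem for the linear combinations of the influence functions,
   whose covariance matrix is [Sigma_mr].

   Since the limit is only known through its characteristic function, one needs
   that convergence of characteristic functions and tightness imply convergence
   of means of bounded continuous functions.  This follows from approximation by
   trigonometric polynomials: for the kernel [((1 + cos u) / 2)^N] the translates
   to [M > N] equidistant nodes add up to a constant, so that they form a finite
   partition of unity by nonnegative trigonometric polynomials, concentrated near
   the nodes.
*)

(** The test function is compared with its approximant under two laws, and the approximation is good
    only on a box. Outside the box the error is charged at the sup norms times a small probability,
    so the approximant must obey the same bound [C] on the whole space. A convex combination of
    values of [g] does so automatically, which is why a partition of unity is built instead of an
    abstract density theorem being applied.

    Independence is given only as a product formula for events about initial segments of the
    sequence. Bounded functions of one variable are reached through their level sets. For partial
    sums, the induction keeps a free product of indicators of the variables not yet summed, so that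
    the next variable can be split off.

    Truncating at a finite second moment rules out third-order Taylor remainders in the
    characteristic function. The second-order expansion is therefore obtained from dominated
    convergence, and an exact [n]-th power of an exponential serves as the comparison.

    Errors are handled by exceptional sets of small probability, so each expansion can be read
    pointwise off such a set. *)

(** * Trigonometric partitions of unity and approximation of continuous functions *)

Section cosine_kernel.
Context {R : realType}.
Implicit Types (u v a b : R) (n N M : nat).

Lemma cosM2 a b : 2 * (cos a * cos b) = cos (a + b) + cos (a - b).
Proof. by rewrite cosD cosB; ring. Qed.

(** Binomial expansion of the power of [e^(iv) + e^(-iv)] in real form. [cosM2] shifts the frequency
    up and down by one, and Pascal's rule collects the terms. *)
Lemma cos_pow_expand n v : (2 * cos v) ^+ n =
  \sum_(k < n.+1) 'C(n, k)%:R * cos ((n%:R - 2 * k%:R) * v).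
Proof.
elim: n => [|n IH].
  by rewrite big_ord1 expr0 bin0 mul1r mulr0 subr0 mul0r cos0.
rewrite exprS IH big_distrr/=.
under eq_bigr => k _.
  rewrite (_ : 2 * cos v * _ = 'C(n, k)%:R * cos ((n.+1%:R - 2 * k%:R) * v) +
    'C(n, k)%:R * cos ((n.+1%:R - 2 * k.+1%:R) * v)); last first.
    rewrite -mulrDr mulrCA; congr (_ * _).
    rewrite -mulrA cosM2 -[cos (v - _)]cosN; congr (cos _ + cos _);
      by rewrite -!natr1; ring.
  over.
rewrite big_split/= [RHS]big_ord_recl/= bin0 mul1r.
rewrite [X in X + _ = _]big_ord_recl/= bin0 mul1r -addrA; congr (_ + _).
under [RHS]eq_bigr => k _ do rewrite /bump/= add1n binS natrD mulrDl.
rewrite big_split/=; congr (_ + _).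
by rewrite [RHS]big_ord_recr/= bin_small// mul0r addr0; apply: eq_bigr.
Qed.

(** Multiplied by the sine of half the step, the sum telescopes along [h]. The arguments at the two
    ends differ by [2 * a * pi], and [sin (a * pi) = 0] makes the end values equal. *)
Lemma sum_cos_equidistributed a M u : (0 < M)%N -> sin (a * (pi / M%:R)) != 0 ->
  sin (a * pi) = 0 ->
  \sum_(j < M) cos (a * (u - 2 * pi * j%:R / M%:R)) = 0.
Proof.
move=> M0 s0 sa.
have MR : M%:R != 0 :> R by rewrite pnatr_eq0 -lt0n.
apply: (mulfI s0); rewrite mulr0 big_distrr/=.
pose h (j : nat) : R := - 2^-1 * sin (a * (u - (2 * j%:R - 1) * pi / M%:R)).
rewrite -(big_mkord xpredT (fun j => sin (a * (pi / M%:R)) *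
  cos (a * (u - 2 * pi * j%:R / M%:R)))) (telescope_sumr_eq h)//=.
  rewrite /h (_ : a * (u - (2 * M%:R - 1) * pi / M%:R) =
    a * (u - (2 * 0%:R - 1) * pi / M%:R) - (a * pi) - (a * pi)); last by field.
  rewrite !(sinB _ (a * pi)) !(cosB _ (a * pi)) sa !mulr0 !subr0 -mulrA -expr2.
  by rewrite cos2sin2 sa expr0n/= subr0 mulr1 subrr.
move=> j _; rewrite /h -mulrBr.
have -> : a * (u - (2 * j%:R - 1) * pi / M%:R) =
  a * (u - 2 * pi * j%:R / M%:R) + a * (pi / M%:R) by field.
have -> : a * (u - (2 * j.+1%:R - 1) * pi / M%:R) =
  a * (u - 2 * pi * j%:R / M%:R) - a * (pi / M%:R) by rewrite -natr1; field.
by rewrite sinB sinD; field.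
Qed.

Lemma sin_natmul_pi n : sin (n%:R * pi) = 0 :> R.
Proof.
elim: n => [|n IH]; first by rewrite mul0r sin0.
by rewrite -natr1 mulrDl mul1r sinDpi IH oppr0.
Qed.

Lemma sum_cos_equidistributed_nat l M u : (0 < l < M)%N ->
  \sum_(j < M) cos (l%:R * (u - 2 * pi * j%:R / M%:R)) = 0.
Proof.
move=> /andP[l0 lM]; have M0 := leq_trans l0 (ltnW lM).
apply: sum_cos_equidistributed => //; last exact: sin_natmul_pi.
have MR : 0 < M%:R :> R by rewrite ltr0n.
rewrite gt_eqF// sin_gt0_pi// mulr_gt0 ?ltr0n ?divr_gt0 ?pi_gt0//=.
by rewrite mulrCA gtr_pMr ?pi_gt0// ltr_pdivrMr// mul1r ltr_nat.
Qed.

(** This is [cos (u / 2) ^+ (2 * N)], the unnormalised de la Vallee Poussin kernel: nonnegative, of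
    degree [N], peaked at the multiples of [2 * pi]. *)
Definition cos_kernel N u : R := ((1 + cos u) / 2) ^+ N.

Lemma cos_kernel_ge0 N u : 0 <= cos_kernel N u.
Proof. by apply: exprn_ge0; have := cos_geN1 u; lra. Qed.

Lemma cos_kernelE N u : cos_kernel N u =
  4 ^- N * \sum_(k < N.*2.+1) 'C(N.*2, k)%:R * cos ((N%:R - k%:R) * u).
Proof.
have -> : cos_kernel N u = 4 ^- N * (2 * cos (u / 2)) ^+ N.*2.
  rewrite -muln2 mulnC exprM -exprVn -exprMn; congr (_ ^+ _).
  have -> : u = (u / 2) *+ 2 by rewrite -mulr_natr; field.
  by rewrite cos_mulr2n -mulr_natr (_ : u / 2 *+ 2 / 2 = u / 2);
    [field|rewrite -mulr_natr; field].
rewrite cos_pow_expand; congr (_ * _); apply: eq_bigr => k _.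
have -> : N.*2%:R = N%:R * 2 :> R by rewrite -muln2 natrM.
by congr (_ * cos _); field.
Qed.

(** The constant Fourier coefficient of the kernel, that is, its mean over a period. *)
Definition cos_kernel_mass N : R := 'C(N.*2, N)%:R / 4 ^+ N.

Lemma cos_kernel_mass_gt0 N : 0 < cos_kernel_mass N.
Proof.
rewrite divr_gt0 ?exprn_gt0 ?ltr0n// bin_gt0 -addnn; exact: leq_addr.
Qed.

(** All frequencies [N - k] have absolute value at most [N < M], so averaging over [M] nodes kills
    every one except zero, which is the term [k = N]. *)
Lemma sum_cos_kernel N M u : (N < M)%N ->
  \sum_(j < M) cos_kernel N (u - 2 * pi * j%:R / M%:R) = M%:R * cos_kernel_mass N.
Proof.
move=> NM; under eq_bigr do rewrite cos_kernelE.
rewrite -big_distrr/= exchange_big/=.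
have N2 : (N < N.*2.+1)%N by rewrite ltnS -addnn leq_addr.
rewrite (bigD1 (Ordinal N2))//= [X in _ + X]big1 ?addr0.
  under eq_bigr do rewrite subrr mul0r cos0 mulr1.
  rewrite sumr_const card_ord /cos_kernel_mass -mulr_natr; ring.
move=> k kN; rewrite -big_distrr/=.
have kN' : (k : nat) != N by apply: contra kN => /eqP kN; apply/eqP/val_inj.
have k2 : (k <= N.*2)%N by rewrite -ltnS ltn_ord.
case: (ltngtP k N) => [lt|lt|e]; last by rewrite e eqxx in kN'.
- under eq_bigr do rewrite -natrB 1?ltnW//.
  rewrite sum_cos_equidistributed_nat ?mulr0// subn_gt0 lt/=.
  exact: leq_ltn_trans (leq_subr _ _) NM.
- under eq_bigr do rewrite -cosN -mulNr opprB -natrB 1?ltnW//.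
  rewrite sum_cos_equidistributed_nat ?mulr0// subn_gt0 lt/=.
  by apply: leq_ltn_trans NM; rewrite leq_subLR addnn.
Qed.

(** The ratio is [1 - 1 / (2 * N + 2)]. Twice its defect is the factor [1 / (N + 1)] of
    [sum_cos_kernel_moment], hence the concentration rate. *)
Lemma cos_kernel_massS N :
  cos_kernel_mass N.+1 = cos_kernel_mass N * ((2 * N%:R + 1) / (2 * N%:R + 2)).
Proof.
have H : (N.+1 * 'C(N.+1.*2, N.+1) = 2 * (N.*2.+1 * 'C(N.*2, N)))%N.
  rewrite doubleS -mul_bin_diag -addnn.
  have -> : 'C((N + N).+1, N) = 'C((N + N).+1, N.+1).
    by rewrite -bin_sub -?addnS ?leq_addr// addKn.
  have -> : (N + N).+2 = (2 * N.+1)%N by lia.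
  by rewrite -mulnA -mul_bin_diag.
have HR : 'C(N.+1.*2, N.+1)%:R = 2 * (2 * N%:R + 1) * 'C(N.*2, N)%:R / (N%:R + 1) :> R.
  have N1 : N%:R + 1 != 0 :> R by rewrite natr1 pnatr_eq0.
  have := congr1 (fun n => n%:R : R) H.
  rewrite !natrM -natr1 -/(N.+1.*2) => H'; apply: (mulfI N1); rewrite H'.
  have -> : N.*2.+1%:R = 2 * N%:R + 1 :> R by rewrite -natr1 -muln2 natrM mulrC.
  by field.
rewrite /cos_kernel_mass HR exprS; field.
have N0 : 0 <= N%:R :> R by [].
by clear H HR; apply/and3P; split; [lra|rewrite expf_neq0|lra].
Qed.

(* [(1 - cos) / 2] times the [N]-th kernel is the difference of consecutive
   kernels, hence the exact value. *)
Lemma sum_cos_kernel_moment N M u : (N.+1 < M)%N ->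
  \sum_(j < M) (1 - cos (u - 2 * pi * j%:R / M%:R)) *
     cos_kernel N (u - 2 * pi * j%:R / M%:R)
  = M%:R * cos_kernel_mass N / N.+1%:R.
Proof.
move=> NM.
under eq_bigr => j _.
  rewrite (_ : (1 - cos _) * _ = 2 * cos_kernel N (u - 2 * pi * j%:R / M%:R)
     - 2 * cos_kernel N.+1 (u - 2 * pi * j%:R / M%:R)); last first.
    by rewrite /cos_kernel exprS; move: (_ ^+ N) => W; field.
  over.
rewrite sumrB -!big_distrr/= !sum_cos_kernel ?(ltnW NM)//.
rewrite cos_kernel_massS -natr1; field.
by have N0 : 0 <= N%:R :> R by []; clear NM; apply/andP; split; lra.
Qed.

End cosine_kernel.

Section trigonometric_polynomials.
Context {R : realType} {k : nat}.
Implicit Types (f g : 'rV[R]_k -> R) (t : 'rV[R]_k).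

(** Only linear combinations are constructors, so convergence of characteristic functions passes to
    every member by linearity. Stability under products comes from the product-to-sum formulas in
    [trigpolyM]. *)
Inductive trigpoly : ('rV[R]_k -> R) -> Prop :=
| trigpoly_cos t : trigpoly (fun x => cos ((t *m x^T) ord0 ord0))
| trigpoly_sin t : trigpoly (fun x => sin ((t *m x^T) ord0 ord0))
| trigpolyD f g : trigpoly f -> trigpoly g -> trigpoly (fun x => f x + g x)
| trigpolyZ a f : trigpoly f -> trigpoly (fun x => a * f x).

Lemma eq_trigpoly f g : f =1 g -> trigpoly f -> trigpoly g.
Proof. by move=> /funext ->. Qed.

Lemma trigpoly_cst a : trigpoly (fun=> a).
Proof.
apply: eq_trigpoly (trigpolyZ a (trigpoly_cos 0)) => x.
by rewrite mul0mx mxE cos0 mulr1.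
Qed.

Lemma trigpoly_sum (I : Type) (r : seq I) (F : I -> 'rV[R]_k -> R) :
  (forall i, trigpoly (F i)) -> trigpoly (fun x => \sum_(i <- r) F i x).
Proof.
move=> tF; elim: r => [|i r IH].
  by apply: eq_trigpoly (trigpoly_cst 0) => x; rewrite big_nil.
by apply: eq_trigpoly (trigpolyD (tF i) IH) => x; rewrite big_cons.
Qed.

Lemma trigpolyM f g : trigpoly f -> trigpoly g -> trigpoly (fun x => f x * g x).
Proof.
have inner s t (x : 'rV[R]_k) : ((s + t) *m x^T) ord0 ord0 =
  (s *m x^T) ord0 ord0 + (t *m x^T) ord0 ord0 by rewrite mulmxDl mxE.
have innerB s t (x : 'rV[R]_k) : ((s - t) *m x^T) ord0 ord0 =
  (s *m x^T) ord0 ord0 - (t *m x^T) ord0 ord0 by rewrite mulmxBl !mxE.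
elim=> [s|s|f1 f2 _ IH1 _ IH2|a f1 _ IH] tg; last 2 first.
- by apply: eq_trigpoly (trigpolyD (IH1 tg) (IH2 tg)) => x; rewrite mulrDl.
- by apply: eq_trigpoly (trigpolyZ a (IH tg)) => x; rewrite mulrA.
- elim: tg => [t|t|g1 g2 _ IH1 _ IH2|a g1 _ IH].
  + apply: eq_trigpoly (trigpolyZ 2^-1
      (trigpolyD (trigpoly_cos (s + t)) (trigpoly_cos (s - t)))) => x.
    by rewrite innerB inner cosB cosD; field.
  + apply: eq_trigpoly (trigpolyZ 2^-1
      (trigpolyD (trigpoly_sin (s + t)) (trigpolyZ (-1) (trigpoly_sin (s - t))))) => x.
    by rewrite innerB inner sinB sinD; field.
  + by apply: eq_trigpoly (trigpolyD IH1 IH2) => x; rewrite mulrDr.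
  + by apply: eq_trigpoly (trigpolyZ a IH) => x; rewrite mulrCA.
- elim: tg => [t|t|g1 g2 _ IH1 _ IH2|a g1 _ IH].
  + apply: eq_trigpoly (trigpolyZ 2^-1
      (trigpolyD (trigpoly_sin (s + t)) (trigpoly_sin (s - t)))) => x.
    by rewrite innerB inner sinB sinD; field.
  + apply: eq_trigpoly (trigpolyZ 2^-1
      (trigpolyD (trigpoly_cos (s - t)) (trigpolyZ (-1) (trigpoly_cos (s + t))))) => x.
    by rewrite innerB inner cosB cosD; field.
  + by apply: eq_trigpoly (trigpolyD IH1 IH2) => x; rewrite mulrDr.
  + by apply: eq_trigpoly (trigpolyZ a IH) => x; rewrite mulrCA.
Qed.

Lemma trigpoly_prod (I : Type) (r : seq I) (F : I -> 'rV[R]_k -> R) :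
  (forall i, trigpoly (F i)) -> trigpoly (fun x => \prod_(i <- r) F i x).
Proof.
move=> tF; elim: r => [|i r IH].
  by apply: eq_trigpoly (trigpoly_cst 1) => x; rewrite big_nil.
by apply: eq_trigpoly (trigpolyM (tF i) IH) => x; rewrite big_cons.
Qed.

Lemma trigpolyX f n : trigpoly f -> trigpoly (fun x => f x ^+ n).
Proof.
move=> tf; elim: n => [|n IH]; first exact: eq_trigpoly (trigpoly_cst 1).
by apply: eq_trigpoly (trigpolyM tf IH) => x; rewrite exprS.
Qed.

Lemma trigpoly_cos_kernel N (i : 'I_k) (a b : R) :
  trigpoly (fun x => cos_kernel N (a * x ord0 i + b)).
Proof.
apply: trigpolyX.
have E (x : 'rV[R]_k) : ((a *: delta_mx ord0 i) *m x^T) ord0 ord0 = a * x ord0 i.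
  rewrite -scalemxAl mxE; congr (_ * _); rewrite mxE (bigD1 i)//= !mxE !eqxx mul1r.
  by rewrite big1 ?addr0// => j /negPf ji; rewrite !mxE ji andbF mul0r.
apply: eq_trigpoly (trigpolyD (trigpoly_cst 2^-1) (trigpolyD
  (trigpolyZ (cos b / 2) (trigpoly_cos (a *: delta_mx ord0 i)))
  (trigpolyZ (- sin b / 2) (trigpoly_sin (a *: delta_mx ord0 i))))) => x.
by rewrite E cosD; field.
Qed.

End trigonometric_polynomials.

Section trigonometric_approximation.
Context {R : realType}.

(** [1 - cos] vanishes only at zero within one period on either side. The range [3 * pi / 2] is the
    largest rescaled distance from a point of the box to a node. *)
Lemma one_minus_cos_lower_bound (b : R) : 0 < b -> exists2 c : R, 0 < c &
  forall a, b < `|a| -> `|a| <= pi + pi / 2 -> c <= 1 - cos a.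
Proof.
move=> b0; have p0 := pi_gt0 R.
(* Capping at [pi / 2] makes [cos b'] nonnegative, so it also dominates the cosine beyond [pi],
   where the cosine is no longer decreasing. *)
pose b' := Num.min b (pi / 2).
have b'0 : 0 < b' by rewrite lt_min b0 divr_gt0.
have b'p : b' <= pi / 2 by rewrite ge_min lexx orbT.
have cb : 0 <= cos b' by apply: cos_ge0_pihalf; rewrite b'p andbT; lra.
exists (1 - cos b').
  rewrite subr_gt0 -[ltRHS]cos0 ltr_cos// in_itv/=; apply/andP; split; lra.
move=> a ba ap; rewrite -(cos_norm a) lerD2l lerN2.
have b'a : b' <= `|a| by rewrite ge_min (ltW ba).
have [ap'|ap'] := leP `|a| pi.
  rewrite leNgt ltr_cos ?in_itv/= -?leNgt//; first by rewrite ap' normr_ge0.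
  by apply/andP; split; lra.
apply: le_trans cb; have := cosDpi (`|a| - pi); rewrite subrK => ->.
rewrite oppr_le0 cos_ge0_pihalf//; apply/andP; split; lra.
Qed.

Lemma trigonometric_partition (K del eta : R) : 0 < K -> 0 < del -> 0 < eta ->
  exists (M : nat) (u : 'I_M -> R) (phi : 'I_M -> R -> R),
  [/\ forall k (i : 'I_k) j, trigpoly (fun x : 'rV[R]_k => phi j (x ord0 i)),
      forall j x, 0 <= phi j x,
      forall x, \sum_j phi j x = 1,
      forall j, `|u j| <= 2 * K &
      forall x, `|x| <= K -> \sum_(j | del < `|u j - x|) phi j x <= eta].
Proof.
move=> K0 d0 e0; have p0 := pi_gt0 R.
(* The kernel gets period [4 * K] and the nodes fill [[-2K, 2K[]. A point with [|x| <= K] is within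
   [3 * K] of each node, so no node is close to it only through periodicity. *)
pose th := pi / (2 * K) : R.
have th0 : 0 < th by rewrite divr_gt0// mulr_gt0.
have [c c0 Hc] := one_minus_cos_lower_bound (mulr_gt0 th0 d0).
(* Then [1 / (c * (N + 1)) < eta], the bound reached at the end. [M = N + 2] is the least number of
   nodes allowed by [sum_cos_kernel_moment]. *)
pose N := Num.truncn (c * eta)^-1.
pose M := N.+2.
have MR : 0 < M%:R :> R by rewrite ltr0n.
pose D := M%:R * @cos_kernel_mass R N.
have D0 : 0 < D by rewrite mulr_gt0 ?cos_kernel_mass_gt0.
pose u (j : 'I_M) : R := 2 * K * (2 * (j%:R / M%:R) - 1).
have uE (j : 'I_M) x : th * (x - u j) = th * x + pi - 2 * pi * j%:R / M%:R.
  by rewrite /u /th; field; apply/andP; split; lra.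
have uK j : `|u j| <= 2 * K.
  rewrite /u normrM gtr0_norm ?mulr_gt0//; apply: ler_piMr.
    by rewrite mulr_ge0// ltW.
  have : 0 <= (j%:R / M%:R : R) <= 1.
    by rewrite divr_ge0//= ler_pdivrMr// mul1r ler_nat ltnW.
  by rewrite ler_norml => /andP[? ?]; apply/andP; split; lra.
exists M, u, (fun j x => cos_kernel N (th * (x - u j)) / D); split => //.
- move=> k i j.
  apply: eq_trigpoly (trigpolyZ D^-1 (trigpoly_cos_kernel N i th (- (th * u j)))) => x.
  by rewrite mulrC mulrBr.
- by move=> j x; rewrite divr_ge0 ?cos_kernel_ge0 1?ltW.
- move=> x; rewrite -big_distrl/=; under eq_bigr do rewrite uE.
  by rewrite sum_cos_kernel// mulfV// gt_eqF.
- move=> x xK; rewrite -big_distrl/= ler_pdivrMr//.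
  (* Chebyshev's argument: at a far node [1 - cos] is at least [c], so the far weights are bounded
     by the full moment divided by [c]. *)
  apply: (@le_trans _ _ (c^-1 * \sum_(j < M) (1 - cos (th * x + pi - 2 * pi * j%:R / M%:R)) *
     cos_kernel N (th * x + pi - 2 * pi * j%:R / M%:R))).
    rewrite big_distrr/= big_mkcond/=; apply: ler_sum => j _.
    rewrite -uE; case: ifPn => [far|_]; last first.
      apply: mulr_ge0; first by rewrite invr_ge0 ltW.
      by rewrite mulr_ge0 ?cos_kernel_ge0// subr_ge0 cos_le1.
    rewrite mulrA ler_peMl ?cos_kernel_ge0// mulrC ler_pdivlMr// mul1r.
    apply: Hc; rewrite normrM gtr0_norm// distrC; first by rewrite ltr_pM2l.
    apply: (@le_trans _ _ (th * (3 * K))); last first.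
      by rewrite (_ : th * (3 * K) = pi + pi / 2) // /th; field; lra.
    by rewrite ler_pM2l//; apply: le_trans (ler_normB _ _) _; have := uK j; lra.
  rewrite sum_cos_kernel_moment// [leRHS]mulrC mulrCA -/D ler_pM2l// -invfM.
  rewrite invf_ple ?posrE ?mulr_gt0 ?ltr0n// mulrC -ler_pdivrMr// -invfM.
  by apply/ltW; rewrite [X in X^-1]mulrC truncnS_gt.
Qed.

Lemma rV_norm_le k (x : 'rV[R]_k) (M : R) : 0 <= M ->
  (forall i, `|x ord0 i| <= M) -> `|x| <= M.
Proof.
move=> M0 xM; rewrite [leLHS]/Num.norm/= mx_normrE; apply/bigmax_leP; split=> //.
by move=> [i j] _ /=; rewrite (ord1 i).
Qed.

Lemma coord_le_norm k (x : 'rV[R]_k) i : `|x ord0 i| <= `|x|.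
Proof.
by rewrite [leRHS]/Num.norm/= mx_normrE; apply/bigmax_geP; right; exists (ord0, i).
Qed.

(** Only [x] is confined to the box: [y] will be a node, and the nodes extend beyond the box.
    Compactness is used as a covering property for pairs of a point and a radius. *)
Lemma continuous_unif_box k (g : 'rV[R]_k -> R) (K e : R) : continuous g -> 0 < e ->
  exists2 del : R, 0 < del & forall x y : 'rV[R]_k,
    (forall i, `|x ord0 i| <= K) -> (forall i, `|x ord0 i - y ord0 i| <= del) ->
    `|g x - g y| <= e.
Proof.
move=> cg e0.
have cK : compact [set x : 'rV[R]_k | forall i, `[- K, K]%classic (x ord0 i)].
  by apply: (@rV_compact _ _ (fun=> `[- K, K]%classic)) => i; exact: segment_compact.
have /compact_near_coveringP H := cK.
have [|del /= del0 Hd] := H R (0^'+) (fun d x =>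
    forall y : 'rV[R]_k, `|x - y| <= d -> `|g x - g y| <= e) _.
  move=> x _.
  have /cvgr_dist_lt/(_ (e / 2)) := cg x.
  rewrite divr_gt0// => /(_ isT) /nbhs_ballP[r /= r0 Hr].
  have r20 : 0 < r / 2 by rewrite divr_gt0.
  exists (ball x (r / 2), [set d | d < r / 2]) => /=.
    by split; [exact: nbhsx_ballx|exact: nbhs_right_lt].
  move=> [x' d]/= []; rewrite -ball_normE /= => xx' dr y x'y.
  have gx' : `|g x - g x'| < e / 2.
    by apply: Hr; rewrite -ball_normE /=; lra.
  have gy : `|g x - g y| < e / 2.
    apply: Hr; rewrite -ball_normE /=.
    by have := ler_distD x' x y; lra.
  have := ler_distD (g x) (g x') (g y); rewrite (distrC (g x') (g x)); lra.
have d20 : 0 < del / 2 by rewrite divr_gt0.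
exists (del / 2) => // x y xK xy; apply: (Hd (del / 2)) => //=.
- by rewrite /ball_/= sub0r normrN gtr0_norm//; lra.
- by move=> i; rewrite in_itv/= -ler_norml.
- by apply: rV_norm_le; [exact: ltW|move=> i; rewrite !mxE].
Qed.

(** A Bernstein-type operator: values of [g] at grid nodes, averaged with products of
    one-dimensional weights. These weights are nonnegative with sum one, which gives the global
    bound [C]. Nodes near [x] contribute at most [e / 2] by uniform continuity, the others little
    total weight. *)
Lemma trigonometric_approximation k (g : 'rV[R]_k -> R) (C K e : R) :
  continuous g -> (forall x, `|g x| <= C) -> 0 < K -> 0 < e ->
  exists A : 'rV[R]_k -> R, [/\ trigpoly A, forall x, `|A x| <= C &
    forall x : 'rV[R]_k, (forall i, `|x ord0 i| <= K) -> `|A x - g x| <= e].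
Proof.
move=> cg gC K0 e0.
have C0 : 0 <= C by apply: le_trans (gC 0).
have e20 : 0 < e / 2 by rewrite divr_gt0.
have [del del0 Hd] := continuous_unif_box K cg e20.
(* Each of the [k] coordinates costs [2 * C * eta] for the nodes far in that coordinate; the [+ 1]
   keeps the denominator positive. *)
pose eta := e / 2 / (2 * C * k%:R + 1).
have D0 : 0 < 2 * C * k%:R + 1 by rewrite ltr_wpDl// !mulr_ge0.
have eta0 : 0 < eta by rewrite divr_gt0.
have [M [u [phi [tphi phi0 phi1 _ far]]]] := trigonometric_partition K0 del0 eta0.
pose w (J : {ffun 'I_k -> 'I_M}) (x : 'rV[R]_k) := \prod_i phi (J i) (x ord0 i).
pose node (J : {ffun 'I_k -> 'I_M}) : 'rV[R]_k := \row_i u (J i).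
have w0 J x : 0 <= w J x by apply: prodr_ge0 => i _.
have w1 x : \sum_J w J x = 1.
  by rewrite -(bigA_distr_bigA (fun i j => phi j (x ord0 i))) big1// => i _.
exists (fun x => \sum_J g (node J) * w J x); split.
- by apply: trigpoly_sum => J; apply: trigpolyZ; apply: trigpoly_prod.
- move=> x; apply: le_trans (ler_norm_sum _ _ _) _.
  apply: (@le_trans _ _ (\sum_J C * w J x)); last first.
    by rewrite -big_distrr/= w1 mulr1.
  by apply: ler_sum => J _; rewrite normrM (ger0_norm (w0 _ _)) ler_wpM2r.
- move=> x xK.
  have -> : \sum_J g (node J) * w J x - g x = \sum_J (g (node J) - g x) * w J x.
    under [RHS]eq_bigr do rewrite mulrBl.
    by rewrite sumrB -big_distrr/= w1 mulr1.
  apply: le_trans (ler_norm_sum _ _ _) _.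
  pose fr (J : {ffun 'I_k -> 'I_M}) i : R := (del < `|u (J i) - x ord0 i|)%R%:R.
  apply: (@le_trans _ _ (\sum_J (e / 2 * w J x + \sum_i 2 * C * (fr J i * w J x)))).
    apply: ler_sum => J _; rewrite normrM (ger0_norm (w0 _ _)).
    have fr0 i : 0 <= 2 * C * (fr J i * w J x) by rewrite !mulr_ge0.
    have [/existsP[i fi]|/existsPn near] := boolP [exists i : 'I_k, (del < `|u (J i) - x ord0 i|)%R].
      apply: (@le_trans _ _ (2 * C * (fr J i * w J x))).
        rewrite /fr fi mul1r ler_wpM2r//; apply: le_trans (ler_normB _ _) _.
        by have := gC (node J); have := gC x; lra.
      rewrite (bigD1 i)//= [X in _ <= _ + X]addrC addrA lerDr addr_ge0//.
        by rewrite mulr_ge0// ltW.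
      by apply: sumr_ge0.
    rewrite -[leLHS]addr0 lerD ?sumr_ge0// ler_wpM2r//.
    rewrite distrC; apply: Hd => // i.
    by rewrite mxE distrC leNgt.
  rewrite big_split/= -big_distrr/= w1 mulr1 exchange_big/=.
  have H i : \sum_J 2 * C * (fr J i * w J x) <= 2 * C * eta.
    rewrite -big_distrr/= ler_wpM2l ?mulr_ge0//.
    (* The indicator that coordinate [i] is far is absorbed into the [i]-th factor, so that the sum
       of products again factors into one-dimensional sums. *)
    pose F i' j := (if i' == i then (del < `|u j - x ord0 i|)%R%:R else 1) * phi j (x ord0 i').
    rewrite (eq_bigr (fun J : {ffun 'I_k -> 'I_M} => \prod_i' F i' (J i'))); last first.
      move=> J _; rewrite /F big_split/=; congr (_ * _).
      by rewrite (bigD1 i)//= eqxx big1 ?mulr1// => i' /negPf ->.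
    rewrite -bigA_distr_bigA (bigD1 i)//= [X in _ * X]big1 ?mulr1; last first.
      by move=> i' /negPf ne; rewrite -[RHS](phi1 (x ord0 i')); apply: eq_bigr => j _;
        rewrite /F ne mul1r.
    apply: le_trans (far _ (xK i)); rewrite [leRHS]big_mkcond/=.
    by apply: ler_sum => j _; rewrite /F eqxx; case: ifP; rewrite ?mul1r ?mul0r.
  apply: (@le_trans _ _ (e / 2 + \sum_(i < k) 2 * C * eta)).
    by rewrite lerD2l; apply: ler_sum => i _.
  rewrite sumr_const card_ord -mulr_natr -mulrAC.
  suff : 2 * C * k%:R * eta <= e / 2 by lra.
  rewrite /eta mulrA ler_pdivrMr// mulrC ler_pM2l//; lra.
Qed.

End trigonometric_approximation.

(** * Exceptional sets and the continuity theorem for characteristic functions *)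

Section probability_tools.
Context {d : measure_display} {T : measurableType d} {R : realType}
  (P : probability T R).
Implicit Types (f g : T -> R) (S : T -> Prop).

Lemma bounded_integrable f (C : R) : measurable_fun setT f -> (forall w, `|f w| <= C) ->
  P.-integrable setT (EFin \o f).
Proof.
move=> mf fC; apply: measurable_bounded_integrable => //.
  by rewrite -ge0_fin_numE// fin_num_measure.
by exists C; split; [exact: num_real|] => M CM x _; exact: le_trans (fC x) (ltW CM).
Qed.

Lemma expectation_Rintegral f : P.-integrable setT (EFin \o f) ->
  'E_P[f]%E = (\int[P]_w f w)%:E.
Proof.
by move=> intf; rewrite unlock /Rintegral fineK//; exact: integrable_fin_num.
Qed.

(* [S] holds off a measurable set of probability at most [e]; since only the
   exceptional set has to be measurable, [S] itself may be arbitrary. *)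
Definition whp (e : R) S : Prop :=
  exists A, [/\ measurable A, (P A <= e%:E)%E & forall w, ~ A w -> S w].

Lemma whp_mono (e e' : R) S S' : e <= e' -> (forall w, S w -> S' w) -> whp e S -> whp e' S'.
Proof.
move=> ee SS [A [mA PA AS]]; exists A; split => //.
  by apply: le_trans PA _; rewrite lee_fin.
by move=> w /AS /SS.
Qed.

Lemma whp_all S (e : R) : 0 <= e -> (forall w, S w) -> whp e S.
Proof. by move=> e0 HS; exists set0; split=> //; rewrite measure0 lee_fin. Qed.

Lemma whp_and e e' S S' : whp e S -> whp e' S' -> whp (e + e') (fun w => S w /\ S' w).
Proof.
move=> [A [mA PA AS]] [B [mB PB BS]]; exists (A `|` B); split.
- exact: measurableU.
- by apply: le_trans (measureU2 _ _ _) _ => //; rewrite EFinD leeD.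
- by move=> w /not_orP[/AS ? /BS ?].
Qed.

Lemma whp_forall k (e : R) (S : 'I_k -> T -> Prop) : 0 <= e -> (forall i, whp e (S i)) ->
  whp (k%:R * e) (fun w => forall i, S i w).
Proof.
move=> e0; elim: k S => [|k IH] S HS.
  by apply: whp_all => [|w []//]; rewrite mul0r.
have H0 := HS ord0; have H := IH _ (fun i => HS (lift ord0 i)).
apply: whp_mono (whp_and H0 H); first by rewrite -natr1 mulrDl mul1r addrC.
move=> w [S0 S1] i; case: (unliftP ord0 i) => [j ->|->//]; exact: S1.
Qed.

(** Integrate the pointwise bound [|f| <= e + C * \1_A], with [A] the exceptional set. *)
Lemma norm_Rintegral_whp f (C e del : R) : measurable_fun setT f -> (forall w, `|f w| <= C) ->
  0 <= e -> 0 <= C -> whp del (fun w => `|f w| <= e) ->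
  `|\int[P]_w f w| <= e + C * del.
Proof.
move=> mf fC e0 C0 [A [mA PA Af]].
have intf := bounded_integrable mf fC.
have mA1 : measurable_fun setT (\1_A : T -> R) by exact: measurable_indic.
have intA : P.-integrable setT (EFin \o (\1_A : T -> R)).
  by apply: (bounded_integrable (C := 1)) => // w; rewrite indicE; case: (_ \in _);
     rewrite ?normr1 ?normr0.
have intCA : P.-integrable setT (EFin \o (fun w => C * \1_A w)).
  exact: (integrableZl measurableT C intA).
have inte : P.-integrable setT (EFin \o (fun w : T => e)).
  by apply: (bounded_integrable (C := `|e|)).
apply: le_trans (le_normr_Rintegral measurableT intf) _.
apply: (@le_trans _ _ (\int[P]_w (e + C * \1_A w))).
  apply: le_Rintegral => //; first exact: integrable_norm.
    exact: (integrableD measurableT inte intCA).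
  move=> w _; rewrite indicE; case: (boolP (w \in A)) => [_|].
    by rewrite mulr1; have := fC w; lra.
  by rewrite notin_setE => /Af; rewrite mulr0 addr0.
rewrite RintegralD// RintegralZl// Rintegral_cst//= probability_setT mulr1 lerD2l.
rewrite ler_wpM2l// /Rintegral integral_indic// setIT.
by rewrite -lee_fin fineK// fin_num_measure.
Qed.

Lemma whp_bounded_RV f (e : R) : measurable_fun setT f -> 0 < e ->
  exists2 K : R, 0 < K & whp e (fun w => `|f w| <= K).
Proof.
move=> mf e0.
pose F n := [set w | n%:R < `|f w|].
have mF n : measurable (F n).
  rewrite (_ : F n = setT `&` (fun w => `|f w|) @^-1` `]n%:R, +oo[%classic); last first.
    by apply/seteqP; split => w /=; rewrite in_itv/= andbT; [split|case].
  by apply: (measurableT_comp (@normr_measurable R setT) mf).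
have F0 : \bigcap_n F n = set0.
  rewrite -subset0 => w /(_ (Num.truncn `|f w|).+1 I); rewrite /F /=.
  by rewrite ltNge => /negP; apply; exact/ltW/truncnS_gt.
have /fine_cvgP[_ ] : (P \o F) n @[n --> \oo] --> (0 : R)%:E.
  have := @nonincreasing_cvg_mu _ _ _ P F _ mF _ _.
  rewrite F0 measure0; apply => //.
    by rewrite (le_lt_trans (probability_le1 _ _)) ?ltry.
  move=> m n mn; apply/subsetPset => w /=; apply: le_lt_trans.
  by rewrite ler_nat.
move=> /cvgr_dist_lt /(_ e e0) [N _ /(_ N.+1)] /= /(_ (leqnSn _)).
rewrite sub0r normrN => HN.
exists N.+1%:R; first by rewrite ltr0n.
exists (F N.+1); split => //.
  rewrite -[leLHS]fineK ?fin_num_measure// lee_fin; apply: ltW.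
  by apply: le_lt_trans HN; rewrite ler_norm.
by move=> w /negP; rewrite -leNgt.
Qed.

End probability_tools.

Section levy.
Context {R : realType} {k : nat}.

Lemma continuous_inner (t : 'rV[R]_k) :
  continuous (fun x : 'rV[R]_k => (t *m x^T) ord0 ord0).
Proof.
rewrite (_ : (fun x : 'rV[R]_k => _) = fun x => \sum_i t ord0 i * x ord0 i); last first.
  by apply/funext => x; rewrite mxE; apply: eq_bigr => i _; rewrite mxE.
elim: (index_enum _) => [|i s IH].
  rewrite (_ : (fun x : 'rV[R]_k => _) = cst 0); first exact: cst_continuous.
  by apply/funext => x; rewrite big_nil.
rewrite (_ : (fun x : 'rV[R]_k => _) =
  fun x => t ord0 i * x ord0 i + \sum_(j <- s) t ord0 j * x ord0 j); last first.
  by apply/funext => x; rewrite big_cons.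
move=> x.
have h := cvgMl_tmp (a := t ord0 i) (@coord_continuous R 1 k ord0 i x).
apply: (@continuousD R R^o _ (fun x : 'rV[R]_k => t ord0 i * x ord0 i)); [exact: h|exact: IH].
Qed.

Lemma trigpoly_continuous (A : 'rV[R]_k -> R) : trigpoly A -> continuous A.
Proof.
elim=> [t x|t x|f g _ IHf _ IHg x|a f _ IH x].
- by apply: (@continuous_comp _ _ _ (fun x : 'rV[R]_k => (t *m x^T) ord0 ord0) cos);
    [exact: continuous_inner|exact: continuous_cos].
- by apply: (@continuous_comp _ _ _ (fun x : 'rV[R]_k => (t *m x^T) ord0 ord0) sin);
    [exact: continuous_inner|exact: continuous_sin].
- exact: (@continuousD R R^o _ f g x (IHf x) (IHg x)).
- by apply: (@continuousM R _ (fun=> a) f x); first [exact: IH|exact: cst_continuous].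
Qed.

Lemma trigpoly_bounded (A : 'rV[R]_k -> R) : trigpoly A ->
  exists C : R, forall x, `|A x| <= C.
Proof.
elim=> [t|t|f g _ [C HC] _ [D HD]|a f _ [C HC]].
- by exists 1 => x; exact: cos_max.
- by exists 1 => x; exact: sin_max.
- by exists (C + D) => x; apply: le_trans (ler_normD _ _) _; rewrite lerD.
- by exists (`|a| * C) => x; rewrite normrM ler_wpM2l.
Qed.

Lemma measurable_trigpoly (d : measure_display) (T : measurableType d)
    (Y : T -> 'rV[R]_k) (A : 'rV[R]_k -> R) :
  (forall i, measurable_fun setT (fun w => Y w ord0 i)) -> trigpoly A ->
  measurable_fun setT (A \o Y).
Proof.
move=> mY.
have mi (t : 'rV[R]_k) : measurable_fun setT (fun w => (t *m (Y w)^T) ord0 ord0).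
  rewrite (_ : (fun w : T => _) = fun w => \sum_i t ord0 i * Y w ord0 i); last first.
    by apply/funext => x; rewrite mxE; apply: eq_bigr => i _; rewrite mxE.
  by apply: measurable_sum => i; apply: measurable_funM.
elim=> [t|t|f g _ IHf _ IHg|a f _ IH].
- have mcos : measurable_fun setT (@cos R).
    by apply: continuous_measurable_fun; exact: continuous_cos.
  exact: (measurableT_comp mcos (mi t)).
- have msin : measurable_fun setT (@sin R).
    by apply: continuous_measurable_fun; exact: continuous_sin.
  exact: (measurableT_comp msin (mi t)).
- exact: measurable_funD.
- exact: measurable_funM.
Qed.

(** Only the coordinates of [Y] are assumed measurable. The approximants on the box of size [n + 1]
    with error [1 / (n + 1)] are measurable after composition and converge to [g] pointwise, since
    every point eventually lies in the box. *)
Lemma measurable_continuous_bounded (d : measure_display) (T : measurableType d)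
    (Y : T -> 'rV[R]_k) (g : 'rV[R]_k -> R) (C : R) :
  (forall i, measurable_fun setT (fun w => Y w ord0 i)) -> continuous g ->
  (forall x, `|g x| <= C) -> measurable_fun setT (g \o Y).
Proof.
move=> mY cg gC.
have en n : 0 < n.+1%:R^-1 :> R by rewrite invr_gt0.
have [A HA] := choice (fun n => trigonometric_approximation cg gC (ltr0Sn R n) (en n)).
apply: (measurable_fun_cvg (h := fun n => A n \o Y)) => [n|w _].
  by apply: measurable_trigpoly; case: (HA n).
apply/cvgrPdist_le => e e0.
near=> n.
rewrite distrC /=; case: (HA n) => _ _ /(_ (Y w)) H.
apply: le_trans (H _) _ => [i|].
  apply: le_trans (coord_le_norm _ i) _.
  near: n; exists (Num.truncn `|Y w|) => // n /= Hn; apply: ltW.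
  by apply: lt_le_trans (truncnS_gt _) _; rewrite ler_nat ltnS.
near: n; exists (Num.truncn e^-1) => // n /= Hn.
rewrite invf_ple ?posrE ?ltr0n//; apply: ltW.
by apply: lt_le_trans (truncnS_gt _) _; rewrite ler_nat ltnS.
Unshelve. all: by end_near. Qed.

(** Measurability is asked of [g \o Y n] instead of the coordinates because the intended [Y n] is a
    continuous image of the vector of estimators. Tightness is assumed along [Y n] only; a single
    vector [Z] has it by [whp_bounded_RV]. *)
Lemma levy_continuity (d d' : measure_display) (T : measurableType d)
    (T' : measurableType d') (P : probability T R) (Q : probability T' R)
    (Y : nat -> T -> 'rV[R]_k) (Z : T' -> 'rV[R]_k) :
  (forall n (g : 'rV[R]_k -> R) (C : R), continuous g -> (forall x, `|g x| <= C) ->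
     measurable_fun setT (g \o Y n)) ->
  (forall i, measurable_fun setT (fun w => Z w ord0 i)) ->
  (forall e : R, 0 < e -> exists2 K : R, 0 < K & \forall n \near \oo,
     whp P e (fun w => forall i, `|Y n w ord0 i| <= K)) ->
  (forall t : 'rV[R]_k,
    (\int[P]_w cos ((t *m (Y n w)^T) ord0 ord0)) @[n --> \oo] -->
     \int[Q]_w cos ((t *m (Z w)^T) ord0 ord0)) ->
  (forall t : 'rV[R]_k,
    (\int[P]_w sin ((t *m (Y n w)^T) ord0 ord0)) @[n --> \oo] -->
     \int[Q]_w sin ((t *m (Z w)^T) ord0 ord0)) ->
  forall (g : 'rV[R]_k -> R) (C : R), continuous g -> (forall x, `|g x| <= C) ->
  (\int[P]_w g (Y n w)) @[n --> \oo] --> \int[Q]_w g (Z w).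
Proof.
move=> mY mZ tY ccos csin g C cg gC.
have C0 : 0 <= C by apply: le_trans (gC 0).
have mgZ (f : 'rV[R]_k -> R) (D : R) (cf : continuous f) (fD : forall x, `|f x| <= D) :=
  measurable_continuous_bounded mZ cf fD.
have cA A : trigpoly A -> (\int[P]_w A (Y n w)) @[n --> \oo] --> \int[Q]_w A (Z w).
  elim=> [t|t|f h tf IHf th IHh|a f tf IH].
  - exact: ccos.
  - exact: csin.
  - have [D fD] := trigpoly_bounded tf; have [D' hD] := trigpoly_bounded th.
    have cf := trigpoly_continuous tf; have ch := trigpoly_continuous th.
    rewrite RintegralD//; last 2 first.
    + exact: (bounded_integrable Q (mgZ _ _ cf fD) (fun w => fD _)).
    + exact: (bounded_integrable Q (mgZ _ _ ch hD) (fun w => hD _)).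
    under eq_fun => n.
      rewrite RintegralD//; last 2 first.
      - exact: (bounded_integrable P (mY n _ _ cf fD) (fun w => fD _)).
      - exact: (bounded_integrable P (mY n _ _ ch hD) (fun w => hD _)).
      over.
    exact: cvgD.
  - have [D fD] := trigpoly_bounded tf; have cf := trigpoly_continuous tf.
    rewrite RintegralZl//; last exact: (bounded_integrable Q (mgZ _ _ cf fD) (fun w => fD _)).
    under eq_fun => n.
      rewrite RintegralZl//; last exact: (bounded_integrable P (mY n _ _ cf fD) (fun w => fD _)).
      over.
    exact: cvgMl_tmp.
apply/cvgrPdist_le => e e0.
(* Replacing [g] by its approximant costs [2 * e'] under each of the two laws, and convergence for
   the approximant costs one more [e']. *)
pose e' := e / 5; have e'0 : 0 < e' by rewrite divr_gt0.
pose del := e' / (2 * C + 1).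
have D0 : 0 < 2 * C + 1 by lra.
have del0 : 0 < del by rewrite divr_gt0.
have Cdel : 2 * C * del <= e'.
  by rewrite /del mulrA ler_pdivrMr// mulrC ler_pM2l//; lra.
have [K1 K10 HK1] := tY _ del0.
have [K2 K20 HK2] : exists2 K2 : R, 0 < K2 & whp Q del (fun w => forall i, `|Z w ord0 i| <= K2).
  have dk0 : 0 < del / k.+1%:R by rewrite divr_gt0.
  have Hi i := whp_bounded_RV Q (mZ i) dk0.
  have [K HK] := choice (fun i => (let: ex_intro2 x p q := Hi i in ex_intro _ x (conj p q))).
  exists (1 + \sum_i K i).
    by rewrite ltr_pwDl// sumr_ge0// => i _; exact: ltW (HK i).1.
  apply: whp_mono (whp_forall (ltW dk0) (fun i => (HK i).2)).
    by rewrite mulrCA ger_pMr// ler_pdivrMr// mul1r ler_nat.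
  move=> w Hw i; apply: le_trans (Hw i) _; rewrite (bigD1 i)//=.
  have : 0 <= \sum_(j | j != i) K j by apply: sumr_ge0 => j _; exact: ltW (HK j).1.
  lra.
pose K := Num.max K1 K2.
have K0 : 0 < K by rewrite lt_max K10.
have [A [tA AC Ag]] := trigonometric_approximation cg gC K0 e'0.
have cAA := trigpoly_continuous tA.
(* Stated for an arbitrary probability space, as it is applied both to [Y n] under [P] and to [Z]
   under [Q]. *)
have bound (d1 : measure_display) (T1 : measurableType d1) (P1 : probability T1 R)
    (W : T1 -> 'rV[R]_k) (K3 : R) :
    (forall (f : 'rV[R]_k -> R) (D : R), continuous f -> (forall x, `|f x| <= D) -> measurable_fun setT (f \o W)) ->
    K3 <= K -> whp P1 del (fun w => forall i, `|W w ord0 i| <= K3) ->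
    `|\int[P1]_w A (W w) - \int[P1]_w g (W w)| <= 2 * e'.
  move=> mW K3K HW.
  rewrite -RintegralB//; last 2 first.
  - exact: (bounded_integrable P1 (mW _ _ cAA AC) (fun w => AC _)).
  - exact: (bounded_integrable P1 (mW _ _ cg gC) (fun w => gC _)).
  apply: (@le_trans _ _ (e' + 2 * C * del)); last by lra.
  apply: norm_Rintegral_whp.
  - exact: measurable_funB (mW _ _ cAA AC) (mW _ _ cg gC).
  - by move=> w; apply: le_trans (ler_normB _ _) _; have := AC (W w); have := gC (W w); lra.
  - exact: ltW.
  - exact: mulr_ge0.
  - apply: (whp_mono (lexx _) _ HW) => w Hw; apply: Ag => i.
    exact: le_trans (Hw i) _.
have bZ := bound _ _ Q Z K2 mgZ _ HK2.
have /cvgrPdist_le/(_ _ e'0) cAn := cA _ tA.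
near=> n.
have bY : `|\int[P]_w A (Y n w) - \int[P]_w g (Y n w)| <= 2 * e'.
  apply: (bound _ _ P (Y n) K1) => //; first exact: mY.
    by rewrite le_max lexx.
  by near: n.
have {}bZ : `|\int[Q]_w A (Z w) - \int[Q]_w g (Z w)| <= 2 * e'.
  by apply: bZ; rewrite le_max lexx orbT.
have cn : `|\int[Q]_w A (Z w) - \int[P]_w A (Y n w)| <= e' by near: n.
have -> : e = 5 * e' by rewrite /e'; field.
move: bY bZ cn; rewrite !ler_norml => /andP[? ?] /andP[? ?] /andP[? ?].
by apply/andP; split; lra.
Unshelve. all: by end_near. Qed.

End levy.

(** * Elementary bounds for sine and cosine, and integral calculus for real functions *)

Section trigonometric_inequalities.
Context {R : realType}.
Implicit Types x : R.

Let sin_mvt x : 0 <= x -> exists2 c : R, 0 <= c <= x & sin x = cos c * x.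
Proof.
move=> x0.
have [|c] := @MVT_segment R sin cos 0 x x0 (fun y _ => is_derive_sin y).
  by apply: continuous_subspaceT; exact: continuous_sin.
by rewrite in_itv/= sin0 !subr0 => cx ->; exists c.
Qed.

Lemma norm_sin_norm x : `|sin `|x| | = `|sin x|.
Proof. by case: (ger0P x) => // _; rewrite sinN normrN. Qed.

Lemma norm_sin_le x : `|sin x| <= `|x|.
Proof.
rewrite -norm_sin_norm; have [c _ ->] := sin_mvt (normr_ge0 x).
by rewrite normrM normr_id ler_piMl// cos_max.
Qed.

Lemma one_minus_cosE x : 1 - cos x = 2 * sin (x / 2) ^+ 2.
Proof.
have {1}-> : x = x / 2 *+ 2 by rewrite -mulr_natr; field.
by rewrite cos_mulr2n cos2sin2 -mulr_natr; ring.
Qed.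

Lemma one_minus_cos_ge0 x : 0 <= 1 - cos x.
Proof. by rewrite subr_ge0 cos_le1. Qed.

Lemma one_minus_cos_le x : 1 - cos x <= x ^+ 2 / 2.
Proof.
rewrite one_minus_cosE.
have : sin (x / 2) ^+ 2 <= (x / 2) ^+ 2.
  rewrite -(real_normK (num_real (sin _))) -(real_normK (num_real (x / 2))).
  by rewrite lerXn2r ?nnegrE// norm_sin_le.
by move=> H; apply: le_trans (ler_wpM2l _ H) _ => //; lra.
Qed.

Lemma sub_sin_le3 x : `|x - sin x| <= `|x| ^+ 3 / 2.
Proof.
have H (y : R) : 0 <= y -> `|y - sin y| <= y ^+ 3 / 2.
  move=> y0; have [c /andP[c0 cy] ->] := sin_mvt y0.
  rewrite -[X in `|X - _|]mul1r -mulrBl normrM (ger0_norm y0).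
  rewrite ger0_norm ?one_minus_cos_ge0//.
  have -> : y ^+ 3 / 2 = y ^+ 2 / 2 * y by rewrite exprSr; ring.
  rewrite ler_wpM2r//; apply: le_trans (one_minus_cos_le c) _.
  by rewrite ler_pM2r// lerXn2r// nnegrE.
have [x0|x0] := ger0P x; first exact: H.
have -> : x - sin x = - (- x - sin (- x)) by rewrite sinN; ring.
by rewrite normrN; apply: H; rewrite oppr_ge0 ltW.
Qed.

(** Near zero the cubic bound is sharper, but a dominating function must be quadratic at infinity to
    be integrable under a second moment; the two bounds are glued at [2]. *)
Lemma sub_sin_le2 x : `|x - sin x| <= x ^+ 2.
Proof.
have [x2|x2] := leP `|x| 2.
  apply: le_trans (sub_sin_le3 x) _.
  rewrite exprSr -mulrA -normrX ger0_norm ?sqr_ge0// ler_piMr ?sqr_ge0//.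
  by rewrite ler_pdivrMr// mul1r.
apply: (@le_trans _ _ (2 * `|x|)).
  by apply: le_trans (ler_normB _ _) _; have := norm_sin_le x; lra.
by rewrite -[leRHS]ger0_norm ?sqr_ge0// normrX expr2 ler_wpM2r// ltW.
Qed.

Lemma one_minus_cos_approx x : `|1 - cos x - x ^+ 2 / 2| <= x ^+ 4 / 8.
Proof.
rewrite one_minus_cosE.
have -> : 2 * sin (x / 2) ^+ 2 - x ^+ 2 / 2 =
   - 2 * ((x / 2 - sin (x / 2)) * (x / 2 + sin (x / 2))) by field.
rewrite !normrM normrN (ger0_norm (ler0n _ 2)).
have -> : x ^+ 4 / 8 = 2 * (`|x / 2| ^+ 3 / 2 * (2 * `|x / 2|)).
  have E (z : R) : 2 * (z ^+ 3 / 2 * (2 * z)) = 2 * (z ^+ 2) ^+ 2 by field.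
  rewrite E.
  by rewrite -normrX ger0_norm ?sqr_ge0//; field.
rewrite ler_wpM2l// ler_pM//; first exact: sub_sin_le3.
by apply: le_trans (ler_normD _ _) _; have := norm_sin_le (x / 2); lra.
Qed.

End trigonometric_inequalities.

Section Rintegral_tools.
Context {d : measure_display} {T : measurableType d} {R : realType}
  (P : probability T R).
Implicit Types (f g : T -> R).

Lemma integrable_sum_Rintegral (I : Type) (s : seq I) (F : I -> T -> R) :
  (forall i, P.-integrable setT (EFin \o F i)) ->
  P.-integrable setT (EFin \o (fun w => \sum_(i <- s) F i w)) /\
  \int[P]_w (\sum_(i <- s) F i w) = \sum_(i <- s) \int[P]_w F i w.
Proof.
move=> intF; elim: s => [|i s [IH1 IH2]].
  rewrite big_nil; under eq_fun do rewrite big_nil.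
  split; first by apply: (bounded_integrable P (C := 0)) => // w; rewrite normr0.
  by rewrite Rintegral_cst// mul0r.
rewrite big_cons; under eq_fun do rewrite big_cons.
split; first exact: (integrableD measurableT (intF i) IH1).
by rewrite RintegralD// IH2.
Qed.

Lemma integrable_RintegralZl f (a : R) : P.-integrable setT (EFin \o f) ->
  P.-integrable setT (EFin \o (fun w => a * f w)) /\
  \int[P]_w (a * f w) = a * \int[P]_w f w.
Proof. by move=> intf; split; [exact: (integrableZl measurableT a intf)|rewrite RintegralZl]. Qed.

Lemma integrable_RintegralD f g : P.-integrable setT (EFin \o f) -> P.-integrable setT (EFin \o g) ->
  P.-integrable setT (EFin \o (fun w => f w + g w)) /\
  \int[P]_w (f w + g w) = \int[P]_w f w + \int[P]_w g w.
Proof. by move=> intf intg; split; [exact: (integrableD measurableT intf intg)|rewrite RintegralD]. Qed.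

Lemma integrable_RintegralB f g : P.-integrable setT (EFin \o f) -> P.-integrable setT (EFin \o g) ->
  P.-integrable setT (EFin \o (fun w => f w - g w)) /\
  \int[P]_w (f w - g w) = \int[P]_w f w - \int[P]_w g w.
Proof. by move=> intf intg; split; [exact: (integrableB measurableT intf intg)|rewrite RintegralB]. Qed.

Lemma integrable_cstT (a : R) : P.-integrable setT (EFin \o (fun _ : T => a)).
Proof. exact: (bounded_integrable P (C := `|a|)). Qed.

Lemma Rintegral_cstT (a : R) : \int[P]_w a = a.
Proof. by rewrite Rintegral_cst//= probability_setT mulr1. Qed.

Lemma integrable_measurable f : P.-integrable setT (EFin \o f) -> measurable_fun setT f.
Proof. by move=> /integrableP[/measurable_EFinP]. Qed.

Lemma le_integrable_norm f g : measurable_fun setT f -> (forall w, `|f w| <= g w) ->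
  P.-integrable setT (EFin \o g) -> P.-integrable setT (EFin \o f).
Proof.
move=> mf fg; apply: le_integrable => //; first exact/measurable_EFinP.
by move=> w _ /=; rewrite lee_fin; apply: le_trans (fg w) (ler_norm _).
Qed.

Lemma Rdominated_convergence (F : nat -> T -> R) f g :
  (forall n, measurable_fun setT (F n)) -> measurable_fun setT f ->
  (forall w, F n w @[n --> \oo] --> f w) ->
  P.-integrable setT (EFin \o g) -> (forall n w, `|F n w| <= g w) ->
  \int[P]_w F n w @[n --> \oo] --> \int[P]_w f w.
Proof.
move=> mF mf Ff intg Fg.
have [|||||intf _ H] := @dominated_convergence _ _ _ P setT measurableT
  (fun n => EFin \o F n) (EFin \o f) (EFin \o g) => //.
- by move=> n; exact/measurable_EFinP.
- exact/measurable_EFinP.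
- by apply: aeW => w _; apply: cvg_EFin; [near=> n|exact: Ff].
- by apply: aeW => w n _; rewrite lee_fin.
have /fine_cvgP[_] : (\int[P]_w (F n w)%:E)%E @[n --> \oo] --> (\int[P]_w f w)%:E.
  rewrite /Rintegral fineK; first exact: H.
  exact: integrable_fin_num.
exact.
Unshelve. all: by end_near. Qed.

Lemma integrable_sq_mul f g : measurable_fun setT f -> measurable_fun setT g ->
  P.-integrable setT (EFin \o (fun w => f w ^+ 2)) ->
  P.-integrable setT (EFin \o (fun w => g w ^+ 2)) ->
  P.-integrable setT (EFin \o (fun w => f w * g w)).
Proof.
move=> mf mg intf intg.
apply: (le_integrable_norm (g := fun w => f w ^+ 2 + g w ^+ 2)).
- exact: measurable_funM.
- move=> w; rewrite normrM -(real_normK (num_real (f w))) -(real_normK (num_real (g w))).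
  by have := sqr_ge0 (`|f w| - `|g w|); have := sqr_ge0 (`|f w| + `|g w|);
    rewrite !expr2; nra.
- exact: (integrable_RintegralD intf intg).1.
Qed.

Lemma integrable_of_sq f : measurable_fun setT f ->
  P.-integrable setT (EFin \o (fun w => f w ^+ 2)) -> P.-integrable setT (EFin \o f).
Proof.
move=> mf intf.
have := @integrable_sq_mul f (fun=> 1) mf (measurable_cst _) intf.
rewrite expr1n => /(_ (integrable_cstT 1)).
by under eq_fun do rewrite mulr1.
Qed.

Lemma whp_chebyshev f (v e : R) : measurable_fun setT f ->
  P.-integrable setT (EFin \o (fun w => f w ^+ 2)) ->
  \int[P]_w (f w ^+ 2) <= v -> 0 < e -> whp P (v / e ^+ 2) (fun w => `|f w| <= e).
Proof.
move=> mf intf fv e0.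
pose A := [set w | e < `|f w|].
have mA : measurable A.
  rewrite (_ : A = setT `&` (fun w => `|f w|) @^-1` `]e, +oo[%classic); last first.
    by apply/seteqP; split => w /=; rewrite in_itv/= andbT; [split|case].
  by apply: (measurableT_comp (@normr_measurable R setT) mf).
have intA : P.-integrable setT (EFin \o (\1_A : T -> R)).
  by apply: (bounded_integrable P (C := 1)) => // w; rewrite indicE; case: (_ \in _);
     rewrite ?normr1 ?normr0.
exists A; split => //; last by move=> w /negP; rewrite -leNgt.
rewrite -[leLHS]fineK ?fin_num_measure// lee_fin ler_pdivlMr ?exprn_gt0//.
apply: le_trans fv; rewrite mulrC.
have -> : fine (P A) = \int[P]_w \1_A w by rewrite /Rintegral integral_indic// setIT.
rewrite -(integrable_RintegralZl (e ^+ 2) intA).2.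
apply: le_Rintegral => //; first exact: (integrable_RintegralZl (e ^+ 2) intA).1.
move=> w _; rewrite indicE; case: (boolP (w \in A)) => [|_].
  rewrite inE /A/= mulr1 => ef; rewrite -(real_normK (num_real (f w))).
  by rewrite lerXn2r// ?nnegrE// ltW.
by rewrite mulr0 sqr_ge0.
Qed.

End Rintegral_tools.

(** * From the product formula for events to independence of functions *)

Section identically_distributed.
Context {d : measure_display} {T : measurableType d} {R : realType}
  (P : probability T R) (X : nat -> {RV P >-> R})
  (idX : identically_distributed P (fun i => X i : T -> R)).

Lemma ident_integral i (f : R -> \bar R) : measurable_fun setT f ->
  (\int[P]_w f (X i w) = \int[P]_w f (X 0%N w))%E.
Proof.
move=> mf.
have ge0 (h : R -> \bar R) : measurable_fun setT h -> (forall x, 0 <= h x)%E ->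
    (\int[P]_w h (X i w) = \int[P]_w h (X 0%N w))%E.
  move=> mh h0.
  have H j := ge0_integral_distribution (X j) mh h0.
  rewrite -[LHS]H -[RHS]H; apply: eq_measure_integral => A mA _.
  exact: idX.
rewrite integralE [RHS]integralE; congr (_ - _)%E.
- have H := ge0 (f^\+)%E (measurable_funepos mf) (funepos_ge0 f).
  by under eq_integral do rewrite funeposE/= -funeposE; under [RHS]eq_integral do rewrite funeposE/= -funeposE.
- have H := ge0 (f^\-)%E (measurable_funeneg mf) (funeneg_ge0 f).
  by under eq_integral do rewrite funenegE/= -funenegE; under [RHS]eq_integral do rewrite funenegE/= -funenegE.
Qed.

Lemma ident_Rintegral i (f : R -> R) : measurable_fun setT f ->
  \int[P]_w f (X i w) = \int[P]_w f (X 0%N w).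
Proof. by move=> mf; congr fine; apply: (ident_integral i (f := EFin \o f)); exact/measurable_EFinP. Qed.

Lemma ident_integrable i (f : R -> R) : measurable_fun setT f ->
  P.-integrable setT (EFin \o (fun w => f (X 0%N w))) ->
  P.-integrable setT (EFin \o (fun w => f (X i w))).
Proof.
move=> mf /integrableP[_ H]; apply/integrableP; split.
  by apply/measurable_EFinP; exact: measurableT_comp mf (measurable_funPT (X i)).
rewrite (_ : (\int[P]_x _ = \int[P]_w (abse \o (EFin \o f)) (X i w))%E)//.
rewrite (ident_integral i (f := abse \o (EFin \o f)))//.
by apply: measurableT_comp => //; exact/measurable_EFinP.
Qed.

End identically_distributed.

Section layer_approximation.
Context {R : realType}.

Lemma sum_ltn_minn (n N : nat) : (\sum_(j < N) (j < n)%N = minn N n)%N.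
Proof. by elim: N => [|N IH]; rewrite ?big_ord0 ?big_ord_recr/= ?IH; lia. Qed.

(** The sum counts the levels below [N * y], so it is the integer part of [N * y]. Applied to a
    function, it gives a uniform approximation by indicators of level sets. *)
Lemma layer_approx (y : R) (N : nat) : (0 < N)%N -> 0 <= y <= 1 ->
  `|y - N%:R^-1 * \sum_(j < N) (j.+1%:R <= N%:R * y)%R%:R| <= N%:R^-1.
Proof.
move=> N0 /andP[y0 y1]; have NR : 0 < N%:R :> R by rewrite ltr0n.
pose n := Num.truncn (N%:R * y).
have Ny0 : 0 <= N%:R * y by rewrite mulr_ge0// ltW.
have := truncn_itv Ny0; rewrite -/n => /andP[n1 n2].
have nN : (n <= N)%N.
  by rewrite -(ler_nat R); apply: le_trans n1 _; rewrite ler_piMr// ltW.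
have -> : \sum_(j < N) (j.+1%:R <= N%:R * y)%R%:R = n%:R :> R.
  rewrite -natr_sum; congr (_%:R).
  rewrite -[RHS](minn_idPr nN) -sum_ltn_minn; apply: eq_bigr => j _.
  congr (nat_of_bool _); apply/idP/idP => [h|h].
    by rewrite -ltnS -(ltr_nat R); apply: le_lt_trans h n2.
  by apply: le_trans n1; rewrite ler_nat.
have -> : y - N%:R^-1 * n%:R = N%:R^-1 * (N%:R * y - n%:R).
  by rewrite mulrBr mulKf// gt_eqF.
rewrite normrM gtr0_norm ?invr_gt0// ler_piMr ?invr_ge0 1?ltW//.
by rewrite ger0_norm ?subr_ge0//; move: n2; rewrite -natr1; lra.
Qed.

End layer_approximation.

Section extension_from_indicators.
Context {d : measure_display} {T : measurableType d} {R : realType}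
  (P : probability T R) (V : T -> R) (Y : T -> R) (C c : R).
Context (mV : measurable_fun setT V) (VC : forall w, `|V w| <= C)
  (mY : measurable_fun setT Y)
  (HV : forall B, measurable B ->
    \int[P]_w (V w * \1_B (Y w)) = c * \int[P]_w \1_B (Y w)).

(** A negative bound would leave no sample point at all, against total mass one. *)
Let C0 : 0 <= C.
Proof.
rewrite leNgt; apply/negP => Cn.
have E : (setT : set T) = set0.
  by apply/seteqP; split => // w _; have := le_lt_trans (VC w) Cn; rewrite ltNge normr_ge0.
by have := @probability_setT _ _ _ P; rewrite E measure0 => /eqP; rewrite eq_sym onee_eq0.
Qed.

Let intV : P.-integrable setT (EFin \o V).
Proof. exact: (bounded_integrable P mV VC). Qed.

Let intf (f : R -> R) (D : R) : measurable_fun setT f -> (forall x, `|f x| <= D) ->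
  P.-integrable setT (EFin \o (fun w => f (Y w))) /\
  P.-integrable setT (EFin \o (fun w => V w * f (Y w))).
Proof.
move=> mf fD; have mfY := measurableT_comp mf mY; split.
  exact: (bounded_integrable P mfY (fun w => fD _)).
apply: (bounded_integrable P (C := C * D)); first exact: measurable_funM.
by move=> w; rewrite normrM ler_pM.
Qed.

Let ext01 (f : R -> R) : measurable_fun setT f -> (forall x, 0 <= f x <= 1) ->
  \int[P]_w (V w * f (Y w)) = c * \int[P]_w f (Y w).
Proof.
move=> mf f01.
have f1 x : `|f x| <= 1 by have /andP[? ?] := f01 x; rewrite ger0_norm.
pose B N j := [set x : R | j.+1%:R <= N%:R * f x].
have mB N j : measurable (B N j).
  rewrite (_ : B N j = setT `&` (fun x => N%:R * f x) @^-1` `[j.+1%:R, +oo[%classic).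
    have mNf : measurable_fun setT (fun x => N%:R * f x) by apply: measurable_funM.
    exact: mNf.
  by apply/seteqP; split => w; rewrite /B /= in_itv/= andbT; [split|case].
pose g N x : R := N%:R^-1 * \sum_(j < N) \1_(B N j) x.
have mi N j : measurable_fun setT (\1_(B N j) : R -> R) by exact: measurable_indic.
have i1 N j x : `|\1_(B N j) x : R| <= 1.
  by rewrite indicE; case: (_ \in _); rewrite ?normr1 ?normr0.
have gP N : [/\ P.-integrable setT (EFin \o (fun w => g N (Y w))),
    P.-integrable setT (EFin \o (fun w => V w * g N (Y w))) &
    \int[P]_w (V w * g N (Y w)) = c * \int[P]_w g N (Y w)].
  have [s1 s2] := integrable_sum_Rintegral (index_enum (ordinal N))
    (fun j => (intf (mi N j) (i1 N j)).1).
  have [s3 s4] := integrable_sum_Rintegral (index_enum (ordinal N))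
    (fun j => (intf (mi N j) (i1 N j)).2).
  have [z1 z2] := integrable_RintegralZl N%:R^-1 s1.
  have [z3 z4] := integrable_RintegralZl N%:R^-1 s3.
  have E : (fun w => V w * g N (Y w)) = (fun w => N%:R^-1 * \sum_(j < N) V w * \1_(B N j) (Y w)).
    by apply/funext => w; rewrite /g mulrCA mulr_sumr.
  rewrite E; split => //; rewrite z2 z4 s2 s4 [RHS]mulrCA; congr (_ * _).
  by rewrite mulr_sumr; apply: eq_bigr => j _; exact: HV.
have fg N x : (0 < N)%N -> `|f x - g N x| <= N%:R^-1.
  move=> N0; have := layer_approx N0 (f01 x); rewrite /g.
  under [in X in _ -> X]eq_bigr => j _.
    rewrite indicE (_ : (x \in B N j) = (j.+1%:R <= N%:R * f x)); last first.
      by apply/idP/idP; rewrite inE.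
    over.
  by [].
apply/eqP; rewrite -subr_eq0 -normr_le0; apply/ler_addgt0Pr => e e0; rewrite add0r.
(* Replacing [f] by its step approximant costs [C / N] on the left and [|c| / N] on the right; this
   [N] makes the total at most [e]. *)
pose N := (Num.truncn ((C + `|c|) / e)).+1.
have NR : 0 < N%:R :> R by rewrite ltr0n.
have [g1 g2 g3] := gP N; have [f1' f2'] := intf mf f1.
have -> : \int[P]_w (V w * f (Y w)) - c * \int[P]_w f (Y w) =
    \int[P]_w (V w * f (Y w) - V w * g N (Y w)) - c * \int[P]_w (f (Y w) - g N (Y w)).
  by rewrite (integrable_RintegralB f2' g2).2 (integrable_RintegralB f1' g1).2 g3; ring.
have bnd (h : T -> R) (D : R) : P.-integrable setT (EFin \o h) -> (forall w, `|h w| <= D) ->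
    `|\int[P]_w h w| <= D.
  move=> inth hD; apply: le_trans (le_normr_Rintegral measurableT inth) _.
  rewrite -[leRHS](Rintegral_cstT P D); apply: le_Rintegral => //.
    exact: integrable_norm.
  exact: integrable_cstT.
have b1 : `|\int[P]_w (V w * f (Y w) - V w * g N (Y w))| <= C * N%:R^-1.
  apply: bnd; first exact: (integrable_RintegralB f2' g2).1.
  by move=> w; rewrite -mulrBr normrM ler_pM// fg.
have b2 : `|\int[P]_w (f (Y w) - g N (Y w))| <= N%:R^-1.
  by apply: bnd => [|w]; [exact: (integrable_RintegralB f1' g1).1|exact: fg].
apply: le_trans (ler_normB _ _) _; rewrite normrM.
apply: (@le_trans _ _ (C * N%:R^-1 + `|c| * N%:R^-1)); first by rewrite lerD// ler_wpM2l.
rewrite -mulrDl ler_pdivrMr// mulrC -ler_pdivrMr//; exact/ltW/truncnS_gt.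
Qed.

(** An affine change brings [f] into [[0, 1]], with [2 * D + 1] nonzero even for [D = 0]. The
    constant term needs the mean of [V] to be [c], which is [HV] for the full set. *)
Lemma integral_mul_ext (f : R -> R) (D : R) : measurable_fun setT f -> (forall x, `|f x| <= D) ->
  \int[P]_w (V w * f (Y w)) = c * \int[P]_w f (Y w).
Proof.
move=> mf fD.
have D0 : 0 <= D by apply: le_trans (fD 0).
have D1 : 0 < 2 * D + 1 by lra.
pose h x := (2 * D + 1)^-1 * (f x + D).
have mh : measurable_fun setT h.
  by apply: measurable_funM => //; exact: measurable_funD.
have h01 x : 0 <= h x <= 1.
  have := fD x; rewrite ler_norml => /andP[? ?].
  apply/andP; split; first by apply: mulr_ge0; [rewrite invr_ge0 ltW|lra].
  by rewrite /h mulrC ler_pdivrMr//; lra.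
have h1 x : `|h x| <= 1 by have /andP[? ?] := h01 x; rewrite ger0_norm.
have [i1 i2] := intf mh h1.
have V1 : \int[P]_w V w = c.
  have := HV measurableT.
  under eq_Rintegral do rewrite indicE in_setT mulr1.
  under [in RHS]eq_Rintegral do rewrite indicE in_setT.
  by rewrite Rintegral_cstT mulr1.
have fE x : f x = (2 * D + 1) * h x - D by rewrite /h mulVKf ?gt_eqF// addrK.
under [in RHS]eq_Rintegral do rewrite fE.
rewrite (_ : (fun w => V w * f (Y w)) = (fun w => (2 * D + 1) * (V w * h (Y w)) - D * V w)).
  have [z1 z2] := integrable_RintegralZl (2 * D + 1) i2; have [z3 z4] := integrable_RintegralZl (2 * D + 1) i1.
  have [z5 z6] := integrable_RintegralZl D intV.
  rewrite (integrable_RintegralB z1 z5).2 z2 z6 (ext01 mh h01) V1.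
  by rewrite (integrable_RintegralB z3 (integrable_cstT P D)).2 z4 Rintegral_cstT; ring.
by apply/funext => w; rewrite fE; ring.
Qed.

End extension_from_indicators.

Section independence.
Context {d : measure_display} {T : measurableType d} {R : realType}
  (P : probability T R) (X : nat -> {RV P >-> R})
  (indX : mutually_independent P (fun i => X i : T -> R)).
Implicit Types (B : nat -> set R) (N : nat).

Definition indic_prod B N (w : T) : R := \prod_(i < N) \1_(B i) (X i w).

Lemma indic_prodE B N w :
  indic_prod B N w = \1_(\big[setI/setT]_(i < N) (X i @^-1` B i)) w.
Proof.
rewrite /indic_prod; elim: N => [|N IH].
  by rewrite !big_ord0 indicT.
rewrite !big_ord_recr/= IH !indicE in_setI.
by rewrite [w \in _ @^-1` _]inE; case: (_ \in _); rewrite ?mul0r// mul1r;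
  congr (nat_of_bool _)%:R; apply/idP/idP; rewrite inE.
Qed.

Lemma measurable_indic_prod_set B N : (forall i, measurable (B i)) ->
  measurable (\big[setI/setT]_(i < N) (X i @^-1` B i)).
Proof.
move=> mB; elim: N => [|N IH]; first by rewrite big_ord0.
rewrite big_ord_recr/=; apply: measurableI => //; exact: measurable_funPTI.
Qed.

Lemma measurable_indic_prod B N : (forall i, measurable (B i)) ->
  measurable_fun setT (indic_prod B N).
Proof.
move=> mB; rewrite (_ : indic_prod B N = \1_(\big[setI/setT]_(i < N) (X i @^-1` B i))).
  by apply: measurable_indic; exact: measurable_indic_prod_set.
by apply/funext => w; exact: indic_prodE.
Qed.

Lemma indic_prod_le1 B N w : `|indic_prod B N w| <= 1.
Proof. by rewrite indic_prodE indicE; case: (_ \in _); rewrite ?normr1 ?normr0. Qed.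

Lemma integral_indic_prod B N : (forall i, measurable (B i)) ->
  \int[P]_w indic_prod B N w = \prod_(i < N) \int[P]_w \1_(B i) (X i w).
Proof.
move=> mB; under eq_Rintegral do rewrite indic_prodE.
rewrite /Rintegral integral_indic ?setIT//; last exact: measurable_indic_prod_set.
rewrite [X in fine X](indX N mB).
have E i : (\int[P]_w (\1_(B i) (X i w))%:E = P (X i @^-1` B i))%E.
  rewrite (_ : P (X i @^-1` B i) = P (X i @^-1` B i `&` setT)); last by rewrite setIT.
  by rewrite -integral_indic//; exact: measurable_funPTI.
under [RHS]eq_bigr do rewrite E.
elim: N {E} => [|N IH]; first by rewrite !big_ord0.
rewrite !big_ord_recr/= fineM ?IH// ?fin_num_measure//.
  by apply/prode_fin_num => i _; rewrite fin_num_measure//; exact: measurable_funPTI.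
exact: measurable_funPTI.
Qed.

(** A slot holding the full set is free: filling it with [A] multiplies both the product and its
    mean. This is independence of one variable from the others, in the form to which
    [integral_mul_ext] applies. *)
Lemma integral_indic_prod_refine B N k (A : set R) : (forall i, measurable (B i)) ->
  measurable A -> B k = setT -> (k < N)%N ->
  let BA i := if i == k then A else B i in
  (forall w, indic_prod BA N w = indic_prod B N w * \1_A (X k w)) /\
  \int[P]_w indic_prod BA N w = \int[P]_w indic_prod B N w * \int[P]_w \1_A (X k w).
Proof.
move=> mB mA Bk kN BA.
have mBA i : measurable (BA i) by rewrite /BA; case: ifP.
split=> [w|].
  rewrite /indic_prod (bigD1 (Ordinal kN))//= [in RHS](bigD1 (Ordinal kN))//=.
  rewrite /BA eqxx Bk indicT mul1r mulrC; congr (_ * _); apply: eq_bigr => i ik.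
  by rewrite ifN.
rewrite !integral_indic_prod// (bigD1 (Ordinal kN))//= [in RHS](bigD1 (Ordinal kN))//=.
rewrite /BA eqxx Bk (_ : \int[P]_w \1_setT (X k w) = 1).
  rewrite mul1r mulrC; congr (_ * _); apply: eq_bigr => i ik.
  by rewrite ifN.
by under eq_Rintegral do rewrite indicT; rewrite Rintegral_cstT.
Qed.

(** Two passes of [integral_mul_ext]: from indicators to [f] in the [i]-th variable with an
    indicator of the [j]-th held fixed, then from indicators to [g] in the [j]-th. *)
Lemma indep2_bounded i j (f g : R -> R) (C D : R) : i != j ->
  measurable_fun setT f -> measurable_fun setT g ->
  (forall x, `|f x| <= C) -> (forall x, `|g x| <= D) ->
  \int[P]_w (f (X i w) * g (X j w)) = \int[P]_w f (X i w) * \int[P]_w g (X j w).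
Proof.
move=> ij mf mg fC gD.
have mX k := measurable_funPT (X k).
have i1 (A : set R) x : `|\1_A x : R| <= 1.
  by rewrite indicE; case: (_ \in _); rewrite ?normr1 ?normr0.
have step A : measurable A ->
    \int[P]_w (\1_A (X j w) * f (X i w)) = \int[P]_w \1_A (X j w) * \int[P]_w f (X i w).
  move=> mA.
  have mA1 : measurable_fun setT (fun w => \1_A (X j w) : R).
    by apply: (measurableT_comp (measurable_indic mA) (mX j)).
  apply: (integral_mul_ext mA1 (fun w => i1 A _) (mX i) _ mf fC) => B mB.
  pose N := (i + j).+1.
  have iN : (i < N)%N by rewrite ltnS leq_addr.
  have jN : (j < N)%N by rewrite ltnS leq_addl.
  have mT (k : nat) : measurable ((fun _ : nat => setT : set R) k) by [].
  have [E1 F1] := integral_indic_prod_refine (B := fun _ : nat => setT : set R) mT mA erefl jN.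
  set BA := (fun k => if k == j then A else setT) in E1 F1.
  have mBA k : measurable (BA k) by rewrite /BA; case: ifP.
  have BAi : BA i = setT by rewrite /BA (negPf ij).
  have [E2 F2] := integral_indic_prod_refine mBA mB BAi iN.
  have W1 w : indic_prod (fun=> setT) N w = 1.
    by rewrite /indic_prod big1// => k _; rewrite indicT.
  have F1' : \int[P]_w indic_prod BA N w = \int[P]_w \1_A (X j w).
    by rewrite F1; under eq_Rintegral do rewrite W1; rewrite Rintegral_cstT mul1r.
  rewrite -F1' -F2; apply: eq_Rintegral => w _.
  by rewrite E2 E1 W1 mul1r.
have mfX := measurableT_comp mf (mX i).
apply: (integral_mul_ext mfX (fun w => fC _) (mX j) _ mg gD) => B mB.
by under eq_Rintegral do rewrite mulrC; rewrite step// mulrC.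
Qed.

Context (idX : identically_distributed P (fun i => X i : T -> R)).

Let trunc_fun (U : R -> R) (n : nat) (x : R) : R := U x * \1_[set y | `|U y| <= n%:R] x.

Let measurable_trunc_fun (U : R -> R) n : measurable_fun setT U ->
  measurable_fun setT (trunc_fun U n).
Proof.
move=> mU; apply: measurable_funM => //; apply: measurable_indic.
rewrite (_ : [set y | _] = setT `&` (fun x => `|U x|) @^-1` `]-oo, n%:R]%classic).
  by apply: (measurableT_comp (@normr_measurable R setT) mU).
by apply/seteqP; split => w; rewrite /= in_itv/=; [split|case].
Qed.

Let trunc_fun_le (U : R -> R) n x : `|trunc_fun U n x| <= n%:R.
Proof.
rewrite /trunc_fun indicE; case: (boolP (x \in _)) => [|_]; rewrite ?mulr0 ?normr0// mulr1.
by rewrite inE.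
Qed.

Let trunc_fun_le_norm (U : R -> R) n x : `|trunc_fun U n x| <= `|U x|.
Proof.
by rewrite /trunc_fun indicE; case: (x \in _); rewrite ?mulr0 ?normr0// mulr1.
Qed.

Let trunc_fun_cvg (U : R -> R) x : trunc_fun U n x @[n --> \oo] --> U x.
Proof.
apply: cvg_near_cst; exists (Num.truncn `|U x|).+1 => // n /= Hn.
rewrite /trunc_fun indicE mem_set ?mulr1//=.
by apply/ltW; apply: lt_le_trans (truncnS_gt _) _; rewrite ler_nat.
Qed.

(** [U] is merely square integrable, so the factorisation is applied to truncations and passed to
    the limit by dominated convergence on both sides. *)
Lemma indep_orthogonal i j (U : R -> R) : i != j -> measurable_fun setT U ->
  P.-integrable setT (EFin \o (fun w => U (X 0%N w) ^+ 2)) ->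
  \int[P]_w U (X 0%N w) = 0 -> \int[P]_w (U (X i w) * U (X j w)) = 0.
Proof.
move=> ij mU intU U0.
have mX k := measurable_funPT (X k).
have mUX k : measurable_fun setT (fun w => U (X k w)) by exact: measurableT_comp mU (mX k).
have mUn k n : measurable_fun setT (fun w => trunc_fun U n (X k w)).
  exact: measurableT_comp (measurable_trunc_fun n mU) (mX k).
have intU2 k : P.-integrable setT (EFin \o (fun w => U (X k w) ^+ 2)).
  by apply: (ident_integrable idX k (f := fun x => U x ^+ 2)) => //; exact: measurable_funX.
have intU1 k : P.-integrable setT (EFin \o (fun w => U (X k w))).
  exact: integrable_of_sq.
have c1 k : \int[P]_w trunc_fun U n (X k w) @[n --> \oo] --> (0 : R).
  rewrite -U0 -(ident_Rintegral idX k mU).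
  apply: (Rdominated_convergence (g := fun w => `|U (X k w)|)) => //.
  exact: (integrable_norm (intU1 k)).
have c2 : \int[P]_w (trunc_fun U n (X i w) * trunc_fun U n (X j w)) @[n --> \oo] -->
    \int[P]_w (U (X i w) * U (X j w)).
  apply: (Rdominated_convergence (g := fun w => `|U (X i w) * U (X j w)|)) => //.
  - by move=> n; exact: measurable_funM.
  - exact: measurable_funM.
  - by move=> w; apply: cvgM; exact: trunc_fun_cvg.
  - have := integrable_norm (integrable_sq_mul (mUX i) (mUX j) (intU2 i) (intU2 j)); exact.
  - by move=> n w; rewrite normrM [leRHS]normrM; apply: ler_pM.
have c3 : \int[P]_w (trunc_fun U n (X i w) * trunc_fun U n (X j w)) @[n --> \oo] -->
    (0 * 0 : R).
  under eq_fun => n.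
    rewrite (indep2_bounded ij (measurable_trunc_fun n mU) (measurable_trunc_fun n mU)
      (trunc_fun_le U n) (trunc_fun_le U n)).
    over.
  exact: (cvgM (c1 i) (c1 j)).
by rewrite (cvg_unique _ c2 c3) ?mulr0.
Qed.

Lemma iid_second_moment (U : R -> R) n : measurable_fun setT U ->
  P.-integrable setT (EFin \o (fun w => U (X 0%N w) ^+ 2)) ->
  \int[P]_w U (X 0%N w) = 0 ->
  P.-integrable setT (EFin \o (fun w => (\sum_(i < n) U (X i w)) ^+ 2)) /\
  \int[P]_w ((\sum_(i < n) U (X i w)) ^+ 2) = n%:R * \int[P]_w (U (X 0%N w) ^+ 2).
Proof.
move=> mU intU U0.
have mUX k : measurable_fun setT (fun w => U (X k w)).
  exact: measurableT_comp mU (measurable_funPT (X k)).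
have intU2 k : P.-integrable setT (EFin \o (fun w => U (X k w) ^+ 2)).
  by apply: (ident_integrable idX k (f := fun x => U x ^+ 2)) => //; exact: measurable_funX.
have intij i j : P.-integrable setT (EFin \o (fun w => U (X i w) * U (X j w))).
  exact: integrable_sq_mul.
have inner i := integrable_sum_Rintegral (index_enum (ordinal n)) (fun j : 'I_n => intij i j).
have [q1 q2] := integrable_sum_Rintegral (index_enum (ordinal n)) (fun i : 'I_n => (inner i).1).
have E w : (\sum_(i < n) U (X i w)) ^+ 2 = \sum_(i < n) \sum_(j < n) U (X i w) * U (X j w).
  by rewrite expr2 mulr_suml; apply: eq_bigr => i _; rewrite mulr_sumr.
under eq_fun do rewrite E.
split => //; rewrite q2.
rewrite (eq_bigr (fun=> \int[P]_w (U (X 0%N w) ^+ 2))).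
  by rewrite sumr_const card_ord mulr_natl.
move=> i _; rewrite (inner i).2 (bigD1 i)//= big1 ?addr0.
  rewrite -(ident_Rintegral idX i (f := fun x => U x ^+ 2))//.
  exact: measurable_funX.
by move=> j ji; apply: indep_orthogonal => //; rewrite eq_sym.
Qed.

Lemma iid_sum_whp (U : R -> R) n (v e : R) : measurable_fun setT U ->
  P.-integrable setT (EFin \o (fun w => U (X 0%N w) ^+ 2)) ->
  \int[P]_w U (X 0%N w) = 0 -> \int[P]_w (U (X 0%N w) ^+ 2) <= v -> (0 < n)%N -> 0 < e ->
  whp P (v / e ^+ 2) (fun w => `|(Num.sqrt n%:R)^-1 * \sum_(i < n) U (X i w)| <= e).
Proof.
move=> mU intU U0 Uv n0 e0; have [i1 i2] := iid_second_moment n mU intU U0.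
have nR : 0 < n%:R :> R by rewrite ltr0n.
have E w : ((Num.sqrt n%:R)^-1 * \sum_(i < n) U (X i w)) ^+ 2 =
    n%:R^-1 * (\sum_(i < n) U (X i w)) ^+ 2.
  by rewrite exprMn exprVn sqr_sqrtr// ltW.
have [z1 z2] := integrable_RintegralZl n%:R^-1 i1.
apply: whp_chebyshev => //.
- apply: measurable_funM => //; apply: measurable_sum => i.
  exact: measurableT_comp mU (measurable_funPT (X i)).
- by under eq_fun do rewrite E.
- by under eq_Rintegral do rewrite E; rewrite z2 i2 mulKf ?gt_eqF.
Qed.

End independence.

(** * The central limit theorem for characteristic functions of scalar sums *)

Section null_sequences.
Context {R : realType}.
Implicit Types f g : nat -> R.

Lemma cvg_near_le f g (l : R) : (\forall n \near \oo, `|f n - l| <= g n) ->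
  g n @[n --> \oo] --> (0 : R) -> f n @[n --> \oo] --> l.
Proof.
move=> fg /cvgrPdist_le g0; apply/cvgrPdist_le => e e0; near=> n.
rewrite distrC; apply: (@le_trans _ _ (g n)); first by near: n.
apply: (@le_trans _ _ `|0 - g n|); first by rewrite sub0r normrN ler_norm.
by near: n; exact: g0.
Unshelve. all: by end_near. Qed.

Lemma cvg_invsqrt : (Num.sqrt n%:R)^-1 @[n --> \oo] --> (0 : R).
Proof.
apply/cvgrPdist_le => e e0; near=> n.
have n0 : 0 < n%:R :> R by rewrite ltr0n; near: n; exact: nbhs_infty_gt.
rewrite sub0r normrN ger0_norm ?invr_ge0 ?sqrtr_ge0//.
rewrite invf_ple ?posrE ?sqrtr_gt0//.
have -> : e^-1 = Num.sqrt (e^-1 ^+ 2) by rewrite sqrtr_sqr ger0_norm// invr_ge0 ltW.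
rewrite ler_sqrt//.
apply: ltW.
near: n; exists (Num.truncn (e^-1 ^+ 2)).+1 => // n /= Hn.
by apply: lt_le_trans (truncnS_gt _) _; rewrite ler_nat.
Unshelve. all: by end_near. Qed.

Lemma natr_invsqrt_sq n : (0 < n)%N -> n%:R * (Num.sqrt n%:R)^-1 ^+ 2 = 1 :> R.
Proof.
move=> n0; have nR : 0 < n%:R :> R by rewrite ltr0n.
by rewrite exprVn sqr_sqrtr ?mulfV ?gt_eqF// ltW.
Qed.

(** From [1 - x <= expR (- x) <= 1 / (1 + x) <= 1 - x + x ^+ 2]. *)
Lemma one_minus_expRN (x : R) : 0 <= x -> `|(1 - expR (- x)) - x| <= x ^+ 2.
Proof.
move=> x0; have h1 := expR_ge1Dx (- x).
have h2 : expR (- x) <= (1 + x)^-1.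
  rewrite expRN lef_pV2 ?posrE ?expR_gt0//; last by lra.
  exact: expR_ge1Dx.
have h3 : (1 + x)^-1 <= 1 - x + x ^+ 2.
  rewrite -[leLHS]mul1r ler_pdivrMr; last by lra.
  have -> : (1 - x + x ^+ 2) * (1 + x) = 1 + x ^+ 3 by ring.
  by rewrite lerDl exprn_ge0.
by rewrite ler_norml; apply/andP; split; lra.
Qed.

End null_sequences.

Section charfun_iid.
Context {d : measure_display} {T : measurableType d} {R : realType}
  (P : probability T R) (X : nat -> {RV P >-> R})
  (indX : mutually_independent P (fun i => X i : T -> R))
  (idX : identically_distributed P (fun i => X i : T -> R))
  (U : R -> R) (mU : measurable_fun setT U).

Let S k w := \sum_(i < k) U (X i w).

Let mUX k : measurable_fun setT (fun w => U (X k w)).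
Proof. exact: measurableT_comp mU (measurable_funPT (X k)). Qed.

Let mcos : measurable_fun setT (@cos R).
Proof. by apply: continuous_measurable_fun; exact: continuous_cos. Qed.

Let msin : measurable_fun setT (@sin R).
Proof. by apply: continuous_measurable_fun; exact: continuous_sin. Qed.

Let mS k : measurable_fun setT (S k).
Proof. by apply: measurable_sum => i; exact: mUX. Qed.

(** Independence of [S k] from events about the variables of index [k] and above. It is stronger
    than the recursion for the characteristic function because the induction step must peel off an
    event about the next variable. *)
Let charfun_split k := forall N B, (forall i, measurable (B i)) ->
  (forall i, (i < k)%N -> B i = setT) -> (k <= N)%N ->
  \int[P]_w (cos (S k w) * indic_prod X B N w) =
    \int[P]_w cos (S k w) * \int[P]_w indic_prod X B N w /\
  \int[P]_w (sin (S k w) * indic_prod X B N w) =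
    \int[P]_w sin (S k w) * \int[P]_w indic_prod X B N w.

Let gam k := \int[P]_w cos (U (X k w)).
Let sig k := \int[P]_w sin (U (X k w)).

(** The induction hypothesis handles indicators of [X k]; [integral_mul_ext] upgrades them to [cos]
    and [sin] of [U (X k)], and the addition formulas reassemble [S k.+1]. *)
Let charfun_step k : charfun_split k -> forall N B, (forall i, measurable (B i)) ->
  (forall i, (i < k.+1)%N -> B i = setT) -> (k < N)%N ->
  \int[P]_w (cos (S k.+1 w) * indic_prod X B N w) =
    (\int[P]_w cos (S k w) * gam k - \int[P]_w sin (S k w) * sig k)
      * \int[P]_w indic_prod X B N w /\
  \int[P]_w (sin (S k.+1 w) * indic_prod X B N w) =
    (\int[P]_w sin (S k w) * gam k + \int[P]_w cos (S k w) * sig k)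
      * \int[P]_w indic_prod X B N w.
Proof.
move=> IH N B mB BT kN.
set W := indic_prod X B N.
have mW : measurable_fun setT W by exact: measurable_indic_prod.
have W1 w : `|W w| <= 1 by exact: indic_prod_le1.
have BT' i : (i < k)%N -> B i = setT by move=> ik; apply: BT; exact: ltnW.
have ext (t : R -> R) : measurable_fun setT t -> (forall x, `|t x| <= 1) ->
    (forall A, measurable A -> \int[P]_w (t (S k w) * W w * \1_A (X k w)) =
        \int[P]_w (t (S k w) * W w) * \int[P]_w \1_A (X k w)) ->
    forall f : R -> R, measurable_fun setT f -> (forall x, `|f x| <= 1) ->
    P.-integrable setT (EFin \o (fun w => t (S k w) * W w * f (U (X k w)))) /\
    \int[P]_w (t (S k w) * W w * f (U (X k w))) =
     \int[P]_w (t (S k w) * W w) * \int[P]_w f (U (X k w)).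
  move=> mt t1 H f mf f1.
  have mV : measurable_fun setT (fun w => t (S k w) * W w).
    by apply: measurable_funM => //; exact: measurableT_comp mt (mS k).
  have V1 w : `|t (S k w) * W w| <= 1 by rewrite normrM mulr_ile1.
  have mfU : measurable_fun setT (fun x => f (U x)) by exact: measurableT_comp mf mU.
  split; last first.
    exact: (integral_mul_ext mV V1 (measurable_funPT (X k)) H mfU (fun x => f1 _)).
  apply: (bounded_integrable P (C := 1)).
    apply: measurable_funM => //; exact: measurableT_comp mf (mUX k).
  by move=> w; rewrite normrM mulr_ile1.
have HA (A : set R) : measurable A ->
   \int[P]_w (cos (S k w) * W w * \1_A (X k w)) =
        \int[P]_w (cos (S k w) * W w) * \int[P]_w \1_A (X k w) /\
   \int[P]_w (sin (S k w) * W w * \1_A (X k w)) =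
        \int[P]_w (sin (S k w) * W w) * \int[P]_w \1_A (X k w).
  move=> mA.
  (* Slot [k] is still free because [B] is the full set below [k.+1]. Putting [A] there leaves the
     slots below [k] untouched, so the induction hypothesis also applies to the refined family. *)
  have [E F] := integral_indic_prod_refine indX mB mA (BT _ (ltnSn k)) kN.
  set BA := (fun i => _) in E F.
  have mBA i : measurable (BA i) by rewrite /BA; case: ifP.
  have BAT i : (i < k)%N -> BA i = setT.
    by move=> ik; rewrite /BA (ltn_eqF ik) BT'.
  have [h1 h2] := IH N BA mBA BAT (ltnW kN).
  have [h3 h4] := IH N B mB BT' (ltnW kN).
  rewrite h3 h4 -!mulrA -F -h1 -h2; split; apply: eq_Rintegral => w _;
    by rewrite E mulrA.
have [hc hs] := IH N B mB BT' (ltnW kN).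
have [cc1 cc2] := ext cos mcos (@cos_max R) (fun A mA => (HA A mA).1) cos mcos (@cos_max R).
have [cs1 cs2] := ext cos mcos (@cos_max R) (fun A mA => (HA A mA).1) sin msin (@sin_max R).
have [sc1 sc2] := ext sin msin (@sin_max R) (fun A mA => (HA A mA).2) cos mcos (@cos_max R).
have [ss1 ss2] := ext sin msin (@sin_max R) (fun A mA => (HA A mA).2) sin msin (@sin_max R).
have SE w : S k.+1 w = S k w + U (X k w) by rewrite /S big_ord_recr.
split.
- rewrite (_ : (fun w => _) = fun w => cos (S k w) * W w * cos (U (X k w)) -
     sin (S k w) * W w * sin (U (X k w))).
    by rewrite (integrable_RintegralB cc1 ss1).2 cc2 ss2 hc hs /gam /sig; ring.
  by apply/funext => w; rewrite SE cosD; ring.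
- rewrite (_ : (fun w => _) = fun w => sin (S k w) * W w * cos (U (X k w)) +
     cos (S k w) * W w * sin (U (X k w))).
    by rewrite (integrable_RintegralD sc1 cs1).2 sc2 cs2 hc hs /gam /sig; ring.
  by apply/funext => w; rewrite SE sinD; ring.
Qed.

Let charfun_rec_aux k : charfun_split k ->
  \int[P]_w cos (S k.+1 w) = \int[P]_w cos (S k w) * gam k - \int[P]_w sin (S k w) * sig k /\
  \int[P]_w sin (S k.+1 w) = \int[P]_w sin (S k w) * gam k + \int[P]_w cos (S k w) * sig k.
Proof.
move=> H.
have [] := @charfun_step k H k.+1 (fun=> setT) (fun=> measurableT) (fun _ _ => erefl) (ltnSn k).
have W1 : indic_prod X (fun=> setT) k.+1 = fun=> 1.
  by apply/funext => w; rewrite /indic_prod big1// => i _; rewrite indicT.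
rewrite W1 Rintegral_cstT !mulr1.
under eq_Rintegral do rewrite mulr1; move=> ->.
by under eq_Rintegral do rewrite mulr1; move=> ->.
Qed.

Let charfun_splitP k : charfun_split k.
Proof.
elim: k => [|k IH] N B mB BT kN.
  have S0 w : S 0 w = 0 by rewrite /S big_ord0.
  split.
    under eq_Rintegral do rewrite S0 cos0 mul1r.
    by under [in RHS]eq_Rintegral do rewrite S0 cos0; rewrite Rintegral_cstT mul1r.
  under eq_Rintegral do rewrite S0 sin0 mul0r.
  by under [X in _ = X * _]eq_Rintegral do rewrite S0 sin0; rewrite !Rintegral_cstT mul0r.
have [-> ->] := charfun_step IH mB BT kN.
by have [-> ->] := charfun_rec_aux IH.
Qed.

Lemma charfun_rec k :
  \int[P]_w cos (\sum_(i < k.+1) U (X i w)) =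
    \int[P]_w cos (\sum_(i < k) U (X i w)) * \int[P]_w cos (U (X 0%N w)) -
    \int[P]_w sin (\sum_(i < k) U (X i w)) * \int[P]_w sin (U (X 0%N w)) /\
  \int[P]_w sin (\sum_(i < k.+1) U (X i w)) =
    \int[P]_w sin (\sum_(i < k) U (X i w)) * \int[P]_w cos (U (X 0%N w)) +
    \int[P]_w cos (\sum_(i < k) U (X i w)) * \int[P]_w sin (U (X 0%N w)).
Proof.
have mcU : measurable_fun setT (fun x => cos (U x)) by exact: measurableT_comp mcos mU.
have msU : measurable_fun setT (fun x => sin (U x)) by exact: measurableT_comp msin mU.
have := @charfun_rec_aux k (@charfun_splitP k); rewrite /gam /sig.
by rewrite (ident_Rintegral idX k mcU) (ident_Rintegral idX k msU).
Qed.

Lemma norm_mean_le1 (f : T -> R) : measurable_fun setT f -> (forall w, `|f w| <= 1) ->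
  `|\int[P]_w f w| <= 1.
Proof.
move=> mf f1; have := @norm_Rintegral_whp _ _ _ P f 1 1 0 mf f1 ler01 ler01.
by rewrite mulr0 addr0; apply; apply: whp_all.
Qed.

(* Powers of a complex number and of [r] are compared without complex numbers:
   means of cosines and sines are at most one in absolute value, so the real
   and imaginary parts can be telescoped separately. *)
Lemma charfun_pow_bound k (r : R) : 0 <= r <= 1 ->
  let g := \int[P]_w cos (U (X 0%N w)) in
  let s := \int[P]_w sin (U (X 0%N w)) in
  `|\int[P]_w cos (\sum_(i < k) U (X i w)) - r ^+ k| <= k%:R * (`|g - r| + `|s|) /\
  `|\int[P]_w sin (\sum_(i < k) U (X i w))| <= k%:R * `|s|.
Proof.
move=> /andP[r0 r1] g s; elim: k => [|k [IH1 IH2]].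
  under eq_Rintegral do rewrite big_ord0 cos0.
  under [in X in _ /\ X]eq_Rintegral do rewrite big_ord0 sin0.
  by rewrite !Rintegral_cstT expr0 subrr normr0 !mul0r.
have [-> ->] := charfun_rec k.
set c := \int[P]_w cos _ in IH1 *; set sk := \int[P]_w sin _ in IH2 *.
have c1 : `|c| <= 1.
  by apply: norm_mean_le1 => [|w]; [exact: measurableT_comp mcos (mS k)|exact: cos_max].
have s1 : `|sk| <= 1.
  by apply: norm_mean_le1 => [|w]; [exact: measurableT_comp msin (mS k)|exact: sin_max].
have g1 : `|g| <= 1.
  by apply: norm_mean_le1 => [|w]; [exact: measurableT_comp mcos (mUX 0)|exact: cos_max].
rewrite -natr1 !mulrDl !mul1r; split.
  have -> : c * g - sk * s - r ^+ k.+1 = r * (c - r ^+ k) + c * (g - r) - sk * s.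
    by rewrite exprS; ring.
  apply: le_trans (ler_normB _ _) _; rewrite [leRHS]addrA; apply: lerD.
    apply: le_trans (ler_normD _ _) _; apply: lerD.
      by apply: le_trans IH1; rewrite normrM ger0_norm// ler_piMl.
    by rewrite normrM ler_piMl.
  by rewrite normrM ler_piMl.
apply: le_trans (ler_normD _ _) _; apply: lerD; last by rewrite normrM ler_piMl.
by apply: le_trans IH2; rewrite normrM ler_piMr.
Qed.

End charfun_iid.

Section central_limit_theorem.
Context {d : measure_display} {T : measurableType d} {R : realType}
  (P : probability T R) (X : nat -> {RV P >-> R})
  (indX : mutually_independent P (fun i => X i : T -> R))
  (idX : identically_distributed P (fun i => X i : T -> R)).

Lemma clt_charfun (U : R -> R) : measurable_fun setT U ->
  P.-integrable setT (EFin \o (fun w => U (X 0%N w) ^+ 2)) ->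
  \int[P]_w U (X 0%N w) = 0 ->
  \int[P]_w cos ((Num.sqrt n%:R)^-1 * \sum_(i < n) U (X i w)) @[n --> \oo] -->
    expR (- (\int[P]_w (U (X 0%N w) ^+ 2)) / 2) /\
  \int[P]_w sin ((Num.sqrt n%:R)^-1 * \sum_(i < n) U (X i w)) @[n --> \oo] --> (0 : R).
Proof.
move=> mU intU2 U0.
set s2 := \int[P]_w (U (X 0%N w) ^+ 2).
pose a := s2 / 2.
have s20 : 0 <= s2 by apply: Rintegral_ge0 => w _; exact: sqr_ge0.
have a0 : 0 <= a by rewrite divr_ge0.
pose y n : R := (Num.sqrt n%:R)^-1.
pose u w := U (X 0%N w).
have mu : measurable_fun setT u by exact: measurableT_comp mU (measurable_funPT (X 0%N)).
have intu : P.-integrable setT (EFin \o u) by exact: integrable_of_sq.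
have mcos : measurable_fun setT (@cos R).
  by apply: continuous_measurable_fun; exact: continuous_cos.
have msin : measurable_fun setT (@sin R).
  by apply: continuous_measurable_fun; exact: continuous_sin.
have myu n : measurable_fun setT (fun w => y n * u w) by exact: measurable_funM.
have mcy n : measurable_fun setT (fun w => cos (y n * u w)) by exact: measurableT_comp mcos (myu n).
have msy n : measurable_fun setT (fun w => sin (y n * u w)) by exact: measurableT_comp msin (myu n).
have icy n : P.-integrable setT (EFin \o (fun w => cos (y n * u w))).
  by apply: (bounded_integrable P (mcy n)) => w; exact: cos_max.
have isy n : P.-integrable setT (EFin \o (fun w => sin (y n * u w))).
  by apply: (bounded_integrable P (msy n)) => w; exact: sin_max.
have nyy n : (0 < n)%N -> n%:R * y n ^+ 2 = 1 by exact: natr_invsqrt_sq.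
have nyle n (z : R) : n%:R * ((y n * z) ^+ 2) <= z ^+ 2.
  case: n => [|n]; first by rewrite mul0r sqr_ge0.
  by rewrite exprMn mulrA nyy// mul1r.
have y0 : y n @[n --> \oo] --> (0 : R) by exact: cvg_invsqrt.
have yz z : y n * z @[n --> \oo] --> (0 : R) by rewrite -(mul0r z); exact: cvgMr_tmp.
have yyz z : y n ^+ 2 * z @[n --> \oo] --> (0 : R).
  rewrite -(mul0r z) -(mul0r 0); apply: cvgMr_tmp.
  under eq_fun do rewrite expr2; exact: (cvgM y0 y0).
(* The scaled integrand tends pointwise to half the square of [u] and is dominated by its square, so
   a finite second moment suffices to expand the real part. *)
have cA : \int[P]_w (n%:R * (1 - cos (y n * u w))) @[n --> \oo] --> a.
  have -> : a = \int[P]_w (2^-1 * u w ^+ 2) by rewrite RintegralZl// mulrC.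
  apply: (Rdominated_convergence (g := fun w => u w ^+ 2)) => //.
  - by move=> n; apply: measurable_funM => //; exact: measurable_funB.
  - by apply: measurable_funM => //; exact: measurable_funX.
  - move=> w; apply: (cvg_near_le _ (yyz (u w ^+ 4 / 8))); near=> n.
    have n0 : (0 < n)%N by near: n; exact: nbhs_infty_gt.
    have -> : n%:R * (1 - cos (y n * u w)) - 2^-1 * u w ^+ 2 =
        n%:R * (1 - cos (y n * u w) - (y n * u w) ^+ 2 / 2).
      rewrite [RHS]mulrBr; congr (_ - _).
      rewrite (_ : n%:R * _ = (n%:R * y n ^+ 2) * (2^-1 * u w ^+ 2)); last by ring.
      by rewrite nyy// mul1r.
    rewrite normrM ger0_norm//; apply: le_trans (ler_wpM2l _ (one_minus_cos_approx _)) _ => //.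
    have -> : n%:R * ((y n * u w) ^+ 4 / 8) =
      (n%:R * y n ^+ 2) * (y n ^+ 2 * (u w ^+ 4 / 8)) by ring.
    by rewrite nyy// mul1r.
  - move=> n w; rewrite normrM ger0_norm// ger0_norm ?one_minus_cos_ge0//.
    apply: le_trans (ler_wpM2l _ (one_minus_cos_le _)) _ => //.
    by have := nyle n (u w); have := sqr_ge0 (u w); lra.
(* As [u] has mean zero, [n] times the mean of [sin (y n * u)] is, up to sign, the mean of this
   second-order remainder, hence negligible. *)
have cB : \int[P]_w (n%:R * (y n * u w - sin (y n * u w))) @[n --> \oo] --> (0 : R).
  rewrite -[X in _ --> X](Rintegral_cstT P 0).
  apply: (Rdominated_convergence (g := fun w => u w ^+ 2)) => //.
  - by move=> n; apply: measurable_funM => //; exact: measurable_funB.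
  - move=> w; apply: (cvg_near_le _ (yz (`|u w| ^+ 3 / 2))); near=> n.
    have n0 : (0 < n)%N by near: n; exact: nbhs_infty_gt.
    rewrite subr0 normrM ger0_norm//; apply: le_trans (ler_wpM2l _ (sub_sin_le3 _)) _ => //.
    have yn0 : 0 <= y n by rewrite invr_ge0 sqrtr_ge0.
    have -> : n%:R * (`|y n * u w| ^+ 3 / 2) =
      (n%:R * y n ^+ 2) * (y n * (`|u w| ^+ 3 / 2)) by rewrite normrM (ger0_norm yn0); ring.
    by rewrite nyy// mul1r.
  - move=> n w; rewrite normrM ger0_norm//.
    apply: le_trans (ler_wpM2l _ (sub_sin_le2 _)) _ => //; exact: nyle.
have EA n : \int[P]_w (n%:R * (1 - cos (y n * u w))) = n%:R * (1 - \int[P]_w cos (y n * u w)).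
  have [i1 i2] := integrable_RintegralB (integrable_cstT P 1) (icy n).
  by rewrite (integrable_RintegralZl n%:R i1).2 i2 Rintegral_cstT.
have EB n : \int[P]_w (n%:R * (y n * u w - sin (y n * u w))) =
    - (n%:R * \int[P]_w sin (y n * u w)).
  have [i1 i2] := integrable_RintegralZl (y n) intu.
  have [i3 i4] := integrable_RintegralB i1 (isy n).
  by rewrite (integrable_RintegralZl n%:R i3).2 i4 i2 U0 mulr0 sub0r mulrN.
have {}cA : n%:R * (1 - \int[P]_w cos (y n * u w)) - a @[n --> \oo] --> (0 : R).
  rewrite -(subrr a); apply: cvgB; last exact: cvg_cst.
  by under eq_fun do rewrite -EA.
have {}cB : `|n%:R * \int[P]_w sin (y n * u w)| @[n --> \oo] --> (0 : R).
  under eq_fun do rewrite -normrN -EB.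
  by rewrite -(normr0 R); apply: cvg_norm.
have pw n : (0 < n)%N ->
    `|\int[P]_w cos (y n * \sum_(i < n) U (X i w)) - expR (- s2 / 2)| <=
      `|n%:R * (1 - \int[P]_w cos (y n * u w)) - a| + y n ^+ 2 * a ^+ 2
      + `|n%:R * \int[P]_w sin (y n * u w)| /\
    `|\int[P]_w sin (y n * \sum_(i < n) U (X i w))| <=
       `|n%:R * \int[P]_w sin (y n * u w)|.
  move=> n0; have nR : 0 < n%:R :> R by rewrite ltr0n.
  (* The exact [n]-th root of the limit, so that [charfun_pow_bound] compares with the limit itself
     and only [n * (g - r)] remains to be estimated. *)
  pose r := expR (- (a / n%:R)).
  have an0 : 0 <= a / n%:R by rewrite divr_ge0.
  have r01 : 0 <= r <= 1 by rewrite expR_ge0/= -[leRHS]expR0 ler_expR oppr_le0.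
  have rn : r ^+ n = expR (- s2 / 2).
    rewrite -expRM_natl; congr expR; rewrite /a; field.
    by rewrite gt_eqF.
  have mUn : measurable_fun setT (fun x => y n * U x) by exact: measurable_funM.
  have := charfun_pow_bound indX idX mUn n r01.
  have E w : \sum_(i < n) y n * U (X i w) = y n * \sum_(i < n) U (X i w) by rewrite mulr_sumr.
  rewrite /= (_ : (fun w => cos (\sum_(i < n) y n * U (X i w))) =
    fun w => cos (y n * \sum_(i < n) U (X i w))); last by apply/funext => w; rewrite E.
  rewrite (_ : (fun w => sin (\sum_(i < n) y n * U (X i w))) =
    fun w => sin (y n * \sum_(i < n) U (X i w))); last by apply/funext => w; rewrite E.
  rewrite rn => -[h1 h2]; split; last first.
    by apply: le_trans h2 _; rewrite normrM (ger0_norm (ltW nR)).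
  apply: le_trans h1 _; rewrite mulrDr normrM (ger0_norm (ltW nR)) lerD2r.
  rewrite -/u -{1}(ger0_norm (ltW nR)) -normrM.
  set g := \int[P]_w cos _.
  have -> : n%:R * (g - r) = n%:R * ((1 - r) - a / n%:R) - (n%:R * (1 - g) - a).
    by field; rewrite gt_eqF.
  apply: le_trans (ler_normB _ _) _; rewrite addrC lerD2l.
  rewrite normrM (ger0_norm (ltW nR)).
  apply: le_trans (ler_wpM2l _ (one_minus_expRN an0)) _ => //.
  have -> : n%:R * (a / n%:R) ^+ 2 = a ^+ 2 * n%:R^-1 by field; rewrite gt_eqF.
  by rewrite /y exprVn sqr_sqrtr ?(ltW nR)// mulrC.
split.
- apply: (@cvg_near_le _ _ (fun n => `|n%:R * (1 - \int[P]_w cos (y n * u w)) - a| +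
    y n ^+ 2 * a ^+ 2 + `|n%:R * \int[P]_w sin (y n * u w)|)).
    by exists 1%N => // n /= n0; exact: (pw n n0).1.
  rewrite -[X in _ --> X](addr0 0) -[X in _ --> X + _](addr0 0).
  apply: cvgD; last exact: cB.
  apply: cvgD; last exact: yyz.
  by rewrite -(normr0 R); apply: cvg_norm.
- apply: (@cvg_near_le _ _ _ 0 _ cB).
  by exists 1%N => // n /= n0; rewrite subr0; exact: (pw n n0).2.
Unshelve. all: by end_near. Qed.

End central_limit_theorem.

(** * Stochastic orders, Ghosh's comparison lemma and normalised iid sums *)

Section stochastic_order.
Context {d : measure_display} {T : measurableType d} {R : realType}
  (P : probability T R).
Implicit Types (Y Z : nat -> T -> R).

Definition oP Y := forall e del : R, 0 < e -> 0 < del ->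
  \forall n \near \oo, whp P del (fun w => `|Y n w| <= e).

Definition OP Y := forall del : R, 0 < del -> exists2 K : R, 0 < K &
  \forall n \near \oo, whp P del (fun w => `|Y n w| <= K).

Lemma oP_le Y Z : (\forall n \near \oo, forall w, `|Y n w| <= `|Z n w|) -> oP Z -> oP Y.
Proof.
move=> YZ hZ e del e0 del0; apply: filterS2 YZ (hZ e del e0 del0) => n YZ.
by apply: whp_mono => // w; exact: le_trans.
Qed.

Lemma eq_oP Y Z : (\forall n \near \oo, forall w, Y n w = Z n w) -> oP Z -> oP Y.
Proof. by move=> YZ; apply: oP_le; apply: filterS YZ => n YZ w; rewrite YZ. Qed.

Lemma oPD Y Z : oP Y -> oP Z -> oP (fun n w => Y n w + Z n w).
Proof.
move=> hY hZ e del e0 del0.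
have e20 : 0 < e / 2 by rewrite divr_gt0.
have d20 : 0 < del / 2 by rewrite divr_gt0.
apply: filterS2 (hY _ _ e20 d20) (hZ _ _ e20 d20) => n h1 h2.
apply: whp_mono (whp_and h1 h2) => [|w [? ?]]; first by lra.
by apply: le_trans (ler_normD _ _) _; lra.
Qed.

Lemma oP_OP Y : oP Y -> OP Y.
Proof. by move=> hY del del0; exists 1 => //; exact: hY. Qed.

Lemma OPD Y Z : OP Y -> OP Z -> OP (fun n w => Y n w + Z n w).
Proof.
move=> hY hZ del del0; have d20 : 0 < del / 2 by rewrite divr_gt0.
have [K K0 hK] := hY _ d20; have [L L0 hL] := hZ _ d20.
exists (K + L); first exact: addr_gt0.
apply: filterS2 hK hL => n h1 h2.
apply: whp_mono (whp_and h1 h2) => [|w [? ?]]; first by lra.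
by apply: le_trans (ler_normD _ _) _; lra.
Qed.

Lemma OPM Y Z : OP Y -> oP Z -> oP (fun n w => Y n w * Z n w).
Proof.
move=> hY hZ e del e0 del0; have d20 : 0 < del / 2 by rewrite divr_gt0.
have [K K0 hK] := hY _ d20; have eK : 0 < e / K by rewrite divr_gt0.
apply: filterS2 hK (hZ _ _ eK d20) => n h1 h2.
apply: whp_mono (whp_and h1 h2) => [|w [h3 h4]]; first by lra.
rewrite normrM (_ : e = K * (e / K)); last by rewrite mulrC divfK// gt_eqF.
exact: ler_pM.
Qed.

Lemma OPMM Y Z : OP Y -> OP Z -> OP (fun n w => Y n w * Z n w).
Proof.
move=> hY hZ del del0; have d20 : 0 < del / 2 by rewrite divr_gt0.
have [K K0 hK] := hY _ d20; have [L L0 hL] := hZ _ d20.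
exists (K * L); first exact: mulr_gt0.
apply: filterS2 hK hL => n h1 h2.
apply: whp_mono (whp_and h1 h2) => [|w [h3 h4]]; first by lra.
by rewrite normrM; exact: ler_pM.
Qed.

Lemma OP_cst (a : R) : OP (fun _ _ => a).
Proof.
move=> del del0; exists (`|a| + 1); first by rewrite ltr_wpDl.
by near=> n; apply: whp_all => [|w]; [exact: ltW|rewrite lerDl].
Unshelve. all: by end_near. Qed.

Lemma oPZ (a : R) Y : oP Y -> oP (fun n w => a * Y n w).
Proof. by move=> hY; exact: OPM (OP_cst a) hY. Qed.

Lemma oPB Y Z : oP Y -> oP Z -> oP (fun n w => Y n w - Z n w).
Proof.
move=> hY hZ; apply: oPD => //; apply: oP_le hZ.
by near=> n => w; rewrite normrN.
Unshelve. all: by end_near. Qed.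

Lemma oP_cvg0 (u : nat -> R) : u n @[n --> \oo] --> (0 : R) -> oP (fun n _ => u n).
Proof.
move=> /cvgrPdist_le u0 e del e0 del0; apply: filterS (u0 e e0) => n.
by rewrite sub0r normrN => h; apply: whp_all => //; exact: ltW.
Qed.

Lemma oP_sum (I : Type) (s : seq I) (Y : I -> nat -> T -> R) : (forall i, oP (Y i)) ->
  oP (fun n w => \sum_(i <- s) Y i n w).
Proof.
move=> hY; elim: s => [|i s IH].
  by apply: eq_oP (oP_cvg0 (cvg_cst 0)); near=> n => w; rewrite big_nil.
by apply: eq_oP (oPD (hY i) IH); near=> n => w; rewrite big_cons.
Unshelve. all: by end_near. Qed.

Lemma OP_sum (I : Type) (s : seq I) (Y : I -> nat -> T -> R) : (forall i, OP (Y i)) ->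
  OP (fun n w => \sum_(i <- s) Y i n w).
Proof.
move=> hY; elim: s => [|i s IH].
  by under eq_fun do under eq_fun do rewrite big_nil; exact: OP_cst.
by under eq_fun do under eq_fun do rewrite big_cons; exact: OPD.
Qed.

(* Ghosh's lemma: it is enough to compare [V] and [W] on a finite grid. *)
Lemma ghosh (V W : nat -> T -> R) : OP W ->
  (forall t : R, exists2 E, oP E & \forall n \near \oo, forall w,
     (V n w <= t) = (W n w <= t + E n w)) ->
  oP (fun n w => V n w - W n w).
Proof.
move=> OW HE e del e0 del0.
(* With [W] in a cell [[t j, t j.+1[] and [V] in []t (j - 2), t (j + 2)]], the two differ by at most
   three mesh widths. *)
pose eps := e / 3; have eps0 : 0 < eps by rewrite divr_gt0.
have d20 : 0 < del / 2 by rewrite divr_gt0.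
have [K K0 HK] := OW _ d20.
have HE2 (t : R) : exists E, oP E /\
    \forall n \near \oo, forall w, (V n w <= t) = (W n w <= t + E n w).
  by have [E ? ?] := HE t; exists E.
have [E' HE'] := choice HE2.
(* The grid covers [[-K, K]] with two spare points on each side: one unit makes the truncation
   exceed [K / eps], the other two are the margin. *)
pose M := (Num.truncn (K / eps)).+3.
pose t (j : nat) : R := (j%:R - M%:R) * eps.
have [q1 q2] : oP (fun n w => \sum_(j < M.*2) `|E' (t j) n w|) /\
    \forall n \near \oo, forall j : 'I_(M.*2), forall w,
      (V n w <= t j) = (W n w <= t j + E' (t j) n w).
  split.
    apply: oP_sum => j; apply: oP_le (HE' (t j)).1.
    by near=> n => w; rewrite normr_id.
  apply: filter_forall => j; exact: (HE' (t j)).2.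
have q1' := q1 _ _ eps0 d20.
near=> n.
have h1 : whp P (del / 2) (fun w => `|W n w| <= K) by near: n.
have h2 : whp P (del / 2) (fun w => `|\sum_(j < M.*2) `|E' (t j) n w| | <= eps) by near: n.
have h3 : forall j : 'I_(M.*2), forall w, (V n w <= t j) = (W n w <= t j + E' (t j) n w).
  by near: n.
apply: whp_mono (whp_and h1 h2) => [|w [WK Es]]; first by lra.
have Ej (j : 'I_(M.*2)) : `|E' (t j) n w| <= eps.
  apply: le_trans Es; rewrite [leRHS]ger0_norm ?sumr_ge0// (bigD1 j)//= lerDl.
  exact: sumr_ge0.
have [j [j1 j2 j3]] : exists j : nat, [/\ (1 < j)%N, (j.+2 < M.*2)%N & t j <= W n w < t j.+1].
  pose z := W n w / eps + M%:R.
  have /andP[z2 zM] : 2 < z < M%:R + M%:R - 2.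
    have KM : K / eps < (Num.truncn (K / eps)).+1%:R by exact: truncnS_gt.
    have MM : M%:R = (Num.truncn (K / eps)).+1%:R + 2 :> R by rewrite /M -!natr1; ring.
    move: WK; rewrite ler_norml => /andP[w1 w2].
    have a1 : - (K / eps) <= W n w / eps by rewrite -mulNr ler_pM2r ?invr_gt0.
    have a2 : W n w / eps <= K / eps by rewrite ler_pM2r ?invr_gt0.
    by rewrite /z; apply/andP; split; lra.
  have z0 : 0 <= z by lra.
  have /andP[j1 j2] := truncn_itv z0; set j := Num.truncn z in j1 j2.
  exists j; split.
  - by rewrite -ltnS -(ltr_nat R); apply: lt_trans z2 j2.
  - have h : j%:R + 2 < M%:R + M%:R :> R by lra.
    by rewrite -addnn -addn2 -(ltr_nat R) !natrD.
  - have Wz : W n w = (z - M%:R) * eps by rewrite /z addrK divfK// gt_eqF.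
    by rewrite /t Wz ler_pM2r// ltr_pM2r// lerD2r ltrD2r j1 j2.
have Wt (i : nat) : (t i.+1 = t i + eps) by rewrite /t -natr1; ring.
have iM (i : nat) : (i <= j.+2)%N -> (i < M.*2)%N by move=> h; apply: leq_ltn_trans h _.
move: j3 => /andP[j3 j4].
have up : V n w <= t j.+2.
  have := h3 (Ordinal (iM j.+2 (leqnn _))) w; rewrite /= => ->.
  have := Ej (Ordinal (iM j.+2 (leqnn _))); rewrite ler_norml => /andP[/= ? _].
  by have := Wt j.+1; lra.
(* Two steps down instead of one: the strict inequality has to survive an error that may equal a
   whole mesh width. *)
have lo : t j.-2 < V n w.
  have jj : (j.-2 <= j.+2)%N by lia.
  rewrite ltNge; have := h3 (Ordinal (iM j.-2 jj)) w; rewrite /= => ->.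
  have := Ej (Ordinal (iM j.-2 jj)); rewrite ler_norml => /andP[/= _ ?].
  rewrite -ltNge; have := Wt j.-2; have := Wt j.-2.+1.
  have -> : j.-2.+2 = j by lia.
  by lra.
have := Wt j; have := Wt j.+1; have := Wt j.-2; have := Wt j.-2.+1.
have -> : j.-2.+2 = j by lia.
have : e = 3 * eps by rewrite /eps; field.
move=> -> ? ? ? ?; rewrite ler_norml; apply/andP; split; lra.
Unshelve. all: by end_near. Qed.

End stochastic_order.

Section iid_stochastic_order.
Context {d : measure_display} {T : measurableType d} {R : realType}
  (P : probability T R) (X : nat -> {RV P >-> R})
  (indX : mutually_independent P (fun i => X i : T -> R))
  (idX : identically_distributed P (fun i => X i : T -> R)).

Lemma OP_iid (U : R -> R) : measurable_fun setT U ->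
  P.-integrable setT (EFin \o (fun w => U (X 0%N w) ^+ 2)) ->
  \int[P]_w U (X 0%N w) = 0 ->
  OP P (fun n w => (Num.sqrt n%:R)^-1 * \sum_(i < n) U (X i w)).
Proof.
move=> mU intU U0 del del0; set v := \int[P]_w (U (X 0%N w) ^+ 2).
have v0 : 0 <= v by apply: Rintegral_ge0 => w _; exact: sqr_ge0.
(* Since [K >= 1], one has [K ^+ 2 >= K >= v / del], so Chebyshev's bound [v / K ^+ 2] is at most
   [del]. *)
pose K := v / del + 1.
have vd0 : 0 <= v / del by rewrite divr_ge0// ltW.
have K1 : 1 <= K by rewrite lerDr.
have K0 : 0 < K by lra.
exists K => //; exists 1%N => // n /= n0.
apply: whp_mono (iid_sum_whp indX idX mU intU U0 (lexx v) n0 K0) => //.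
rewrite ler_pdivrMr ?exprn_gt0// mulrC -ler_pdivrMr//.
apply: (@le_trans _ _ K); first by rewrite lerDl.
by rewrite expr2 ler_pMr.
Qed.

(** The summand may change with [n]. It is used for increments of the empirical distribution
    function over shrinking intervals. *)
Lemma oP_iid_array (U : nat -> R -> R) (v : nat -> R) :
  (forall n, measurable_fun setT (U n)) ->
  (forall n, P.-integrable setT (EFin \o (fun w => U n (X 0%N w) ^+ 2))) ->
  (forall n, \int[P]_w U n (X 0%N w) = 0) ->
  (forall n, \int[P]_w (U n (X 0%N w) ^+ 2) <= v n) ->
  v n @[n --> \oo] --> (0 : R) ->
  oP P (fun n w => (Num.sqrt n%:R)^-1 * \sum_(i < n) U n (X i w)).
Proof.
move=> mU intU U0 Uv /cvgrPdist_le v0 e del e0 del0.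
have ed : 0 < del * e ^+ 2 by rewrite mulr_gt0 ?exprn_gt0.
near=> n.
have n0 : (0 < n)%N by near: n; exact: nbhs_infty_gt.
apply: whp_mono (iid_sum_whp indX idX (mU n) (intU n) (U0 n) (Uv n) n0 e0) => //.
rewrite ler_pdivrMr ?exprn_gt0//.
apply: (@le_trans _ _ `|0 - v n|); first by rewrite sub0r normrN ler_norm.
by near: n; exact: v0.
Unshelve. all: by end_near. Qed.

(** The deviation is the normalised centred sum, bounded in probability, divided by another
    [sqrt n]. *)
Lemma lln (U : R -> R) : measurable_fun setT U ->
  P.-integrable setT (EFin \o (fun w => U (X 0%N w) ^+ 2)) ->
  oP P (fun n w => n%:R^-1 * \sum_(i < n) U (X i w) - \int[P]_w U (X 0%N w)).
Proof.
move=> mU intU; set m := \int[P]_w U (X 0%N w).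
have mUX : measurable_fun setT (fun w => U (X 0%N w)).
  exact: measurableT_comp mU (measurable_funPT (X 0%N)).
have intU1 := integrable_of_sq mUX intU.
pose U' x := U x - m.
have mU' : measurable_fun setT U' by exact: measurable_funB.
have U'0 : \int[P]_w U' (X 0%N w) = 0.
  by rewrite (integrable_RintegralB intU1 (integrable_cstT P m)).2 Rintegral_cstT subrr.
have intU' : P.-integrable setT (EFin \o (fun w => U' (X 0%N w) ^+ 2)).
  rewrite (_ : (fun w => _) = fun w => U (X 0%N w) ^+ 2 - ((2 * m) * U (X 0%N w) - m ^+ 2)).
    apply: (integrable_RintegralB _ _).1 => //; apply: (integrable_RintegralB _ (integrable_cstT _ _)).1.
    exact: (integrable_RintegralZl _ intU1).1.
  by apply/funext => w; rewrite /U'; ring.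
have H := OPM (OP_iid mU' intU' U'0) (oP_cvg0 P (@cvg_invsqrt R)).
apply: eq_oP H; exists 1%N => // n /= n0 w.
have nR : 0 < n%:R :> R by rewrite ltr0n.
have sn : 0 < Num.sqrt n%:R :> R by rewrite sqrtr_gt0.
rewrite /U' sumrB sumr_const card_ord -[m *+ n]mulr_natl.
have -> : n%:R^-1 = (Num.sqrt n%:R)^-1 ^+ 2 :> R by rewrite exprVn sqr_sqrtr// ltW.
have E : m = (Num.sqrt n%:R)^-1 ^+ 2 * (n%:R * m).
  by rewrite mulrA [_ * n%:R]mulrC natr_invsqrt_sq// mul1r.
by rewrite {1}E; ring.
Qed.

End iid_stochastic_order.

(** * Order statistics, quantiles and the weak Bahadur representation *)

Section differentials.
Context {R : realType}.

Lemma diff_expansion (V W : normedModType R) (f : V -> W) (x : V) (e : R) :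
  differentiable f x -> 0 < e -> exists2 del : R, 0 < del &
    forall v, `|v| <= del -> `|f (x + v) - f x - 'd f x v| <= e * `|v|.
Proof.
move=> df e0; have /eqaddoP/(_ e e0) := diff_locally df.
move=> /nbhs_ballP[del /= del0 H]; exists (del / 2); first by rewrite divr_gt0.
move=> v vd; have /H : ball 0 del v.
  by rewrite -ball_normE /= sub0r normrN; lra.
rewrite /=; set A := (X in `|X| <= _); set B := (X in _ -> `|X| <= _).
suff -> : A = B by [].
by rewrite /A /B !fctE /= [x + v]addrC opprD addrA.
Qed.

Lemma derivable_expansion (F : R -> R) (q e : R) : derivable F q 1 -> 0 < e ->
  exists2 del : R, 0 < del &
    forall v, `|v| <= del -> `|F (q + v) - F q - derive1 F q * v| <= e * `|v|.
Proof.
move=> dF e0; have df : differentiable F q by exact/derivable1_diffP.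
have [del del0 H] := diff_expansion df e0; exists del => // v /H.
suff -> : 'd F q v = derive1 F q * v by [].
by rewrite diff1E// mulrC.
Qed.

End differentials.

Section order_statistics.
Context {d : measure_display} {T : measurableType d} {R : realType}.
Implicit Types (X : nat -> T -> R).

Lemma count_leE X n (x : R) w :
  count (fun z => z <= x) [seq X i w | i <- iota 0 n] = (\sum_(i < n) (X i w <= x)%R)%N.
Proof.
rewrite count_map -sum1_count big_mkcond/=.
rewrite (_ : iota 0 n = index_iota 0 n) ?big_mkord; last by rewrite /index_iota subn0.
by apply: eq_bigr => i _ /=; case: (_ <= _).
Qed.

Lemma order_stat_le X n k (x : R) w : (0 < k <= n)%N ->
  (order_stat X n k w <= x) = (k <= \sum_(i < n) (X i w <= x)%R)%N.
Proof.
move=> /andP[k0 kn]; rewrite /order_stat -count_leE.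
set s := [seq _ | _ <- _].
have ss : sorted <=%R (sort <=%R s) by apply: sort_sorted; exact: le_total.
have sz : size (sort <=%R s) = n by rewrite size_sort size_map size_iota.
rewrite -(count_sort <=%R); apply/idP/idP => [|h].
  apply: contraTT; rewrite -ltnNge -ltNge => h.
  apply: nth_count_gt => //.
  by rewrite sz prednK// kn andbT -ltnS prednK.
by apply: nth_count_le => //; rewrite prednK.
Qed.

Lemma indic_leE (x z : R) : \1_(`]-oo, x]%classic) z = (z <= x)%R%:R :> R.
Proof.
by rewrite indicE; congr (nat_of_bool _)%:R; apply/idP/idP; rewrite inE/= in_itv.
Qed.

Lemma measurable_order_stat X n k : (forall i, measurable_fun setT (X i)) ->
  (0 < k <= n)%N -> measurable_fun setT (order_stat X n k).
Proof.
move=> mX kn; apply: (measurability _ (RGenOInfty.measurableE R)) => _ [_ [x ->] <-].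
pose c w : R := \sum_(i < n) \1_(`]-oo, x]%classic) (X i w).
have mc : measurable_fun setT c.
  apply: measurable_sum => i.
  by apply: measurableT_comp (mX i); exact: measurable_indic.
rewrite (_ : _ `&` _ = setT `&` c @^-1` `]-oo, k%:R[%classic); first exact: mc.
apply/seteqP; split => w /= [_]; rewrite !in_itv/= ?andbT => h; split => //; move: h;
  rewrite /c; under eq_bigr do rewrite indic_leE.
  by rewrite -natr_sum ltr_nat ltNge order_stat_le// -ltnNge.
by rewrite -natr_sum ltr_nat ltNge order_stat_le// -ltnNge.
Qed.

(** The condition [0 < p < 1] keeps the rank between [1] and [n], so the default value of [nth] in
    [order_stat] is never returned for nonempty samples. *)
Lemma ceil_index n (p : R) : (0 < n)%N -> 0 < p < 1 ->
  let k := `|Num.ceil (n%:R * p)|%N in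
  [/\ (0 < k <= n)%N, n%:R * p <= k%:R & k%:R <= n%:R * p + 1 :> R].
Proof.
move=> n0 /andP[p0 p1] k; have nR : 0 < n%:R :> R by rewrite ltr0n.
have np0 : 0 < n%:R * p by rewrite mulr_gt0.
have /andP[c1 c2] := ceil_itv (n%:R * p).
have c0 : 0 < Num.ceil (n%:R * p) by rewrite -(ltr0z R); exact: lt_le_trans np0 c2.
have kE : k%:R = (Num.ceil (n%:R * p))%:~R :> R.
  by rewrite /k natr_absz gtr0_norm.
have k2 : k%:R < n%:R * p + 1 by move: c1; rewrite rmorphB/= -kE; lra.
split; rewrite ?kE//; last by rewrite -kE ltW.
rewrite absz_gt0 gt_eqF//= -ltnS -(ltr_nat R) -natr1.
by apply: lt_trans k2 _; rewrite ltrD2r gtr_pMr.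
Qed.

Lemma measurable_sample_quantile X n (p : R) : (forall i, measurable_fun setT (X i)) ->
  0 < p < 1 -> measurable_fun setT (sample_quantile X n p).
Proof.
move=> mX p01; have [->|n0] := posnP n.
  (* The empty sample yields the default value [0] of [nth]. *)
  rewrite (_ : sample_quantile X 0 p = cst 0); first exact: measurable_cst.
  by apply/funext => w; rewrite /sample_quantile /order_stat/= nth_nil.
by have [kn _ _] := ceil_index n0 p01; exact: measurable_order_stat.
Qed.

End order_statistics.

Section cdf_facts.
Context {d : measure_display} {T : measurableType d} {R : realType}
  (P : probability T R) (X : {RV P >-> R}).

Lemma cdfR_integral x : cdfR X x = \int[P]_w \1_(`]-oo, x]%classic) (X w).
Proof.
rewrite /cdfR /cdf /Rintegral; congr fine.
rewrite (_ : distribution P X `]-oo, x] = P (X @^-1` `]-oo, x] `&` setT)); last by rewrite setIT.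
by rewrite -integral_indic//; exact: measurable_funPTI.
Qed.

Lemma cdfR_nondecreasing x y : x <= y -> cdfR X x <= cdfR X y.
Proof. by move=> xy; rewrite fine_le ?fin_num_measure// cdf_nondecreasing. Qed.

(** The limits of the distribution function at both infinities make the infimum a genuine one. Too
    large a value at [q] would put points left of [q] into the set; too small a value would exclude
    the points just right of [q]. *)
Lemma cdfR_quantile (p : R) : 0 < p < 1 -> {for quantile X p, continuous (cdfR X)} ->
  cdfR X (quantile X p) = p.
Proof.
move=> /andP[p0 p1] cF; set q := quantile X p in cF *.
pose S := [set x | p <= cdfR X x].
have hS : has_inf S.
  split.
    have /fine_cvg/cvgr_dist_lt/(_ (1 - p)) := cvg_cdfy1 X.
    rewrite subr_gt0 => /(_ p1) [M [_ /(_ (M + 1))]]; rewrite ltrDl ltr01 => /(_ isT) /= h.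
    exists (M + 1); rewrite /S /= /cdfR.
    by move: h; rewrite ltr_norml => /andP[? ?]; lra.
  have /fine_cvg/cvgr_dist_lt/(_ p p0) := cvg_cdfNy0 X.
  move=> [M [_ /(_ (M - 1))]]; rewrite gtrBl ltr01 => /(_ isT) /= h.
  exists (M - 1) => x Sx; rewrite leNgt; apply/negP => /ltW/cdfR_nondecreasing.
  move: h; rewrite sub0r normrN ltr_norml => /andP[_ h] h2.
  by have := lt_le_trans (le_lt_trans h2 h) Sx; rewrite ltxx.
have near_q (e : R) : 0 < e -> exists2 del : R, 0 < del &
    forall x, `|q - x| < del -> `|cdfR X q - cdfR X x| < e.
  move=> e0; have /cvgr_dist_lt/(_ e e0)/nbhs_ballP[del /= del0 H] := cF.
  by exists del => // x xd; apply: H; rewrite -ball_normE.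
apply/eqP; rewrite eq_le; apply/andP; split; rewrite leNgt; apply/negP => h.
- have [|del del0 H] := near_q (cdfR X q - p); first by rewrite subr_gt0.
  have : S (q - del / 2).
    have /H : `|q - (q - del / 2)| < del.
      by rewrite opprB addrC subrK gtr0_norm ?divr_gt0//; lra.
    by rewrite ltr_norml /S /= => /andP[_ ?]; lra.
  move=> /(ge_inf hS.2); rewrite -/q; lra.
- have [|del del0 H] := near_q (p - cdfR X q); first by rewrite subr_gt0.
  have [x Sx xq] := inf_adherent del0 hS.
  have qx : q <= x by exact: ge_inf hS.2 _ Sx.
  have /H : `|q - x| < del by rewrite distrC ger0_norm ?subr_ge0//; move: xq; rewrite -/q; lra.
  by rewrite ltr_norml => /andP[? _]; move: Sx; rewrite /S/=; lra.
Qed.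

End cdf_facts.

Section bahadur.
Context {d : measure_display} {T : measurableType d} {R : realType}
  (P : probability T R) (X : nat -> {RV P >-> R})
  (indX : mutually_independent P (fun i => X i : T -> R))
  (idX : identically_distributed P (fun i => X i : T -> R)).

Lemma integrable_indic_le i x : P.-integrable setT (EFin \o (fun w => \1_(`]-oo, x]%classic) (X i w))).
Proof.
apply: (bounded_integrable P (C := 1)).
  by apply: measurableT_comp (measurable_funPT (X i)); exact: measurable_indic.
by move=> w; rewrite indicE; case: (_ \in _); rewrite ?normr1 ?normr0.
Qed.

(** The uncentred increment is, up to a sign, the indicator of the interval between [x] and [q], so
    its second moment is [|F x - F q|], and centring only decreases it. *)
Lemma indic_increment_moment (x q : R) :
  let F := cdfR (X 0%N) in
  let U z := (\1_(`]-oo, x]%classic) z - F x) - (\1_(`]-oo, q]%classic) z - F q) in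
  [/\ measurable_fun setT U, P.-integrable setT (EFin \o (fun w => U (X 0%N w) ^+ 2)),
      \int[P]_w U (X 0%N w) = 0 & \int[P]_w (U (X 0%N w) ^+ 2) <= `|F x - F q|].
Proof.
move=> F U.
have mi y : measurable_fun setT (\1_(`]-oo, y]%classic) : R -> R) by exact: measurable_indic.
have mU : measurable_fun setT U.
  by apply: measurable_funB; apply: measurable_funB.
pose B w := \1_(`]-oo, x]%classic) (X 0%N w) - \1_(`]-oo, q]%classic) (X 0%N w) : R.
pose b := F x - F q.
have UB w : U (X 0%N w) = B w - b by rewrite /U /B /b; ring.
have [iB eB] := integrable_RintegralB (integrable_indic_le 0 x) (integrable_indic_le 0 q).
rewrite -!cdfR_integral -/F -/b in eB.
(* [s] is the sign of the increment; it treats [x <= q] and [q < x] at once. *)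
have [s sB sb] : exists2 s : R, forall w, B w ^+ 2 = s * B w & s * b = `|b|.
  have [xq|qx] := leP x q.
    exists (-1).
      move=> w; rewrite /B !indic_leE; case: (leP (X 0%N w) x) => h1;
        case: (leP (X 0%N w) q) => h2;
        by rewrite /= ?expr2; lra.
    by rewrite mulN1r ler0_norm// /b subr_le0; exact: cdfR_nondecreasing.
  exists 1.
    move=> w; rewrite /B !indic_leE; case: (leP (X 0%N w) x) => h1;
        case: (leP (X 0%N w) q) => h2;
      by rewrite /= ?expr2; lra.
  by rewrite mul1r ger0_norm// /b subr_ge0; apply: cdfR_nondecreasing; exact: ltW.
have E2 w : U (X 0%N w) ^+ 2 = (s - 2 * b) * B w + b ^+ 2.
  have -> : (s - 2 * b) * B w = s * B w - 2 * b * B w by ring.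
  by rewrite -sB UB; ring.
have [z1 z2] := integrable_RintegralZl (s - 2 * b) iB.
have [z3 z4] := integrable_RintegralD z1 (integrable_cstT P (b ^+ 2)).
split => //.
- by under eq_fun do rewrite E2.
- under eq_Rintegral do rewrite UB.
  by rewrite (integrable_RintegralB iB (integrable_cstT P b)).2 Rintegral_cstT eB subrr.
- under eq_Rintegral do rewrite E2.
  rewrite z4 z2 eB Rintegral_cstT mulrBl sb -/b.
  by have := sqr_ge0 b; rewrite expr2; lra.
Qed.

Lemma bahadur (p : R) : 0 < p < 1 ->
  derivable (cdfR (X 0%N)) (quantile (X 0%N) p) 1 ->
  0 < dens (X 0%N) (quantile (X 0%N) p) ->
  let q := quantile (X 0%N) p in let f := dens (X 0%N) q in
  oP P (fun n w => Num.sqrt n%:R * (sample_quantile (fun k => X k : T -> R) n p w - q)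
     - (Num.sqrt n%:R)^-1 * \sum_(i < n) (p - \1_(`]-oo, q]%classic) (X i w)) / f).
Proof.
move=> p01 dF f0 q f; set F := cdfR (X 0%N) in dF.
have cF : {for q, continuous F} by apply: differentiable_continuous; exact/derivable1_diffP.
have Fq : F q = p by exact: cdfR_quantile.
pose y n : R := (Num.sqrt n%:R)^-1.
have y0 : y n @[n --> \oo] --> (0 : R) by exact: cvg_invsqrt.
have mi z : measurable_fun setT (\1_(`]-oo, z]%classic) : R -> R) by exact: measurable_indic.
apply: ghosh.
  have mU : measurable_fun setT (fun z => (p - \1_(`]-oo, q]%classic) z) / f : R).
    by apply: measurable_funM => //; exact: measurable_funB.
  apply: (OP_iid indX idX mU).
    have [iU _ _ _] := indic_increment_moment q q.
    apply: (bounded_integrable P (C := (2 / f) ^+ 2)).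
      by apply: measurable_funX; exact: measurableT_comp mU (measurable_funPT (X 0%N)).
    move=> w; rewrite normrX; apply: lerXn2r; rewrite ?nnegrE//.
      by rewrite divr_ge0// ltW.
    rewrite normrM (gtr0_norm (_ : 0 < f^-1)) ?invr_gt0// ler_pM2r ?invr_gt0//.
    move: p01 => /andP[? ?]; rewrite indic_leE ler_norml.
    by case: (_ <= q); rewrite /=; apply/andP; split; lra.
  have [i1 i2] := integrable_RintegralB (integrable_cstT P p) (integrable_indic_le 0 q).
  by rewrite RintegralZr// i2 Rintegral_cstT -cdfR_integral -/F Fq subrr mul0r.
move=> t; pose x n := q + t * y n.
have x0 : x n @[n --> \oo] --> q.
  rewrite -[X in _ --> X]addr0; apply: cvgD; first exact: cvg_cst.
  by rewrite -(mulr0 t); exact: cvgMl_tmp.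
pose U n z := (\1_(`]-oo, x n]%classic) z - F (x n)) - (\1_(`]-oo, q]%classic) z - F q) : R.
pose k n := `|Num.ceil (n%:R * p)|%N.
(* Chosen so that [t + E - W] equals [y n / f] times the number of observations up to [x n] minus
   the rank [k n]. The first summand is deterministic (derivative and rounding of the rank); the
   second is the oscillation of the empirical process between [q] and [x n]. *)
exists (fun n w => (y n * (n%:R * F (x n) - (k n)%:R) / f - t) +
   f^-1 * (y n * \sum_(i < n) U n (X i w))).
  apply: oPD.
    apply: oP_cvg0; apply/cvgrPdist_le => e e0.
    (* The derivative error then uses at most half of [e * f]; rounding the rank, an error of at
       most one scaled by [y n], uses the other half. *)
    pose e1 := e * f / (2 * (`|t| + 1)).
    have t1 : 0 < `|t| + 1 by rewrite ltr_wpDl.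
    have e10 : 0 < e1 by rewrite divr_gt0 ?mulr_gt0.
    have [del del0 H] := derivable_expansion dF e10.
    have ty0 : t * y n @[n --> \oo] --> (0 : R) by rewrite -(mulr0 t); exact: cvgMl_tmp.
    have ef0 : 0 < e * f / 2 by rewrite divr_gt0 ?mulr_gt0.
    near=> n.
    have n0 : (0 < n)%N by near: n; exact: nbhs_infty_gt.
    have nR : 0 < n%:R :> R by rewrite ltr0n.
    have yn0 : 0 < y n by rewrite invr_gt0 sqrtr_gt0.
    have ny : n%:R * y n ^+ 2 = 1 by exact: natr_invsqrt_sq.
    have h1 : `|t * y n| <= del.
      by rewrite -normrN -sub0r; near: n; exact: (cvgr_dist_le _ _ ty0 _ del0).
    have h2 : y n <= e * f / 2.
      apply: le_trans (ler_norm _) _.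
      by rewrite -normrN -sub0r; near: n; exact: (cvgr_dist_le _ _ y0 _ ef0).
    have [_ k1 k2] := ceil_index n0 p01.
    have {}H := H _ h1; rewrite -/(x n) Fq -/(dens _ _) -/f in H.
    rewrite sub0r normrN.
    have -> : y n * (n%:R * F (x n) - (k n)%:R) / f - t =
      (n%:R * y n * (F (x n) - p - f * (t * y n)) + y n * (n%:R * p - (k n)%:R)) / f
       + t * (n%:R * y n ^+ 2 - 1) by field; rewrite gt_eqF.
    rewrite ny subrr mulr0 addr0 normrM (gtr0_norm (_ : 0 < f^-1)) ?invr_gt0//.
    rewrite ler_pdivrMr//; apply: le_trans (ler_normD _ _) _.
    have -> : e * f = e * f / 2 + e * f / 2 by field.
    apply: lerD.
      rewrite normrM gtr0_norm ?mulr_gt0//.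
      apply: (@le_trans _ _ (n%:R * y n * (e1 * `|t * y n|))).
        by apply: ler_wpM2l => //; rewrite mulr_ge0// ltW.
      rewrite normrM (gtr0_norm yn0).
      have -> : n%:R * y n * (e1 * (`|t| * y n)) = (n%:R * y n ^+ 2) * (e1 * `|t|) by ring.
      rewrite ny mul1r /e1 mulrAC ler_pdivrMr ?mulr_gt0//.
      have -> : e * f / 2 * (2 * (`|t| + 1)) = e * f * (`|t| + 1) by field.
      by rewrite ler_pM2l ?mulr_gt0// lerDl.
    rewrite normrM gtr0_norm//; apply: le_trans h2; apply: ler_piMr; first exact: ltW.
    by rewrite ler_norml /k; apply/andP; split; lra.
  apply: oPZ; apply: (oP_iid_array indX idX (v := fun n => `|F (x n) - F q|)) => [n|n|n|n|].
  - by case: (indic_increment_moment (x n) q).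
  - by case: (indic_increment_moment (x n) q).
  - by case: (indic_increment_moment (x n) q).
  - by case: (indic_increment_moment (x n) q).
  - rewrite -(normr0 R) -(subrr (F q)); apply: cvg_norm; apply: cvgB; last exact: cvg_cst.
    exact: (cvg_comp _ _ x0 cF).
exists 1%N => // n /= n0 w.
have nR : 0 < n%:R :> R by rewrite ltr0n.
have sn0 : 0 < Num.sqrt n%:R :> R by rewrite sqrtr_gt0.
have yn0 : 0 < y n by rewrite invr_gt0.
have [kn _ _] := ceil_index n0 p01.
have -> : (Num.sqrt n%:R * (sample_quantile (fun k => X k : T -> R) n p w - q) <= t) =
    (sample_quantile (fun k => X k : T -> R) n p w <= x n).
  by rewrite mulrC -ler_pdivlMr// lerBlDl.
rewrite /sample_quantile order_stat_le// -(ler_nat R) natr_sum.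
pose G := \sum_(i < n) \1_(`]-oo, x n]%classic) (X i w) : R.
pose H := \sum_(i < n) \1_(`]-oo, q]%classic) (X i w) : R.
have -> : \sum_(i < n) (X i w <= x n)%R%:R = G :> R.
  by apply: eq_bigr => i _; rewrite indic_leE.
rewrite -/(k n) -[RHS]subr_ge0.
rewrite [X in 0 <= X](_ : _ = y n / f * (G - (k n)%:R)).
  by rewrite pmulr_rge0 ?divr_gt0// subr_ge0.
have -> : \sum_(i < n) (p - \1_(`]-oo, q]%classic) (X i w)) / f = (n%:R * p - H) / f.
  by rewrite -mulr_suml sumrB sumr_const card_ord -[p *+ n]mulr_natl.
have -> : \sum_(i < n) U n (X i w) = G - n%:R * F (x n) - (H - n%:R * p).
  rewrite /U !sumrB !sumr_const card_ord -/G -/H Fq.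
  by rewrite -[F (x n) *+ n]mulr_natl -[p *+ n]mulr_natl.
rewrite -/(y n); field.
by rewrite gt_eqF.
Unshelve. all: by end_near. Qed.

End bahadur.

(** * Linearisation of the sample mean absolute deviation and of the sample variance *)

Section moment_linearization.
Context {d : measure_display} {T : measurableType d} {R : realType}
  (P : probability T R) (X : nat -> {RV P >-> R})
  (indX : mutually_independent P (fun i => X i : T -> R))
  (idX : identically_distributed P (fun i => X i : T -> R))
  (intX : P.-integrable setT (EFin \o (X 0%N : T -> R)))
  (intX2 : P.-integrable setT (EFin \o (fun w => X 0%N w ^+ 2))).

Lemma meanRE (f : T -> R) : meanR P f = \int[P]_w f w.
Proof. by rewrite /meanR unlock. Qed.

Let mu := meanR P (X 0%N).
Let A n w := (Num.sqrt n%:R)^-1 * \sum_(i < n) (X i w - mu).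
Let del n w := sample_mean (fun k => X k : T -> R) n w - mu.

Lemma integrable_centered_sq : P.-integrable setT (EFin \o (fun w => (X 0%N w - mu) ^+ 2)).
Proof.
rewrite (_ : (fun w => _) = fun w => X 0%N w ^+ 2 - ((2 * mu) * X 0%N w - mu ^+ 2)).
  apply: (integrable_RintegralB _ _).1 => //; apply: (integrable_RintegralB _ (integrable_cstT _ _)).1.
  exact: (integrable_RintegralZl _ intX).1.
by apply/funext => w; ring.
Qed.

Let mcent : measurable_fun setT (fun z : R => z - mu).
Proof. exact: measurable_funB. Qed.

Let OPA : OP P A.
Proof.
apply: (OP_iid indX idX mcent integrable_centered_sq).
by rewrite (integrable_RintegralB intX (integrable_cstT P mu)).2 Rintegral_cstT -meanRE subrr.
Qed.

Let delE n w : (0 < n)%N -> del n w = (Num.sqrt n%:R)^-1 * A n w.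
Proof.
move=> n0; have nR : 0 < n%:R :> R by rewrite ltr0n.
rewrite /del /A mulrA -expr2 exprVn sqr_sqrtr ?(ltW nR)// /sample_mean.
rewrite sumrB sumr_const card_ord mulrBr; congr (_ - _).
by rewrite -[mu *+ n]mulr_natl mulKf// gt_eqF.
Qed.

Let oPdel : oP P del.
Proof.
apply: eq_oP (OPM OPA (oP_cvg0 P (@cvg_invsqrt R))).
by exists 1%N => // n /= n0 w; rewrite delE// mulrC.
Qed.

(** Bounds the share of observations for which replacing the centre [mu] by the sample mean can
    cross the kink of the absolute value. Continuity at [mu] makes a small window light, and the law
    of large numbers counts it. *)
Let oP_near_center : {for mu, continuous (cdfR (X 0%N))} ->
  oP P (fun n w => n%:R^-1 * \sum_(i < n) (`|X i w - mu| <= `|del n w|)%R%:R).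
Proof.
move=> cF e ep e0 ep0; set F := cdfR (X 0%N) in cF.
have e40 : 0 < e / 4 by rewrite divr_gt0.
have /cvgr_dist_lt/(_ _ e40)/nbhs_ballP[del0 /= del00 HF] := cF.
pose eta := del0 / 3.
have eta0 : 0 < eta by rewrite divr_gt0.
(* The window is half-open, so it reaches down to [mu - 2 * eta] in order to contain all points at
   distance at most [eta]. With [eta = del0 / 3] both ends stay within the continuity radius. *)
pose J z : R := \1_(`]-oo, mu + eta]%classic) z - \1_(`]-oo, mu - 2 * eta]%classic) z.
have mi y : measurable_fun setT (\1_(`]-oo, y]%classic) : R -> R) by exact: measurable_indic.
have mJ : measurable_fun setT J by exact: measurable_funB.
have J2 : P.-integrable setT (EFin \o (fun w => J (X 0%N w) ^+ 2)).
  apply: (bounded_integrable P (C := 2 ^+ 2)).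
    by apply: measurable_funX; exact: measurableT_comp mJ (measurable_funPT (X 0%N)).
  move=> w; rewrite normrX; apply: lerXn2r; rewrite ?nnegrE// /J !indic_leE ler_norml.
  by case: (X 0%N w <= mu + eta); case: (X 0%N w <= mu - 2 * eta);
    rewrite /=; apply/andP; split; lra.
have EJ : \int[P]_w J (X 0%N w) <= e / 2.
  rewrite (integrable_RintegralB (integrable_indic_le X 0 _) (integrable_indic_le X 0 _)).2.
  rewrite -!cdfR_integral -/F.
  have h1 : `|F mu - F (mu + eta)| < e / 4.
    apply: HF; rewrite -ball_normE /= opprD addrA subrr sub0r normrN gtr0_norm//.
    by rewrite /eta; lra.
  have h2 : `|F mu - F (mu - 2 * eta)| < e / 4.
    apply: HF; rewrite -ball_normE /= opprB addrC subrK gtr0_norm ?mulr_gt0//.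
    by rewrite /eta; lra.
  move: h1; rewrite ltr_norml => /andP[? ?].
  by move: h2; rewrite ltr_norml => /andP[? ?]; lra.
have e20 : 0 < e / 2 by rewrite divr_gt0.
have ep20 : 0 < ep / 2 by rewrite divr_gt0.
have L := lln indX idX mJ J2 e20 ep20.
have D := oPdel eta0 ep20.
apply: filterS2 L D => n h1 h2.
apply: whp_mono (whp_and h1 h2) => [|w [h3 h4]]; first by lra.
rewrite ger0_norm ?mulr_ge0 ?invr_ge0 ?sumr_ge0//.
apply: (@le_trans _ _ (n%:R^-1 * \sum_(i < n) J (X i w))).
  rewrite ler_wpM2l ?invr_ge0//; apply: ler_sum => i _; rewrite /J !indic_leE.
  have [k1|k1] := leP `|X i w - mu| `|del n w|; last first.
    by case: (leP (X i w) (mu + eta)) => ?; case: (leP (X i w) (mu - 2 * eta)) => ?;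
      rewrite /=; lra.
  have := le_trans k1 h4; rewrite ler_norml => /andP[k2 k3].
  by case: (leP (X i w) (mu + eta)) => ?; case: (leP (X i w) (mu - 2 * eta)) => ?;
    rewrite /=; lra.
by move: h3; rewrite ler_norml => /andP[_ ?]; lra.
Qed.

(** The sign with value [-1] at zero, which makes its mean an exact expression in the distribution
    function even in the presence of atoms. *)
Let pos_sign (z : R) : R := 1 - 2 * (z <= 0)%R%:R.

(** The absolute value is affine on each side of zero, so the first-order expansion is exact unless
    the shift [v] reaches across the kink. *)
Let rho_bound (z v : R) :
  `| `|z - v| - `|z| + v * pos_sign z| <= 2 * `|v| * (`|z| <= `|v|)%R%:R.
Proof.
rewrite /pos_sign; have [z0|z0] := leP z 0.
- rewrite (ler0_norm z0) mulr1; have [vz|vz] := leP v z.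
    have v0 : v <= 0 by lra.
    rewrite (ler0_norm v0) lerN2 vz mulr1 (ger0_norm (_ : 0 <= z - v)) ?subr_ge0//.
    by rewrite ger0_norm; lra.
  rewrite (ltr0_norm (_ : z - v < 0)) ?subr_lt0//.
  rewrite (_ : - (z - v) - - z + v * (1 - 2) = 0) ?normr0; last by ring.
  by rewrite !mulr_ge0.
- rewrite (gtr0_norm z0) mulr0 subr0 mulr1; have [zv|vz] := leP z v.
    have v0 : 0 <= v by lra.
    rewrite (ger0_norm v0) zv mulr1 (ler0_norm (_ : z - v <= 0)) ?subr_le0//.
    by rewrite ger0_norm; lra.
  rewrite (gtr0_norm (_ : 0 < z - v)) ?subr_gt0//.
  rewrite (_ : z - v - z + v = 0) ?normr0; last by ring.
  by rewrite !mulr_ge0.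
Qed.

Let pos_sign_mean : \int[P]_w pos_sign (X 0%N w - mu) = 1 - 2 * cdfR (X 0%N) mu.
Proof.
have [i1 i2] := integrable_RintegralZl 2 (integrable_indic_le X 0 mu).
rewrite (_ : (fun w => _) = fun w => 1 - 2 * \1_(`]-oo, mu]%classic) (X 0%N w)).
  by rewrite (integrable_RintegralB (integrable_cstT P 1) i1).2 i2 Rintegral_cstT -cdfR_integral.
by apply/funext => w; rewrite /pos_sign indic_leE subr_le0.
Qed.

Let sqrt_inv n : (0 < n)%N -> Num.sqrt n%:R = (Num.sqrt n%:R)^-1 * n%:R :> R.
Proof.
move=> n0; have nR : 0 < n%:R :> R by rewrite ltr0n.
have sn : 0 < Num.sqrt n%:R :> R by rewrite sqrtr_gt0.
by rewrite -{3}(sqr_sqrtr (ltW nR)) expr2 mulKf// gt_eqF.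
Qed.

(** Expanding the squares around [mu], the error is exactly [- A n ^+ 2 / sqrt n]. *)
Lemma sample_variance_linearization (m2 : R) :
  oP P (fun n w => Num.sqrt n%:R * (sample_cmoment (fun k => X k : T -> R) n 2 w - m2)
   - (Num.sqrt n%:R)^-1 * \sum_(i < n) (`|X i w - mu| ^+ 2 - m2)).
Proof.
apply: (@oP_le _ _ _ P _ (fun n w => A n w * A n w * (Num.sqrt n%:R)^-1)); last first.
  exact: OPM (OPMM OPA OPA) (oP_cvg0 P (@cvg_invsqrt R)).
exists 1%N => // n /= n0 w.
have nR : 0 < n%:R :> R by rewrite ltr0n.
have sn : 0 < Num.sqrt n%:R :> R by rewrite sqrtr_gt0.
set S2 := \sum_(i < n) (`|X i w - mu| ^+ 2).
have S1 : \sum_(i < n) (X i w - mu) = n%:R * del n w.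
  rewrite delE// /A [RHS](_ : _ = (n%:R * (Num.sqrt n%:R)^-1 ^+ 2) * \sum_(i < n) (X i w - mu)).
    by rewrite natr_invsqrt_sq// mul1r.
  by ring.
have E : \sum_(i < n) `|X i w - sample_mean (fun k => X k : T -> R) n w| ^+ 2 =
    S2 - n%:R * del n w ^+ 2.
  under eq_bigr => i _.
    rewrite real_normK ?num_real//.
    rewrite (_ : _ ^+ 2 = `|X i w - mu| ^+ 2 - (2 * del n w) * (X i w - mu) + del n w ^+ 2).
      over.
    by rewrite real_normK ?num_real// /del; ring.
  rewrite big_split/= sumrB -mulr_sumr S1 sumr_const card_ord -/S2 -[_ *+ n]mulr_natl.
  by ring.
rewrite /sample_cmoment E sumrB sumr_const card_ord -/S2 -[m2 *+ n]mulr_natl.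
rewrite {1}sqrt_inv//.
rewrite [X in `|X|](_ : _ = - ((Num.sqrt n%:R)^-1 * n%:R * del n w ^+ 2)).
  rewrite normrN delE// exprMn mulrA.
  rewrite [X in `|X|](_ : _ = (n%:R * (Num.sqrt n%:R)^-1 ^+ 2) * (A n w * A n w * (Num.sqrt n%:R)^-1)).
    by rewrite natr_invsqrt_sq// mul1r.
  by ring.
by field; rewrite !lt0r_neq0.
Qed.

(** Summing the expansion of [rho_bound] leaves [- del n] times the sum of signs. The mean of the
    signs is [- c], so estimating [mu] adds the term [c * X i]. What remains is [rho], controlled by
    the observations near [mu], and [A n] times a law-of-large-numbers error. *)
Lemma sample_mad_linearization (m1 : R) : {for mu, continuous (cdfR (X 0%N))} ->
  let c := 2 * cdfR (X 0%N) mu - 1 in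
  oP P (fun n w => Num.sqrt n%:R * (sample_cmoment (fun k => X k : T -> R) n 1 w - m1)
   - (Num.sqrt n%:R)^-1 * \sum_(i < n) ((`|X i w - mu| ^+ 1 + c * X i w) - (m1 + c * mu))).
Proof.
move=> cF c.
have mps : measurable_fun setT (fun z : R => pos_sign (z - mu)).
  rewrite (_ : (fun z : R => _) = fun z : R => 1 - 2 * \1_(`]-oo, mu]%classic) z).
    by apply: measurable_funB => //; apply: measurable_funM => //; exact: measurable_indic.
  by apply/funext => z; rewrite /pos_sign indic_leE subr_le0.
have ips : P.-integrable setT (EFin \o (fun w => pos_sign (X 0%N w - mu) ^+ 2)).
  rewrite (_ : (fun w => _) = fun=> 1); first exact: integrable_cstT.
  by apply/funext => w; rewrite /pos_sign; case: (_ <= 0); rewrite /=; ring.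
have L := lln indX idX mps ips; rewrite pos_sign_mean in L.
pose rho n w := \sum_(i < n) (`|X i w - mu - del n w| - `|X i w - mu|
   + del n w * pos_sign (X i w - mu)).
apply: (@eq_oP _ _ _ P _ (fun n w => (Num.sqrt n%:R)^-1 * rho n w -
    A n w * (n%:R^-1 * \sum_(i < n) pos_sign (X i w - mu) - (1 - 2 * cdfR (X 0%N) mu)))).
  exists 1%N => // n /= n0 w.
  have nR : 0 < n%:R :> R by rewrite ltr0n.
  have S1 : \sum_(i < n) X i w = n%:R * (del n w + mu).
    by rewrite /del subrK /sample_mean mulVKf// gt_eqF.
  have S2 : \sum_(i < n) `|X i w - sample_mean (fun k => X k : T -> R) n w| ^+ 1 =
     \sum_(i < n) `|X i w - mu - del n w|.
    by apply: eq_bigr => i _; rewrite expr1 /del; congr `|_|; ring.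
  have S3 : \sum_(i < n) `|X i w - mu| ^+ 1 = \sum_(i < n) `|X i w - mu|.
    by apply: eq_bigr => i _; rewrite expr1.
  have hr : rho n w = \sum_(i < n) `|X i w - mu - del n w| - \sum_(i < n) `|X i w - mu|
      + del n w * \sum_(i < n) pos_sign (X i w - mu).
    by rewrite /rho big_split/= sumrB -mulr_sumr.
  have hs : \sum_(i < n) (`|X i w - mu| ^+ 1 + c * X i w - (m1 + c * mu)) =
      \sum_(i < n) `|X i w - mu| + c * (n%:R * (del n w + mu)) - n%:R * (m1 + c * mu).
    rewrite sumrB big_split/= -mulr_sumr sumr_const card_ord S1 S3.
    by rewrite -[(m1 + c * mu) *+ n]mulr_natl.
  rewrite {1}sqrt_inv// /sample_cmoment S2 hr hs /c.
  set a := \sum_(i < n) _; set b := \sum_(i < n) _; set s := \sum_(i < n) pos_sign _.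
  have yA : (Num.sqrt n%:R)^-1 * del n w = A n w * n%:R^-1.
    by rewrite delE// mulrA -expr2 exprVn sqr_sqrtr ?(ltW nR)// mulrC.
  have yA' : A n w = (Num.sqrt n%:R)^-1 * (n%:R * del n w).
    by rewrite mulrCA yA mulrCA mulfV ?mulr1// gt_eqF.
  by rewrite yA'; field; rewrite !lt0r_neq0// sqrtr_gt0.
apply: oPB; last exact: OPM OPA L.
apply: (@oP_le _ _ _ P _ (fun n w => 2 * A n w *
   (n%:R^-1 * \sum_(i < n) (`|X i w - mu| <= `|del n w|)%R%:R))); last first.
  by apply: OPM (oP_near_center cF); exact: OPMM (OP_cst P 2) OPA.
exists 1%N => // n /= n0 w.
have nR : 0 < n%:R :> R by rewrite ltr0n.
have y0 : 0 < (Num.sqrt n%:R)^-1 :> R by rewrite invr_gt0 sqrtr_gt0.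
pose S : R := \sum_(i < n) (`|X i w - mu| <= `|del n w|)%R%:R.
have S0 : 0 <= S by apply: sumr_ge0.
have -> : `|2 * A n w * (n%:R^-1 * S)| =
   (Num.sqrt n%:R)^-1 * \sum_(i < n) 2 * `|del n w| * (`|X i w - mu| <= `|del n w|)%R%:R.
  have H (a : R) : `|2 * a * (n%:R^-1 * S)| = 2 * `|a| * (n%:R^-1 * S).
    rewrite !normrM (ger0_norm S0) (ger0_norm (ler0n _ 2)).
    by rewrite (ger0_norm (_ : 0 <= n%:R^-1)) ?invr_ge0.
  have dA : `|del n w| = (Num.sqrt n%:R)^-1 * `|A n w| by rewrite delE// normrM gtr0_norm.
  have yy : n%:R^-1 = (Num.sqrt n%:R)^-1 ^+ 2 :> R by rewrite exprVn sqr_sqrtr// ltW.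
  by rewrite H -mulr_sumr -/S; clearbody S; rewrite dA yy; ring.
rewrite normrM gtr0_norm// ler_pM2l//; apply: le_trans (ler_norm_sum _ _ _) _.
by apply: ler_sum => i _; exact: rho_bound.
Qed.

End moment_linearization.

(** * Influence functions: second moments, covariance and linearisation of all coordinates *)

Section influence_functions.
Context {d : measure_display} {T : measurableType d} {R : realType}
  (P : probability T R) (X : nat -> {RV P >-> R})
  (indX : mutually_independent P (fun i => X i : T -> R))
  (idX : identically_distributed P (fun i => X i : T -> R))
  (intX : P.-integrable setT (EFin \o (X 0%N : T -> R)))
  (intX2 : P.-integrable setT (EFin \o (fun w => X 0%N w ^+ 2)))
  (m : nat) (p : 'I_m -> R) (r : nat).
Context (p01 : forall i, 0 < p i < 1)
  (pinc : forall i j : 'I_m, (i < j)%N -> p i < p j)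
  (r12 : r = 1%N \/ r = 2%N)
  (dF : forall i, derivable (cdfR (X 0%N)) (quantile (X 0%N) (p i)) 1)
  (f0 : forall i, 0 < dens (X 0%N) (quantile (X 0%N) (p i)))
  (intX2r : P.-integrable setT (EFin \o (fun w => X 0%N w ^+ (2 * r))))
  (dmu : r = 1%N -> derivable (cdfR (X 0%N)) (meanR P (X 0%N)) 1).

Let mu := meanR P (X 0%N).
Let F := cdfR (X 0%N).
Let q i := quantile (X 0%N) (p i).
Let f i := dens (X 0%N) (q i).
Let c := (2 - r%:R) * (2 * F mu - 1).

(** The term [c * z] is the first-order effect of replacing [mu] by the sample mean. It vanishes for
    [r = 2], where [2 - r] is zero. *)
Definition moment_influence (z : R) : R := `|z - mu| ^+ r + c * z.
Local Notation Y := moment_influence.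

Definition influence (z : R) : 'rV[R]_(m + 1) :=
  row_mx (\row_i ((p i - \1_(`]-oo, q i]%classic) z) / f i))
         (\row_(_ < 1) (Y z - \int[P]_w Y (X 0%N w))).

Let Fq i : F (q i) = p i.
Proof.
by apply: cdfR_quantile => //; apply: differentiable_continuous; exact/derivable1_diffP.
Qed.

Let mX i : measurable_fun setT (X i) := measurable_funPT (X i).

Let mabs : measurable_fun setT (fun z : R => `|z - mu| ^+ r).
Proof.
apply: measurable_funX; apply: (measurableT_comp (@normr_measurable R setT)).
exact: measurable_funB.
Qed.

Let mY : measurable_fun setT Y.
Proof. by apply: measurable_funD => //; exact: measurable_funM. Qed.

Let intabs2 : P.-integrable setT (EFin \o (fun w => (`|X 0%N w - mu| ^+ r) ^+ 2)).
Proof.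
case: r12 => E.
  rewrite (_ : (fun w => _) = fun w => (X 0%N w - mu) ^+ 2).
    exact: integrable_centered_sq.
  by apply/funext => w; rewrite E expr1 real_normK ?num_real.
have h4 : P.-integrable setT (EFin \o (fun w => X 0%N w ^+ 4)).
  by move: intX2r; rewrite E.
(* The constant [8] comes from applying [(a + b) ^+ 2 <= 2 * a ^+ 2 + 2 * b ^+ 2] twice. *)
apply: (le_integrable_norm (g := fun w => 8 * X 0%N w ^+ 4 + 8 * mu ^+ 4)).
- apply: measurable_funX; exact: (measurableT_comp mabs (mX 0)).
- move=> w; rewrite E real_normK ?num_real// ger0_norm ?sqr_ge0//.
  have e2 : (X 0%N w - mu) ^+ 2 <= 2 * X 0%N w ^+ 2 + 2 * mu ^+ 2.
    by have := sqr_ge0 (X 0%N w + mu); rewrite !expr2; lra.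
  apply: (@le_trans _ _ ((2 * X 0%N w ^+ 2 + 2 * mu ^+ 2) ^+ 2)).
    apply: lerXn2r => //; rewrite nnegrE ?sqr_ge0//.
    by apply: addr_ge0; apply: mulr_ge0 => //; exact: sqr_ge0.
  have := sqr_ge0 (X 0%N w ^+ 2 - mu ^+ 2).
  have -> : X 0%N w ^+ 4 = (X 0%N w ^+ 2) ^+ 2 by ring.
  have -> : mu ^+ 4 = (mu ^+ 2) ^+ 2 by ring.
  by rewrite !expr2; lra.
- apply: (integrable_RintegralD _ (integrable_cstT _ _)).1; exact: (integrable_RintegralZl 8 h4).1.
Qed.

Let mYX : measurable_fun setT (fun w => Y (X 0%N w)).
Proof. exact: (measurableT_comp mY (mX 0)). Qed.

Let intabs : P.-integrable setT (EFin \o (fun w => `|X 0%N w - mu| ^+ r)).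
Proof. by apply: integrable_of_sq => //; exact: (measurableT_comp mabs (mX 0)). Qed.

Let intcX : P.-integrable setT (EFin \o (fun w => c * X 0%N w)).
Proof. exact: (integrable_RintegralZl c intX).1. Qed.

Let intY : P.-integrable setT (EFin \o (fun w => Y (X 0%N w))).
Proof. exact: (integrable_RintegralD intabs intcX).1. Qed.

Let intYc2 : P.-integrable setT (EFin \o (fun w => (Y (X 0%N w) - \int[P]_w Y (X 0%N w)) ^+ 2)).
Proof.
set e := \int[P]_w _.
apply: (le_integrable_norm (g := fun w => 3 * (`|X 0%N w - mu| ^+ r) ^+ 2 +
   ((3 * c ^+ 2) * X 0%N w ^+ 2 + 3 * e ^+ 2))).
- by apply: measurable_funX; exact: measurable_funB.
- move=> w; rewrite ger0_norm ?sqr_ge0// /Y; set a := `|_| ^+ r; set x := X 0%N w.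
  have := sqr_ge0 (a - c * x); have := sqr_ge0 (a + e); have := sqr_ge0 (c * x + e).
  have -> : 3 * c ^+ 2 * x ^+ 2 = 3 * (c * x) ^+ 2 by ring.
  by rewrite !expr2; lra.
- apply: (integrable_RintegralD _ _).1; first exact: (integrable_RintegralZl 3 intabs2).1.
  apply: (integrable_RintegralD _ (integrable_cstT _ _)).1; exact: (integrable_RintegralZl _ intX2).1.
Qed.

Let EY : \int[P]_w Y (X 0%N w) = cmoment P (X 0%N) r + c * mu.
Proof.
rewrite (integrable_RintegralD intabs intcX).2 (integrable_RintegralZl c intX).2 /cmoment meanRE.
by rewrite -/mu /mu !meanRE.
Qed.

Let I i w : R := \1_(`]-oo, q i]%classic) (X 0%N w).

Let intI i : P.-integrable setT (EFin \o I i).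
Proof. exact: integrable_indic_le. Qed.

Let EI i : \int[P]_w I i w = p i.
Proof. by rewrite -cdfR_integral; exact: Fq. Qed.

Let coordL z i : influence z ord0 (lshift 1 i) = (p i - \1_(`]-oo, q i]%classic) z) / f i.
Proof. by rewrite /influence row_mxEl mxE. Qed.

Let coordR z : influence z ord0 (rshift m ord0) = Y z - \int[P]_w Y (X 0%N w).
Proof. by rewrite /influence row_mxEr mxE. Qed.

Lemma measurable_influence j : measurable_fun setT (fun z => influence z ord0 j).
Proof.
case: (split_ordP j) => i ->.
  under eq_fun do rewrite coordL.
  apply: measurable_funM => //; apply: measurable_funB => //; exact: measurable_indic.
by rewrite (ord1 i); under eq_fun do rewrite coordR; exact: measurable_funB.
Qed.

Let indic01 i w : 0 <= I i w <= 1.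
Proof. by rewrite /I indicE; case: (_ \in _); rewrite /= ?lexx ler01. Qed.

Lemma integrable_influence_sq j :
  P.-integrable setT (EFin \o (fun w => influence (X 0%N w) ord0 j ^+ 2)).
Proof.
case: (split_ordP j) => i ->; last first.
  by rewrite (ord1 i); under eq_fun do rewrite coordR; exact: intYc2.
under eq_fun do rewrite coordL.
apply: (bounded_integrable P (C := (1 / f i) ^+ 2)).
  apply: measurable_funX; apply: measurable_funM => //; apply: measurable_funB => //.
  exact: integrable_measurable (intI i).
move=> w; rewrite normrX; apply: lerXn2r; rewrite ?nnegrE//.
  by rewrite divr_ge0// ltW// f0.
rewrite normrM (gtr0_norm (_ : 0 < (f i)^-1)) ?invr_gt0 ?f0// ler_pM2r ?invr_gt0 ?f0//.
have /andP[? ?] := p01 i; have /andP[? ?] := indic01 i w; rewrite ler_norml.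
by rewrite -/(I i w); apply/andP; split; lra.
Qed.

Lemma influence_mean0 j : \int[P]_w influence (X 0%N w) ord0 j = 0.
Proof.
case: (split_ordP j) => i ->.
  under eq_Rintegral do rewrite coordL.
  have [i1 i2] := integrable_RintegralB (integrable_cstT P (p i)) (intI i).
  by rewrite RintegralZr// i2 Rintegral_cstT EI subrr mul0r.
rewrite (ord1 i); under eq_Rintegral do rewrite coordR.
by rewrite (integrable_RintegralB intY (integrable_cstT _ _)).2 Rintegral_cstT subrr.
Qed.

Let min_indic i j : q i <= q j -> forall w, I i w * I j w = I i w.
Proof.
move=> qij w; rewrite /I !indic_leE.
by case: (leP (X 0%N w) (q i)) => [h|_]; rewrite ?mul0r// (le_trans h qij) mulr1.
Qed.

Let cov_quantile i j : q i <= q j ->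
  \int[P]_w ((p i - I i w) / f i * ((p j - I j w) / f j)) = p i * (1 - p j) / (f i * f j).
Proof.
move=> qij.
have fi := lt0r_neq0 (f0 i); have fj := lt0r_neq0 (f0 j).
rewrite (_ : (fun w => _) = fun w => (f i * f j)^-1 * (p i * p j + ((1 - p j) * I i w - p i * I j w))).
  have [a1 a2] := integrable_RintegralZl (1 - p j) (intI i); have [b1 b2] := integrable_RintegralZl (p i) (intI j).
  have [c1 c2] := integrable_RintegralB a1 b1.
  have [d1 d2] := integrable_RintegralD (integrable_cstT P (p i * p j)) c1.
  rewrite (integrable_RintegralZl _ d1).2 d2 c2 a2 b2 !EI Rintegral_cstT mulrC; congr (_ * _).
  by ring.
apply/funext => w.
have -> : (p i - I i w) / f i * ((p j - I j w) / f j) =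
  (f i * f j)^-1 * (p i * p j + (I i w * I j w - p j * I i w - p i * I j w)).
  by field; exact/andP.
by rewrite (min_indic qij); ring.
Qed.

Let q_mono (i j : 'I_m) : (i <= j)%N -> q i <= q j.
Proof.
rewrite leq_eqVlt => /predU1P[/val_inj -> //|ij].
rewrite leNgt; apply/negP => /ltW/(cdfR_nondecreasing (X 0%N)).
by rewrite [cdfR _ _]Fq [X in _ <= X]Fq leNgt pinc.
Qed.

Let prob_above i : fine (P [set w | q i < X 0%N w]) = 1 - p i.
Proof.
have -> : [set w | q i < X 0%N w] = ~` (X 0%N @^-1` `]-oo, q i]).
  by apply/seteqP; split => w /=; rewrite in_itv/=; [rewrite ltNge => /negP|move=> /negP; rewrite -ltNge].
rewrite probability_setC; last exact: measurable_funPTI.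
rewrite fineB ?fin_num_measure//; last exact: measurable_funPTI.
by rewrite -(Fq i).
Qed.

(** As [P (X > q i)] is [1 - p i], the conditioning denominator cancels the factor in [tau]. What is
    left is the covariance of [p i - I i] with [h ^+ k], the form produced by the influence
    functions. *)
Let tauE (h : T -> R) k i : P.-integrable setT (EFin \o (fun w => h w ^+ k)) ->
  tau (X 0%N) h k (p i) = p i * \int[P]_w (h w ^+ k) - \int[P]_w (I i w * h w ^+ k).
Proof.
move=> inth; rewrite /tau /cond_exp_above -/(q i) prob_above !meanRE.
have mh := integrable_measurable inth.
have intIh : P.-integrable setT (EFin \o (fun w => I i w * h w ^+ k)).
  apply: (le_integrable_norm (g := fun w => `|h w ^+ k|)).
  - by apply: measurable_funM => //; exact: integrable_measurable (intI i).
  - move=> w; have /andP[? ?] := indic01 i w.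
    by rewrite normrM ger0_norm// ler_piMl.
  - exact: (integrable_norm inth).
rewrite (_ : (fun w => h w ^+ k * _) = fun w => h w ^+ k - I i w * h w ^+ k).
  rewrite (integrable_RintegralB inth intIh).2; have /andP[? ?] := p01 i.
  by field; rewrite gt_eqF// subr_gt0.
apply/funext => w; rewrite /I indic_leE leNgt; case: (q i < _) => /=; ring.
Qed.

(** [p i - I i] has mean zero, so centring the moment coordinate contributes nothing, and the two
    summands of [moment_influence] give the two [tau] terms. *)
Let cov_moment i :
  \int[P]_w ((p i - I i w) / f i * (Y (X 0%N w) - \int[P]_w Y (X 0%N w))) =
  (tau (X 0%N) (fun w => `|X 0%N w - mu|) r (p i) + c * tau (X 0%N) (X 0%N) 1 (p i)) / f i.
Proof.
have intX1 : P.-integrable setT (EFin \o (fun w => X 0%N w ^+ 1)) by exact: intX.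
rewrite !tauE//; set e := \int[P]_w Y (X 0%N w).
have fi := lt0r_neq0 (f0 i).
have intIg (g : T -> R) : P.-integrable setT (EFin \o g) ->
    P.-integrable setT (EFin \o (fun w => I i w * g w)).
  move=> intg; apply: (le_integrable_norm (g := fun w => `|g w|)).
  - apply: measurable_funM; first exact: integrable_measurable (intI i).
    exact: integrable_measurable intg.
  - by move=> w; have /andP[? ?] := indic01 i w; rewrite normrM ger0_norm// ler_piMl.
  - exact: (integrable_norm intg).
have [a1 a2] := integrable_RintegralZl c (intIg _ intX1).
have [b1 b2] := integrable_RintegralD (intIg _ intabs) a1.
have [c1 c2] := integrable_RintegralZl (p i) intY.
have [d1 d2] := integrable_RintegralB c1 b1.
have [g1 g2] := integrable_RintegralZl e (intI i).
have [h1 h2] := integrable_RintegralB g1 (integrable_cstT P (p i * e)).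
have [k1 k2] := integrable_RintegralD d1 h1.
rewrite (_ : (fun w => _) = fun w => (f i)^-1 * ((p i * Y (X 0%N w) -
   (I i w * `|X 0%N w - mu| ^+ r + c * (I i w * X 0%N w ^+ 1))) + (e * I i w - p i * e))).
  rewrite (integrable_RintegralZl _ k1).2 k2 d2 h2 c2 b2 a2 g2 EI Rintegral_cstT mulrC.
  rewrite (integrable_RintegralD intabs intcX).2 (integrable_RintegralZl c intX).2.
  by congr (_ / _); rewrite (_ : (fun w => X 0%N w ^+ 1) = X 0%N)//; ring.
by apply/funext => w; rewrite /Y; field.
Qed.

Lemma influence_covariance j l :
  \int[P]_w (influence (X 0%N w) ord0 j * influence (X 0%N w) ord0 l) =
  Sigma_mr (X 0%N) p r j l.
Proof.
case: (split_ordP j) => i ->; case: (split_ordP l) => k ->; rewrite /Sigma_mr.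
- rewrite block_mxEul mxE; under eq_Rintegral do rewrite !coordL.
  case: (leqP i k) => [ik|ki]; first by rewrite cov_quantile ?q_mono.
  under eq_Rintegral do rewrite mulrC.
  by rewrite cov_quantile ?q_mono 1?ltnW// [f i * _]mulrC.
- rewrite block_mxEur mxE (ord1 k); under eq_Rintegral do rewrite coordL coordR.
  exact: cov_moment.
- rewrite block_mxEdl !mxE (ord1 i); under eq_Rintegral do rewrite coordL coordR mulrC.
  exact: cov_moment.
- rewrite block_mxEdr mxE (ord1 i) (ord1 k); under eq_Rintegral do rewrite coordR.
  rewrite /variance unlock unlock /Rintegral; congr fine.
Qed.

Lemma influence_linearization j :
  oP P (fun n w => Num.sqrt n%:R * (zhat_vec X p r n w ord0 j - z0_vec (X 0%N) p r ord0 j)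
    - (Num.sqrt n%:R)^-1 * \sum_(i < n) influence (X i w) ord0 j).
Proof.
rewrite /zhat_vec /z0_vec; case: (split_ordP j) => i ->.
  have B := bahadur indX idX (p01 i) (@dF i) (f0 i); cbv zeta in B.
  apply: (eq_oP _ B); exists 1%N => // n _ w.
  rewrite !row_mxEl !mxE; congr (_ - _ * _); apply: eq_bigr => k _.
  by rewrite coordL.
have E n w : row_mx (\row_i0 sample_quantile (fun k => X k : T -> R) n (p i0) w)
     (\row_(_ < 1) sample_cmoment (fun k => X k : T -> R) n r w) ord0 (rshift m i) =
     sample_cmoment (fun k => X k : T -> R) n r w by rewrite row_mxEr mxE.
have E0 : row_mx (\row_i0 quantile (X 0%N) (p i0)) (\row_(_ < 1) cmoment P (X 0%N) r)
   ord0 (rshift m i) = cmoment P (X 0%N) r by rewrite row_mxEr mxE.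
rewrite E0 (ord1 i).
case: r12 => rE.
  have cF : {for mu, continuous (cdfR (X 0%N))}.
    by apply: differentiable_continuous; apply/derivable1_diffP; exact: dmu.
  have B := sample_mad_linearization indX idX intX intX2 (cmoment P (X 0%N) r) cF.
  cbv zeta in B; apply: (eq_oP _ B).
  exists 1%N => // n _ w; rewrite -(ord1 i) E rE; congr (_ - _ * _).
  apply: eq_bigr => k _; rewrite (ord1 i) coordR EY /Y /c -/mu rE.
  by rewrite (_ : (2 - 1%:R) = 1 :> R) ?mul1r//; ring.
apply: (eq_oP _ (sample_variance_linearization indX idX intX intX2 (cmoment P (X 0%N) r))).
exists 1%N => // n _ w; rewrite -(ord1 i) E rE; congr (_ - _ * _).
apply: eq_bigr => k _; rewrite (ord1 i) coordR EY /Y /c -/mu rE.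
by rewrite subrr !mul0r !addr0.
Qed.

End influence_functions.

(** * Delta method, transfer of limits and the final assembly *)

Section delta_method.
Context {d : measure_display} {T : measurableType d} {R : realType}
  (P : probability T R).

Lemma innerE k (t v : 'rV[R]_k) : (t *m v^T) ord0 ord0 = \sum_j t ord0 j * v ord0 j.
Proof. by rewrite mxE; apply: eq_bigr => j _; rewrite mxE. Qed.

Lemma OP_all k (Y : 'I_k -> nat -> T -> R) (e : R) : (forall l, OP P (Y l)) -> 0 < e ->
  exists2 K : R, 0 < K & \forall n \near \oo, whp P e (fun w => forall l, `|Y l n w| <= K).
Proof.
move=> HY e0; have ek : 0 < e / k.+1%:R by rewrite divr_gt0.
have H l : exists K : R, 0 < K /\ \forall n \near \oo, whp P (e / k.+1%:R) (fun w => `|Y l n w| <= K).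
  by have [K K0 HK] := HY l _ ek; exists K.
have [K HK] := choice H.
exists (1 + \sum_l K l).
  by rewrite ltr_pwDl// sumr_ge0// => l _; exact: ltW (HK l).1.
have HA : \forall n \near \oo, forall l, whp P (e / k.+1%:R) (fun w => `|Y l n w| <= K l).
  by apply: filter_forall => l; exact: (HK l).2.
apply: filterS HA => n Hn.
apply: whp_mono (whp_forall (ltW ek) Hn).
  by rewrite mulrCA ger_pMr// ler_pdivrMr// mul1r ler_nat.
move=> w Hw l; apply: le_trans (Hw l) _; rewrite (bigD1 l)//=.
have : 0 <= \sum_(j | j != l) K j by apply: sumr_ge0 => j _; exact: ltW (HK j).1.
lra.
Qed.

(** Off an exceptional set the estimation error [v] has norm at most [K / sqrt n]. Differentiability
    with precision [e / K] bounds the remainder by [e / sqrt n], which is [e] after scaling. *)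
Lemma delta_method k k' (zh : nat -> T -> 'rV[R]_k) (z0 : 'rV[R]_k)
    (h : 'rV[R]_k -> 'rV[R]_k') : differentiable h z0 ->
  (forall j, OP P (fun n w => Num.sqrt n%:R * (zh n w ord0 j - z0 ord0 j))) ->
  forall l, oP P (fun n w => (Num.sqrt n%:R *: (h (zh n w) - h z0)) ord0 l -
     ((Num.sqrt n%:R *: (zh n w - z0)) *m 'J h z0) ord0 l).
Proof.
move=> dh Oz l e del e0 del0.
have [K K0 HK] := OP_all Oz del0.
have eK : 0 < e / K by rewrite divr_gt0.
have [ep ep0 Hexp] := diff_expansion dh eK.
have yK : (Num.sqrt n%:R)^-1 * K @[n --> \oo] --> (0 : R).
  by rewrite -(mul0r K); apply: cvgMr_tmp; exact: cvg_invsqrt.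
near=> n.
have n0 : (0 < n)%N by near: n; exact: nbhs_infty_gt.
have sn : 0 < Num.sqrt n%:R :> R by rewrite sqrtr_gt0 ltr0n.
have yKn : (Num.sqrt n%:R)^-1 * K <= ep.
  apply: le_trans (ler_norm _) _.
  by rewrite -normrN -sub0r; near: n; exact: (cvgr_dist_le _ _ yK _ ep0).
have : whp P del (fun w => forall j, `|Num.sqrt n%:R * (zh n w ord0 j - z0 ord0 j)| <= K).
  by near: n.
apply: whp_mono => // w Hw.
set v := zh n w - z0.
have vK : `|v| <= (Num.sqrt n%:R)^-1 * K.
  apply: rV_norm_le => [|j]; first by rewrite mulr_ge0 ?invr_ge0 ?(ltW sn) ?(ltW K0).
  have := Hw j; rewrite normrM gtr0_norm// => hj.
  by rewrite /v !mxE [leRHS]mulrC ler_pdivlMr// mulrC.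
have zE : z0 + v = zh n w by rewrite /v addrC subrK.
have := Hexp v (le_trans vK yKn); rewrite zE => hv.
have -> : (Num.sqrt n%:R *: (h (zh n w) - h z0)) ord0 l -
     ((Num.sqrt n%:R *: v) *m 'J h z0) ord0 l =
   Num.sqrt n%:R * (h (zh n w) - h z0 - 'd h z0 v) ord0 l.
  by rewrite -scalemxAl /jacobian mul_rV_lin1 !mxE -mulrBr.
rewrite normrM gtr0_norm//.
apply: (@le_trans _ _ (Num.sqrt n%:R * (e / K * ((Num.sqrt n%:R)^-1 * K)))).
  apply: ler_wpM2l; first exact: ltW.
  apply: le_trans (coord_le_norm _ _) _; apply: le_trans hv _.
  by apply: ler_wpM2l => //; exact: ltW.
rewrite le_eqVlt; apply/orP; left; apply/eqP; field.
by rewrite !lt0r_neq0.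
Unshelve. all: by end_near. Qed.

(** Slutsky's argument for the 1-Lipschitz functions bounded by one that characteristic functions
    involve, namely [cos] and [sin]. *)
Lemma cvg_mean_transfer (tf : R -> R) (Y1 Y2 : nat -> T -> R) (l : R) :
  (forall a b, `|tf a - tf b| <= `|a - b|) -> (forall a, `|tf a| <= 1) ->
  (forall n, measurable_fun setT (fun w => tf (Y1 n w))) ->
  (forall n, measurable_fun setT (fun w => tf (Y2 n w))) ->
  oP P (fun n w => Y1 n w - Y2 n w) ->
  \int[P]_w tf (Y2 n w) @[n --> \oo] --> l -> \int[P]_w tf (Y1 n w) @[n --> \oo] --> l.
Proof.
move=> lip t1 m1 m2 H12 /cvgrPdist_le c2; apply/cvgrPdist_le => e e0.
have e6 : 0 < e / 6 by rewrite divr_gt0.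
have e2 : 0 < e / 2 by rewrite divr_gt0.
have H := H12 _ _ e6 e6.
near=> n.
have h1 : `|l - \int[P]_w tf (Y2 n w)| <= e / 2 by near: n; exact: c2.
have h2 : whp P (e / 6) (fun w => `|Y1 n w - Y2 n w| <= e / 6) by near: n.
have i1 := bounded_integrable P (m1 n) (fun w => t1 _).
have i2 := bounded_integrable P (m2 n) (fun w => t1 _).
have h3 : `|\int[P]_w (tf (Y1 n w) - tf (Y2 n w))| <= e / 6 + 2 * (e / 6).
  apply: norm_Rintegral_whp => //.
  - exact: measurable_funB.
  - move=> w; apply: le_trans (ler_normB _ _) _.
    by have := t1 (Y1 n w); have := t1 (Y2 n w); lra.
  - exact: ltW.
  - by apply: whp_mono h2 => // w; exact: le_trans.
rewrite (integrable_RintegralB i1 i2).2 in h3.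
move: h1 h3; rewrite !ler_norml => /andP[? ?] /andP[? ?].
by apply/andP; split; lra.
Unshelve. all: by end_near. Qed.

Lemma lipschitz_sin (a b : R) : `|sin a - sin b| <= `|a - b|.
Proof.
have -> : sin a - sin b = 2 * (cos ((a + b) / 2) * sin ((a - b) / 2)).
  have key (x y : R) : sin (x + y) - sin (x - y) = 2 * (cos x * sin y).
    by rewrite sinB sinD; ring.
  by rewrite -key; congr (sin _ - sin _); field.
rewrite !normrM (ger0_norm (ler0n _ 2)).
have h1 := cos_max ((a + b) / 2); have h2 := norm_sin_le ((a - b) / 2).
apply: (@le_trans _ _ (2 * (1 * `|(a - b) / 2|))); first by rewrite ler_pM2l// ler_pM.
rewrite normrM (ger0_norm (_ : 0 <= 2^-1))//; lra.
Qed.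

Lemma lipschitz_cos (a b : R) : `|cos a - cos b| <= `|a - b|.
Proof.
rewrite -!sinDpihalf; apply: le_trans (lipschitz_sin _ _) _.
by rewrite opprD addrACA subrr addr0.
Qed.

Lemma rV_continuous k k' (h : 'rV[R]_k -> 'rV[R]_k') :
  (forall i, continuous (fun z => h z ord0 i)) -> continuous h.
Proof.
move=> ch z; have FF : Filter (nbhs z) by exact: nbhs_filter.
apply/cvgrPdist_le => e e0.
have H : \forall z' \near z, forall i, `|h z ord0 i - h z' ord0 i| <= e.
  apply: (@filter_forall _ _ _ (nbhs z) FF) => i.
  exact: (@cvgr_dist_le _ _ _ (nbhs z) FF _ _ (ch i z) _ e0).
apply: (@filterS _ (nbhs z) FF _ _ _ H) => z' {}H; apply: rV_norm_le => [|i]; first exact: ltW.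
by rewrite !mxE.
Qed.

Lemma measurable_zhat (X : nat -> {RV P >-> R}) m (p : 'I_m -> R) r n :
  (forall i, 0 < p i < 1) ->
  forall j, measurable_fun setT (fun w => zhat_vec X p r n w ord0 j).
Proof.
move=> p01 j; have mX i : measurable_fun setT (X i) by exact: measurable_funPT.
rewrite /zhat_vec; case: (split_ordP j) => i ->.
  under eq_fun do rewrite row_mxEl mxE.
  exact: measurable_sample_quantile.
under eq_fun do rewrite row_mxEr mxE.
have ms : measurable_fun setT (sample_mean (fun k => X k : T -> R) n).
  by apply: measurable_funM => //; apply: measurable_sum => k.
apply: measurable_funM => //; apply: measurable_sum => k; apply: measurable_funX.
by apply: (measurableT_comp (@normr_measurable R setT)); exact: measurable_funB.
Qed.

End delta_method.

Section quadratic_form.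
Context {d : measure_display} {T : measurableType d} {R : realType}
  (P : probability T R).

Lemma integral_quadratic_form k (xi : T -> 'rV[R]_k) (S : 'M[R]_k) (u : 'rV[R]_k) :
  (forall j, measurable_fun setT (fun w => xi w ord0 j)) ->
  (forall j, P.-integrable setT (EFin \o (fun w => xi w ord0 j ^+ 2))) ->
  (forall j l, \int[P]_w (xi w ord0 j * xi w ord0 l) = S j l) ->
  P.-integrable setT (EFin \o (fun w => (\sum_j u ord0 j * xi w ord0 j) ^+ 2)) /\
  \int[P]_w ((\sum_j u ord0 j * xi w ord0 j) ^+ 2) = (u *m S *m u^T) ord0 ord0.
Proof.
move=> mxi ixi Sxi.
have i2 j l := integrable_sq_mul (mxi j) (mxi l) (ixi j) (ixi l).
have z j l := integrable_RintegralZl (u ord0 j * u ord0 l) (i2 j l).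
have s1 l := integrable_sum_Rintegral (index_enum (ordinal k)) (fun j : 'I_k => (z j l).1).
have [q1 q2] := integrable_sum_Rintegral (index_enum (ordinal k)) (fun l : 'I_k => (s1 l).1).
have E : (fun w => (\sum_j u ord0 j * xi w ord0 j) ^+ 2) = fun w =>
    \sum_l \sum_j u ord0 j * u ord0 l * (xi w ord0 j * xi w ord0 l).
  apply/funext => w; rewrite expr2 mulr_sumr; apply: eq_bigr => l _.
  by rewrite mulr_suml; apply: eq_bigr => j _; ring.
rewrite E; split => //; rewrite q2 mxE; apply: eq_bigr => l _.
rewrite (s1 l).2 !mxE mulr_suml; apply: eq_bigr => j _.
by rewrite (z j l).2 Sxi; ring.
Qed.

End quadratic_form.

Theorem theorem5 (d : measure_display) (T : measurableType d) (R : realType)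
  (P : probability T R) (X : nat -> {RV P >-> R})
  (m : nat) (p : 'I_m -> R) (r : nat)
  (h : 'rV[R]_(m + 1) -> 'rV[R]_(m + 1)) :
  (* X_1, X_2, ... iid with parent X := X 0 *)
  mutually_independent P (fun i => X i : T -> R) ->
  identically_distributed P (fun i => X i : T -> R) ->
  (* finite mean and variance *)
  P.-integrable setT (EFin \o (X 0%N : T -> R)) ->
  P.-integrable setT (EFin \o (fun w => X 0%N w ^+ 2)) ->
  (* 0 < m, 0 < p_1 < ... < p_m < 1 *)
  (0 < m)%N ->
  (forall i, 0 < p i < 1) ->
  (forall i j : 'I_m, (i < j)%N -> p i < p j) ->
  (* r in {1, 2} *)
  (r = 1%N \/ r = 2%N) ->
  (* F_X differentiable at q_X(p_i) with f_X(q_X(p_i)) > 0 *)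
  (forall i, derivable (cdfR (X 0%N)) (quantile (X 0%N) (p i)) 1) ->
  (forall i, 0 < dens (X 0%N) (quantile (X 0%N) (p i))) ->
  (* E[X^{2r}] < oo *)
  P.-integrable setT (EFin \o (fun w => X 0%N w ^+ (2 * r))) ->
  (* if r = 1, the density exists and is positive at mu *)
  (r = 1%N ->
     derivable (cdfR (X 0%N)) (meanR P (X 0%N)) 1 /\
     0 < dens (X 0%N) (meanR P (X 0%N))) ->
  (* h has continuous components, differentiable at z0 *)
  (forall i : 'I_(m + 1), continuous (fun z => h z ord0 i)) ->
  differentiable h (z0_vec (X 0%N) p r) ->
  (* conclusion; J := ('J h z0)^T is the Jacobian matrix (dh_i/dz_j) *)
  let z0 := z0_vec (X 0%N) p r in
  let J := ('J h z0)^T in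
  cvg_in_law_normal P
    (fun n w => Num.sqrt n%:R *: (h (zhat_vec X p r n w) - h z0))
    (J *m Sigma_mr (X 0%N) p r *m J^T).
Proof.
move=> indX idX intX intX2 _ p01 pinc r12 dF f0 intX2r dmu ch dh z0 J
  d' T' Q Z [mZ charZ] g cg [M gM].
have {}dmu : r = 1%N -> derivable (cdfR (X 0%N)) (meanR P (X 0%N)) 1 by move=> /dmu[].
pose Y n w := Num.sqrt n%:R *: (h (zhat_vec X p r n w) - h z0).
pose Dl n w := Num.sqrt n%:R *: (zhat_vec X p r n w - z0).
pose xi := influence X p r.
have mxi := @measurable_influence _ _ _ P X m p r.
have ixi : forall j, P.-integrable setT (EFin \o (fun w => xi (X 0%N w) ord0 j ^+ 2)).
  exact: integrable_influence_sq.
have xi0 : forall j, \int[P]_w xi (X 0%N w) ord0 j = 0.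
  exact: influence_mean0.
have cxi : forall j l, \int[P]_w (xi (X 0%N w) ord0 j * xi (X 0%N w) ord0 l) =
    Sigma_mr (X 0%N) p r j l.
  exact: influence_covariance.
have lin : forall j, oP P (fun n w => Num.sqrt n%:R * (zhat_vec X p r n w ord0 j - z0 ord0 j)
    - (Num.sqrt n%:R)^-1 * \sum_(i < n) xi (X i w) ord0 j).
  exact: influence_linearization.
have OD j : OP P (fun n w => Num.sqrt n%:R * (zhat_vec X p r n w ord0 j - z0 ord0 j)).
  have H := OPD (oP_OP (lin j)) (OP_iid indX idX (mxi j) (ixi j) (xi0 j)).
  rewrite (_ : (fun n w => _) = fun n w => (Num.sqrt n%:R *
    (zhat_vec X p r n w ord0 j - z0 ord0 j) - (Num.sqrt n%:R)^-1 *
    \sum_(i < n) xi (X i w) ord0 j) + (Num.sqrt n%:R)^-1 * \sum_(i < n) xi (X i w) ord0 j).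
    exact: H.
  by apply/funext => n; apply/funext => w; rewrite subrK.
have dm := delta_method dh OD.
have mz n := @measurable_zhat _ _ _ P X m p r n p01.
have chh : continuous h by exact: rV_continuous.
(* Measurability goes through the estimators: [G \o Y n] is a bounded continuous function of
   [zhat_vec], whose coordinates are measurable. *)
have mg n (G : 'rV[R]_(m + 1) -> R) (C : R) : continuous G -> (forall x, `|G x| <= C) ->
    measurable_fun setT (G \o Y n).
  move=> cG GC; pose G' z := G (Num.sqrt n%:R *: (h z - h z0)).
  apply: (@measurable_continuous_bounded _ _ _ _ (zhat_vec X p r n) G' C (mz n)) => //.
    move=> z; rewrite /G'.
    apply: (@continuous_comp _ _ _ (fun z => Num.sqrt n%:R *: (h z - h z0)) G); last exact: cG.
    apply: continuousZr; apply: continuousB; first exact: chh.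
    exact: cst_continuous.
  by move=> z; exact: GC.
(* Tightness of [Y n] is inherited from that of the scaled estimation errors through the linear map
   ['J h z0], up to the delta-method error. *)
have tY (e : R) : 0 < e -> exists2 K : R, 0 < K & \forall n \near \oo,
     whp P e (fun w => forall i, `|Y n w ord0 i| <= K).
  apply: (@OP_all _ _ _ P _ (fun l n w => Y n w ord0 l)) => l.
  have H1 : OP P (fun n w => (Dl n w *m 'J h z0) ord0 l).
    rewrite (_ : (fun n w => _) = fun n w => \sum_j (Num.sqrt n%:R *
        (zhat_vec X p r n w ord0 j - z0 ord0 j)) * 'J h z0 j l).
      by apply: OP_sum => j; exact: OPMM (OD j) (OP_cst P _).
    apply/funext => n; apply/funext => w; rewrite mxE; apply: eq_bigr => j _.
    by rewrite !mxE.
  have H := OPD (oP_OP (dm l)) H1.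
  rewrite (_ : (fun n w => _) = fun n w => (Y n w ord0 l - (Dl n w *m 'J h z0) ord0 l) +
    (Dl n w *m 'J h z0) ord0 l); first exact: H.
  by apply/funext => n; apply/funext => w; rewrite subrK.
(* Cramer-Wold reduction: vectors are rows, so testing [Y n] against [t] amounts to testing the
   influence vector against [u = t *m J], which is a scalar iid sum. *)
have key (t : 'rV[R]_(m + 1)) : let u := t *m J in
    let U z := \sum_j u ord0 j * xi z ord0 j in
    [/\ \int[P]_w cos ((t *m (Y n w)^T) ord0 ord0) @[n --> \oo] -->
         expR (- ((t *m (J *m Sigma_mr (X 0%N) p r *m J^T) *m t^T) ord0 ord0) / 2) &
        \int[P]_w sin ((t *m (Y n w)^T) ord0 ord0) @[n --> \oo] --> (0 : R)].
  move=> u U.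
  have mU : measurable_fun setT U.
    by apply: measurable_sum => j; apply: measurable_funM => //; exact: mxi.
  have mxiX j : measurable_fun setT (fun w => xi (X 0%N w) ord0 j).
    exact: (measurableT_comp (mxi j) (measurable_funPT (X 0%N))).
  have [iU2 EU2] := integral_quadratic_form u mxiX ixi cxi.
  have U0 : \int[P]_w U (X 0%N w) = 0.
    have ii j := integrable_RintegralZl (u ord0 j) (integrable_of_sq (mxiX j) (ixi j)).
    rewrite (integrable_sum_Rintegral (index_enum (ordinal (m + 1))) (fun j => (ii j).1)).2.
    by rewrite big1// => j _; rewrite (ii j).2 xi0 mulr0.
  have [cc cs] := clt_charfun indX idX mU iU2 U0.
  have uE : (t *m (J *m Sigma_mr (X 0%N) p r *m J^T) *m t^T) ord0 ord0 =
      \int[P]_w (U (X 0%N w) ^+ 2).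
    by rewrite EU2 /u trmx_mul !mulmxA.
  (* Two approximations are added: the delta method weighted by [t] and the linearisation of the
     estimators weighted by [u]. The intermediate linear term in [Dl n] cancels. *)
  have lin_t : oP P (fun n w => (t *m (Y n w)^T) ord0 ord0 -
      (Num.sqrt n%:R)^-1 * \sum_(i < n) U (X i w)).
    have H1 := oP_sum (index_enum (ordinal (m + 1))) (fun l => oPZ (t ord0 l) (dm l)).
    have H2 := oP_sum (index_enum (ordinal (m + 1))) (fun j => oPZ (u ord0 j) (lin j)).
    apply: eq_oP (oPD H1 H2); exists 1%N => // n _ w.
    have -> : \sum_l t ord0 l * (Y n w ord0 l - (Dl n w *m 'J h z0) ord0 l) =
        (t *m (Y n w)^T) ord0 ord0 - (u *m (Dl n w)^T) ord0 ord0.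
      have -> : u *m (Dl n w)^T = t *m (Dl n w *m 'J h z0)^T.
        by rewrite trmx_mul /u /J mulmxA.
      by rewrite !innerE -sumrB; apply: eq_bigr => l _; rewrite mulrBr.
    have -> : \sum_j u ord0 j * (Num.sqrt n%:R * (zhat_vec X p r n w ord0 j - z0 ord0 j) -
         (Num.sqrt n%:R)^-1 * \sum_(i < n) xi (X i w) ord0 j) =
       (u *m (Dl n w)^T) ord0 ord0 - (Num.sqrt n%:R)^-1 * \sum_(i < n) U (X i w).
      rewrite innerE /U exchange_big/= mulr_sumr -sumrB; apply: eq_bigr => j _.
      have -> : Dl n w ord0 j = Num.sqrt n%:R * (zhat_vec X p r n w ord0 j - z0 ord0 j).
        by rewrite /Dl mxE; congr (_ * _); rewrite mxE; congr (_ + _); rewrite mxE.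
      by rewrite mulrBr -mulr_sumr; congr (_ - _); exact: mulrCA.
    by ring.
  have mc (tf : R -> R) : continuous tf -> measurable_fun setT tf.
    by move=> ctf; exact: continuous_measurable_fun.
  have mS n : measurable_fun setT (fun w => (Num.sqrt n%:R)^-1 * \sum_(i < n) U (X i w)).
    apply: measurable_funM => //; apply: measurable_sum => i.
    exact: (measurableT_comp mU (measurable_funPT (X i))).
  rewrite uE; split.
  - apply: (cvg_mean_transfer lipschitz_cos (@cos_max R) _ _ lin_t cc) => n.
      apply: (mg n _ 1 (trigpoly_continuous (trigpoly_cos t))) => x; exact: cos_max.
    exact: (measurableT_comp (mc _ (@continuous_cos R)) (mS n)).
  - apply: (cvg_mean_transfer lipschitz_sin (@sin_max R) _ _ lin_t cs) => n.
      apply: (mg n _ 1 (trigpoly_continuous (trigpoly_sin t))) => x; exact: sin_max.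
    exact: (measurableT_comp (mc _ (@continuous_sin R)) (mS n)).
have EQ (f : T' -> R) (a : R) : 'E_Q[f]%E = a%:E -> \int[Q]_w f w = a.
  by rewrite unlock /Rintegral => ->.
have mgZ := measurable_continuous_bounded mZ cg gM.
rewrite (expectation_Rintegral (bounded_integrable Q mgZ (fun w => gM _))).
under eq_fun => n.
  rewrite (expectation_Rintegral (bounded_integrable P (mg n _ _ cg gM) (fun w => gM _))).
  over.
apply: cvg_EFin; first by near=> n.
apply: (levy_continuity mg mZ tY _ _ cg gM) => t.
- by rewrite (EQ _ _ (charZ t).1); have [] := key t.
- by rewrite (EQ _ _ (charZ t).2); have [] := key t.
Unshelve. all: by end_near. Qed.
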